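(* Let $n\ge 2$, let $\Omega\subset\mathbb R^n$ be a bounded Lipschitz domain, $T>0$, $\nu>0$ and $Q_T=\Omega\times(0,T)$. Assume $b\in L_2(Q_T)$ (with values in $\mathbb R^n$), $u_0\in L_2(\Omega)$, $f\in L_1(Q_T)$, and $\operatorname{div} b\le 0$ in $\mathcal D'(Q_T)$. Let $u$ be a weak solution to the problem $$\partial_t u-\nu\Delta u+b\cdot\nabla u=f \ \text{ in } Q_T,\qquad u|_{\partial\Omega\times(0,T)}=0,\qquad u|_{t=0}=u_0.$$ Then $u\in C([0,T];L_1(\Omega))$ and for any $0\le t_1\le t_2\le T$ $$\|u(\cdot,t_2)\|_{L_1(\Omega)}\le\|u(\cdot,t_1)\|_{L_1(\Omega)}+\int_{t_1}^{t_2}\int_\Omega|f(x,t)|\,dxdt.$$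
   Context: $\overset{\circ}{W}{}^1_2(\Omega)$ is the closure of $C_0^\infty(\Omega)$ in the Sobolev space $W^1_2(\Omega)$. $\nabla$ is the gradient in $x$. The condition $\operatorname{div} b\le 0$ in $\mathcal D'(Q_T)$ means $\int_{Q_T} b\cdot\nabla\eta\,dxdt\ge 0$ for all $\eta\in C_0^\infty(Q_T)$ with $\eta\ge 0$. Weak solution: for $b\in L_2(Q_T)$, $u_0\in L_2(\Omega)$, $f\in L_1(Q_T)$, a scalar function $u$ on $Q_T$ is a weak solution of the problem if $u\in L_\infty(0,T;L_2(\Omega))\cap L_2(0,T;\overset{\circ}{W}{}^1_2(\Omega))$ and $$\int_{Q_T}\big(-u\,\partial_t\eta+\nu\nabla u\cdot\nabla\eta\big)\,dxdt+\int_{Q_T} b\cdot\nabla u\,\eta\,dxdt=\int_\Omega u_0(x)\eta(x,0)\,dx+\int_{Q_T} f\eta\,dxdt$$ for all $\eta\in C_0^\infty(\Omega\times[0,T))$. $u\in C([0,T];L_1(\Omega))$ means that, after redefinition on a null set of times, $t\mapsto u(\cdot,t)$ is continuous from $[0,T]$ to $L_1(\Omega)$ in norm; the values $u(\cdot,t)$ in the estimate are those of this representative. *)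

(* Defs.v *)
From HB Require Import structures.
From mathcomp Require Import all_boot all_order all_algebra.
From mathcomp Require Import all_classical all_reals all_analysis.
Set Implicit Arguments.
Unset Strict Implicit.
Unset Printing Implicit Defensive.
Import Order.TTheory GRing.Theory Num.Theory.
Import numFieldNormedType.Exports.
Local Open Scope classical_set_scope.
Local Open Scope ring_scope.

(* The sigma-algebra on R^n generated by the coordinates, i.e. the Borel
   sigma-algebra.  Elements of L_p are thus given by Borel representatives;
   every Lebesgue-measurable function is a.e. equal to a Borel one. *)
Definition rV_display : measure_display.
Proof. exact: default_measure_display. Qed.

Section measurable_rV.
Context {R : realType} (n : nat).

Let coords : 'I_n -> 'rV[R]_n -> measurableTypeR R := fun i x => x 0 i.

Let rV_set0 : g_sigma_preimage coords set0.
Proof. exact: sigma_algebra0. Qed.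

Let rV_setC A : g_sigma_preimage coords A -> g_sigma_preimage coords (~` A).
Proof. exact: sigma_algebraC. Qed.

Let rV_bigcup (F : _^nat) : (forall i, g_sigma_preimage coords (F i)) ->
  g_sigma_preimage coords (\bigcup_i (F i)).
Proof. exact: sigma_algebra_bigcup. Qed.

HB.instance Definition _ := @isMeasurable.Build rV_display
  'rV[R]_n (g_sigma_preimage coords) rV_set0 rV_setC rV_bigcup.

Lemma measurable_coord (i : 'I_n) :
  measurable_fun [set: 'rV[R]_n] (fun x => x 0 i : measurableTypeR R).
Proof.
move=> _ Y mY; rewrite setTI; apply: sub_sigma_algebra => /=.
rewrite -bigcup_seq/=; exists i => /=; first by rewrite mem_index_enum.
by exists Y => //; rewrite setTI.
Qed.

Lemma measurable_fun_coordP d (T : measurableType d) (f : T -> 'rV[R]_n) :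
  (forall i, measurable_fun setT (fun x => f x 0 i : measurableTypeR R)) ->
  measurable_fun setT f.
Proof.
move=> mf; suff : g_sigma_preimage (fun i => coords i \o f) `<=` measurable.
  rewrite g_sigma_preimage_comp => prefS _ A mA.
  by apply: prefS; exists A.
apply: smallest_sub; first exact: sigma_algebra_measurable.
rewrite -bigcup_seq; apply: bigcup_sub => i _.
by move=> A [B mB <-]; exact: mf.
Qed.

End measurable_rV.

Section lebesgue_rV.
Context {R : realType}.

Definition consrV n (p : measurableTypeR R * 'rV[R]_n) : 'rV[R]_n.+1 :=
  \row_i if unlift ord0 i is Some j then p.2 0 j else p.1.

Definition unconsrV n (x : 'rV[R]_n.+1) : measurableTypeR R * 'rV[R]_n :=
  (x 0 ord0, \row_j x 0 (lift ord0 j)).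

Lemma consrVK n : cancel (@consrV n) (@unconsrV n).
Proof.
move=> [a x]; rewrite /unconsrV mxE unlift_none; congr pair.
by apply/rowP => j; rewrite !mxE liftK.
Qed.

Lemma measurable_consrV n : measurable_fun setT (@consrV n).
Proof.
apply: measurable_fun_coordP => i.
have [j ->|->] := unliftP ord0 i.
  rewrite (_ : (fun _ => _) = (fun x : 'rV[R]_n => x 0 j : measurableTypeR R) \o snd).
    by apply: measurableT_comp => //; exact: measurable_coord.
  by apply/funext => p /=; rewrite mxE liftK.
rewrite (_ : (fun _ => _) = fst)//.
by apply/funext => p /=; rewrite mxE unlift_none.
Qed.

Lemma measurable_unconsrV n : measurable_fun setT (@unconsrV n).
Proof.
apply/measurable_fun_pairP; split => /=; first exact: measurable_coord.
apply: measurable_fun_coordP => i /=.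
rewrite (_ : (fun _ => _) = fun x : 'rV[R]_n.+1 => x 0 (lift ord0 i)).
  exact: measurable_coord.
by apply/funext => x; rewrite mxE.
Qed.

Section step.
Local Open Scope ereal_scope.
Context n (mu : {sigma_finite_measure set 'rV[R]_n -> \bar R}).

Definition lebesgue_step : set 'rV[R]_n.+1 -> \bar R :=
  pushforward (@lebesgue_measure R \x mu) (@consrV n).

Let preim A : measurable A -> measurable (@consrV n @^-1` A).
Proof. by move=> mA; rewrite -[X in measurable X]setTI; exact: measurable_consrV. Qed.

Let step0 : lebesgue_step set0 = 0.
Proof. by rewrite /lebesgue_step /pushforward preimage_set0 measure0. Qed.

Let step_ge0 A : 0 <= lebesgue_step A.
Proof. by rewrite /lebesgue_step /pushforward; apply: measure_ge0. Qed.

Let step_sigma_additive : semi_sigma_additive lebesgue_step.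
Proof.
move=> F mF tF mUF; rewrite /lebesgue_step /pushforward preimage_bigcup.
apply: measure_semi_sigma_additive.
- by move=> k; exact: preim.
- apply/trivIsetP => /= i j _ _ ij; rewrite -preimage_setI.
  by move/trivIsetP : tF => /(_ _ _ _ _ ij) ->//; rewrite preimage_set0.
- by rewrite -preimage_bigcup; exact: preim.
Qed.

HB.instance Definition _ := isMeasure.Build _ _ _ lebesgue_step
  step0 step_ge0 step_sigma_additive.

Let step_sigma_finite : sigma_finite setT lebesgue_step.
Proof.
have /sigma_finiteP[F [TF ndF Foo]] := sigma_finiteT (@lebesgue_measure R).
have /sigma_finiteP[G [TG ndG Goo]] := sigma_finiteT mu.
exists (fun k => @unconsrV n @^-1` (F k `*` G k)) => [|k].
  rewrite -preimage_bigcup (_ : \bigcup_k _ = setT) ?preimage_setT//.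
  rewrite -subTset => -[a x] _.
  have [i _ Fia] : (\bigcup_i F i) a by rewrite -TF.
  have [j _ Gjx] : (\bigcup_j G j) x by rewrite -TG.
  exists (maxn i j) => //; split => /=.
    by move: a Fia; exact/subsetPset/ndF/leq_maxl.
  by move: x Gjx; exact/subsetPset/ndG/leq_maxr.
have [[mF Fk] [mG Gk]] := (Foo k, Goo k).
have mFG := measurableX mF mG; split.
  by rewrite -[X in measurable X]setTI; exact: measurable_unconsrV.
rewrite /lebesgue_step /pushforward -comp_preimage (_ : _ \o _ = id); last first.
  by apply/funext => p; exact: consrVK.
by rewrite preimage_id product_measure1E// lte_mul_pinfty// ge0_fin_numE.
Qed.

HB.instance Definition _ := Measure_isSigmaFinite.Build _ _ _ lebesgue_step
  step_sigma_finite.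

End step.

Fixpoint lebesgue_rV n : {sigma_finite_measure set 'rV[R]_n -> \bar R} :=
  match n with
  | 0 => \d_(0 : 'rV[R]_0)
  | n.+1 => lebesgue_step (lebesgue_rV n)
  end.

Lemma lebesgue_rV_box n (A : 'I_n -> set (measurableTypeR R)) :
  (forall i, measurable (A i)) ->
  lebesgue_rV n [set x | forall i, A i (x 0 i)] =
  (\big[*%E/1]_(i < n) lebesgue_measure (A i))%E.
Proof.
elim: n A => [|n ih] A mA /=.
  by rewrite big_ord0 diracE mem_set// => -[].
rewrite big_ord_recl /lebesgue_step /pushforward.
rewrite (_ : _ @^-1` _ = A ord0 `*`
  [set x : 'rV[R]_n | forall i, A (lift ord0 i) (x 0 i)]); last first.
  apply/seteqP; split => [p /= Ap|p /= [A0 Ap] i].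
    split; first by have := Ap ord0; rewrite mxE unlift_none.
    by move=> i; have := Ap (lift ord0 i); rewrite mxE liftK.
  by rewrite mxE; case: unliftP => [j ->|->].
rewrite product_measure1E//; first by congr (_ * _)%E; apply: ih.
rewrite (_ : [set _ | _] = \bigcap_(i in [set: 'I_n])
  ((fun x : 'rV[R]_n => x 0 i : measurableTypeR R) @^-1` A (lift ord0 i))).
  apply: fin_bigcap_measurable => // i _.
  by rewrite -[X in measurable X]setTI; exact: measurable_coord.
by apply/seteqP; split => [x /= Ax i _|x /= Ax i]; exact: Ax.
Qed.

End lebesgue_rV.

Section smooth_functions.
Context {R : realType} {V : normedModType R}.

Definition iter_derive (vs : seq V) (phi : V -> R) : V -> R :=
  foldr (fun v psi => fun x => 'D_v psi x) phi vs.

(* For finite-dimensional V this is C^oo(V). *)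
Definition smooth (phi : V -> R) := forall vs : seq V,
  continuous (iter_derive vs phi) /\
  forall x v, derivable (iter_derive vs phi) x v.

(* C_0^oo(D), with functions extended by 0 to the whole space *)
Definition test_function (D : set V) (phi : V -> R) :=
  [/\ smooth phi, compact (closure [set x | phi x != 0]) &
      closure [set x | phi x != 0] `<=` D].

End smooth_functions.

Section domains.
Context {R : realType} (n : nat).

(* Near every boundary point, after an orthogonal change of coordinates,
   Omega is the region above the graph of a Lipschitz function of the
   coordinates other than the i-th one. *)
Definition lipschitz_boundary (Omega : set 'rV[R]_n) :=
  forall x0, (closure Omega `\` Omega°) x0 ->
  exists (O : 'M[R]_n) (i : 'I_n) (gamma : 'rV[R]_n.-1 -> R),
  [/\ O *m O^T = 1%:M, lipschitz gamma &
      \forall x \near x0,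
        Omega x <-> gamma (col' i (x *m O)) < (x *m O) 0 i].

Definition bounded_lipschitz_domain (Omega : set 'rV[R]_n) :=
  [/\ open Omega, connected Omega, Omega !=set0, bounded_set Omega &
      lipschitz_boundary Omega].

End domains.

Section sobolev.
Context {R : realType} {n : nat}.
Implicit Types (Omega : set 'rV[R]_n) (v : 'rV[R]_n -> R)
  (g : 'rV[R]_n -> 'rV[R]_n).

Definition dotrv (a c : 'rV[R]_n) : R := \sum_(i < n) a 0 i * c 0 i.

Definition Lp_on d (T : measurableType d) (mu : {measure set T -> \bar R})
  (p : R) (D : set T) (f : T -> R) := f \_ D \in Lfun mu p%:E.

Definition grad v : 'rV[R]_n -> 'rV[R]_n :=
  fun x => \row_i 'D_(delta_mx 0 i) v x.

Definition weak_grad Omega v g := forall phi, test_function Omega phi ->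
  forall i : 'I_n,
  \int[lebesgue_rV n]_(x in Omega) (v x * grad phi x 0 i) =
  - \int[lebesgue_rV n]_(x in Omega) (g x 0 i * phi x).

(* v is in W^1_2(Omega), with weak gradient g *)
Definition W12 Omega v g :=
  [/\ Lp_on (lebesgue_rV n) 2 Omega v,
      forall i, Lp_on (lebesgue_rV n) 2 Omega (fun x => g x 0 i) &
      weak_grad Omega v g].

Definition W12_sqnorm Omega v g : \bar R :=
  (\int[lebesgue_rV n]_(x in Omega) (v x ^+ 2 + dotrv (g x) (g x))%:E)%E.

(* v is in the closure of C_0^oo(Omega) in W^1_2(Omega) *)
Definition W12_0 Omega v g := W12 Omega v g /\
  forall e : R, 0 < e -> exists2 phi, test_function Omega phi &
    (W12_sqnorm Omega (v \- phi)%R (g \- grad phi)%R < e%:E)%E.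

End sobolev.

Section parabolic_problem.
Context {R : realType} {n : nat}.
Implicit Types (Omega : set 'rV[R]_n) (T : R) (v : 'rV[R]_n -> R)
  (u : 'rV[R]_n * R -> R).

Definition QT Omega T : set ('rV[R]_n * R) := Omega `*` `]0, T[.

Definition lebesgue_xt :
    {measure set ('rV[R]_n * measurableTypeR R) -> \bar R} :=
  (lebesgue_rV n \x @lebesgue_measure R)%E.

Definition dt u : 'rV[R]_n * R -> R :=
  fun z => 'D_((0, 1) : 'rV[R]_n * R) u z.

Definition gradx u : 'rV[R]_n * R -> 'rV[R]_n :=
  fun z => \row_i 'D_((delta_mx 0 i, 0) : 'rV[R]_n * R) u z.

Definition div_le0 Omega T (b : 'rV[R]_n * R -> 'rV[R]_n) :=
  forall eta, test_function (QT Omega T) eta -> (forall z, 0 <= eta z) ->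
  0 <= \int[lebesgue_xt]_(z in QT Omega T) dotrv (b z) (gradx eta z).

Definition Loo_L2 Omega T u :=
  measurable_fun (QT Omega T : set ('rV[R]_n * measurableTypeR R))
    (u : _ -> measurableTypeR R) /\
  exists M : R, {ae @lebesgue_measure R, forall t, (0 < t < T)%R ->
    \int[lebesgue_rV n]_(x in Omega) ((u (x, t)) ^+ 2)%:E <= M%:E}%E.

(* u is in L_2(0, T; W°^1_2(Omega)), with spatial gradient g *)
Definition L2_W12_0 Omega T u (g : 'rV[R]_n * R -> 'rV[R]_n) :=
  [/\ measurable_fun (QT Omega T : set ('rV[R]_n * measurableTypeR R))
        (u : _ -> measurableTypeR R),
      forall i, measurable_fun
        (QT Omega T : set ('rV[R]_n * measurableTypeR R))
        ((fun z => g z 0 i) : _ -> measurableTypeR R),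
      {ae @lebesgue_measure R, forall t, 0 < t < T ->
        W12_0 Omega (fun x => u (x, t)) (fun x => g (x, t))} &
      (\int[@lebesgue_measure R]_(t in `]0%R, T[)
        W12_sqnorm Omega (fun x => u (x, t)) (fun x => g (x, t)) < +oo)%E].

(* C_0^oo(Omega x [0, T)) consists of the restrictions to t >= 0 of the
   functions of C_0^oo(Omega x (-oo, T)). *)
Definition weak_solution Omega T (nu : R) (b : 'rV[R]_n * R -> 'rV[R]_n)
    (u0 : 'rV[R]_n -> R) (f : 'rV[R]_n * R -> R) u :=
  Loo_L2 Omega T u /\
  exists2 g, L2_W12_0 Omega T u g &
  forall eta, test_function (Omega `*` `]-oo, T[) eta ->
  \int[lebesgue_xt]_(z in QT Omega T)
    (- u z * dt eta z + nu * dotrv (g z) (gradx eta z)) +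
  \int[lebesgue_xt]_(z in QT Omega T) (dotrv (b z) (g z) * eta z) =
  \int[lebesgue_rV n]_(x in Omega) (u0 x * eta (x, 0)) +
  \int[lebesgue_xt]_(z in QT Omega T) (f z * eta z).

Definition L1_norm Omega v : \bar R :=
  (\int[lebesgue_rV n]_(x in Omega) `|v x|%:E)%E.

(* w is a representative of u in C([0, T]; L_1(Omega)) *)
Definition C_L1_representative Omega T u (w : R -> 'rV[R]_n -> R) :=
  [/\ forall t, 0 <= t <= T -> Lp_on (lebesgue_rV n) 1 Omega (w t),
      forall t, 0 <= t <= T ->
        L1_norm Omega (fun x => w s x - w t x) @[s --> within `[0, T] (nbhs t)]
          --> 0%E &
      {ae @lebesgue_measure R, forall t, 0 < t < T ->
        {ae lebesgue_rV n, forall x, Omega x -> w t x = u (x, t)}}].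

End parabolic_problem.

(* Main.v *)
Require Import Defs.
From HB Require Import structures.
From mathcomp Require Import all_boot all_order all_algebra.
From mathcomp Require Import all_classical all_reals all_analysis.
From mathcomp Require Import measurable_realfun.
From mathcomp Require Import ring lra.
Set Implicit Arguments.
Unset Strict Implicit.
Unset Printing Implicit Defensive.
Import Order.TTheory GRing.Theory Num.Theory.
Import numFieldNormedType.Exports.
Local Open Scope classical_set_scope.
Local Open Scope ring_scope.

(** Formally one multiplies the equation by the sign of u. The diffusion
    contributes a nonnegative term, the transport term is the integral of
    b . grad |u|, which is nonnegative since div b <= 0, and what remains is
    d/dt |u|_1 <= |f|_1. The difficulty is that b is only square integrable, so that
    b . grad u is merely integrable, and a function of u is not an admissible test
    in the weak formulation. The sign is replaced by phi, the derivative of the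
    convex function Phi (s) = sqrt (s^2 + e^2) - e, and time is discretized.

    Products of a cutoff in time and a test function p (x) turn the weak
    formulation into an identity between the slices of u at two times s < t, for all
    times of a set G of full measure that does not depend on p (slice_identity). At
    fixed times the coefficients are integrable or square integrable in x and phi is
    bounded, so that phi (v) is allowed as a test for each v in the closure of the
    test functions in W^1_2 (closure_identity), in particular for v = u (t) - c.

    Continuity in time. For a slice c of u the convexity of Phi bounds the increments
    of the integral of Phi (u (t) - c) by testing with phi (u (t) - c) and with
    phi (u (s) - c). The bound contains (t - s) times the squared norms of the
    gradients at s and t; a subdivision of [s, t] at times where these norms
    are below their mean removes these terms (chain_bound), and only integrals over
    [s, t] remain. With c = u (r), for a suitable r between s and t, this yields the
    uniform continuity of u in L1 on G (unif_cont_L1), hence a continuous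
    representative.

    The estimate. The tested equation on the windows ]r - h, r], integrated over r in
    ]s, t] and divided by h, contains Steklov averages of drift and gradient, which
    converge in L1 and L2 (steklov_cvg_L1, steklov_cvg_L2). In the limit the diffusion
    is nonnegative, and so is the transport term: the averages in time of b are
    square integrable in x with nonpositive divergence, hence may be tested with
    Phi (u) (steklov_div_le0). The left side converges by the continuity just obtained
    (E0_growth); finally e tends to 0 (L1_norm_growth). *)

(** * Smooth functions on normed spaces *)

Section smooth_calculus.
Context {R : realType} {V : normedModType R}.
Implicit Types f g : V -> R.

Definition cont_derivable f := continuous f /\ forall x v, derivable f x v.

(** All iterated derivatives of a function of the class stay in the class. *)
Lemma smooth_class (C : (V -> R) -> Prop) : (forall f, C f -> cont_derivable f) ->
  (forall f v, C f -> C (fun x => 'D_v f x)) -> forall f, C f -> smooth f.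
Proof.
move=> Cd CD f Cf vs; suff : C (iter_derive vs f) by exact: Cd.
by elim: vs => [//|v vs ih]; exact: CD.
Qed.

(** The algebra of functions generated by B. Smoothness of compositions and
    quotients is reduced to the statement that the derivatives of the generators
    are polynomials in the generators. *)
Inductive gen_alg (B : (V -> R) -> Prop) : (V -> R) -> Prop :=
| gen_base f : B f -> gen_alg B f
| gen_cst c : gen_alg B (fun=> c)
| gen_add f g : gen_alg B f -> gen_alg B g -> gen_alg B (fun x => f x + g x)
| gen_mul f g : gen_alg B f -> gen_alg B g -> gen_alg B (fun x => f x * g x).

Lemma gen_ext B f g : f =1 g -> gen_alg B f -> gen_alg B g.
Proof. by move=> /funext ->. Qed.

(** By Leibniz' rule the derivations of the algebra are determined by their
    values on the generators, so that it suffices to differentiate these. *)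
Lemma gen_alg_smooth (B : (V -> R) -> Prop) : (forall f, B f -> cont_derivable f) ->
  (forall f v, B f -> gen_alg B (fun x => 'D_v f x)) ->
  forall f, gen_alg B f -> smooth f.
Proof.
move=> Bd BD.
have genD f : gen_alg B f -> cont_derivable f.
  elim => {f} [f /Bd//|c|f g _ [cf df] _ [cg dg]|f g _ [cf df] _ [cg dg]].
  - by split=> [x|x v]; [exact: cst_continuous|exact: derivable_cst].
  - by split=> [x|x v]; [apply: continuousD; [exact: cf|exact: cg]|exact: derivableD].
  - by split=> [x|x v]; [apply: continuousM; [exact: cf|exact: cg]|exact: derivableM].
apply: (smooth_class genD) => f v; elim => {f} [f /BD//|c|f g Bf gf Bg gg|f g Bf gf Bg gg].
- by apply: (gen_ext _ (gen_cst _ 0)) => x; rewrite derive_cst.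
- have [[_ df] [_ dg]] := (genD _ Bf, genD _ Bg).
  by apply: (gen_ext _ (gen_add gf gg)) => x; rewrite -deriveD.
- have [[_ df] [_ dg]] := (genD _ Bf, genD _ Bg).
  apply: (gen_ext _ (gen_add (gen_mul Bf gg) (gen_mul Bg gf))) => x.
  by rewrite deriveM.
Qed.

Lemma smooth_cont_derivable f : smooth f -> cont_derivable f.
Proof. by move=> /(_ [::]). Qed.

Lemma smooth_cont f : smooth f -> continuous f.
Proof. by move=> /smooth_cont_derivable[]. Qed.

Lemma smooth_derivable f x v : smooth f -> derivable f x v.
Proof. by move=> /smooth_cont_derivable[]. Qed.

Lemma smooth_D f v : smooth f -> smooth (fun x => 'D_v f x).
Proof.
move=> sf vs; have := sf (rcons vs v).
by rewrite /iter_derive foldr_rcons.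
Qed.

Let smooth_gen_alg f : gen_alg smooth f -> smooth f.
Proof.
apply: gen_alg_smooth => [? /smooth_cont_derivable//|? v sf].
exact/gen_base/smooth_D.
Qed.

Lemma smooth_cst c : smooth (fun _ : V => c).
Proof. exact/smooth_gen_alg/(gen_cst _ c). Qed.

Lemma smoothDf f g : smooth f -> smooth g -> smooth (fun x => f x + g x).
Proof. by move=> sf sg; apply/smooth_gen_alg/gen_add; apply: gen_base. Qed.

Lemma smoothMf f g : smooth f -> smooth g -> smooth (fun x => f x * g x).
Proof. by move=> sf sg; apply/smooth_gen_alg/gen_mul; apply: gen_base. Qed.

Lemma smoothBf f g : smooth f -> smooth g -> smooth (fun x => f x - g x).
Proof.
move=> sf sg; have -> : (fun x => f x - g x) = (fun x => f x + (-1) * g x).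
  by apply/funext => x; rewrite mulN1r.
exact: (smoothDf sf (smoothMf (smooth_cst _) sg)).
Qed.

Let derive_slice_quotient f x v :
  (fun h : R => h^-1 *: (((fun h : R => f (h *: v + x)) \o shift 0) (h *: 1)
     - (f (0 *: v + x)))) =
  (fun h => h^-1 *: ((f \o shift x) (h *: v) - f x)).
Proof.
by apply/funext => h /=; rewrite addr0 scale0r add0r /GRing.scale /= mulr1.
Qed.

(** On the line through x with direction v this is the one-variable chain rule. *)
Lemma is_derive_dir_comp (F : R -> R) f x v a :
  is_derive (f x) 1 F a -> derivable f x v ->
  is_derive x v (fun y => F (f y)) (a * 'D_v f x).
Proof.
move=> dF df.
pose p := (fun h : R => f (h *: v + x)).
have dp : is_derive (0 : R) 1 p ('D_v f x).
  apply: DeriveDef; first exact: ((derivable1P f x v).1 df).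
  by rewrite /derive derive_slice_quotient.
have dF' : is_derive (p 0) 1 F a by rewrite /p scale0r add0r.
have := @is_derive1_comp _ F p 0 _ _ dF' dp.
move=> [dc ec]; have dc' := (derivable1P (fun y => F (f y)) x v).2 dc.
apply: (DeriveDef dc').
rewrite -ec /derive.
by rewrite (derive_slice_quotient (fun y => F (f y))).
Qed.

Lemma derive_dir_comp (F : R -> R) f x v : derivable F (f x) 1 ->
  derivable f x v -> 'D_v (fun y => F (f y)) x = 'D_1 F (f x) * 'D_v f x.
Proof.
move=> dF df; have [_ ->//] := is_derive_dir_comp (derivableP dF) df.
Qed.

Lemma derivable_dir_comp (F : R -> R) f x v : derivable F (f x) 1 ->
  derivable f x v -> derivable (fun y => F (f y)) x v.
Proof.
by move=> dF df; have [] := is_derive_dir_comp (derivableP dF) df.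
Qed.

End smooth_calculus.

Section smooth_comp.
Context {R : realType} {V : normedModType R}.

(** The derivative of G \o f is (G' \o f) times the derivative of f: the algebra
    generated by the smooth functions and the compositions with f is stable. *)
Lemma smooth_comp (F : R -> R) (f : V -> R) : smooth F -> smooth f ->
  smooth (fun x => F (f x)).
Proof.
move=> sF sf.
pose B := fun h : V -> R => smooth h \/ exists2 F : R -> R, smooth F & h = fun x => F (f x).
apply: (@gen_alg_smooth _ _ B); last by apply: gen_base; right; exists F.
- move=> h [/smooth_cont_derivable//|[G sG ->]]; split => [x|x v].
    exact: (@continuous_comp _ _ _ f G x (@smooth_cont _ _ _ sf x) (@smooth_cont _ _ _ sG (f x))).
  by apply: derivable_dir_comp; exact: smooth_derivable.
- move=> h v [sh|[G sG ->]]; first by apply: gen_base; left; exact: smooth_D.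
  apply: (@gen_ext _ _ _ (fun x => 'D_1 G (f x) * 'D_v f x)) => [x|].
    by rewrite (@derive_dir_comp _ _ G f)//; exact: smooth_derivable.
  apply: gen_mul; apply: gen_base; last by left; exact: smooth_D.
  by right; exists (fun y => 'D_1 G y); [exact: smooth_D|].
Qed.

(** The derivative of f \o L along v is ('D_(L v) f) \o L, again of the same form. *)
Lemma smooth_linear {W : normedModType R} (L : {linear W -> V}) (f : V -> R) :
  continuous L -> smooth f -> smooth (fun x => f (L x)).
Proof.
move=> cL sf.
have DL (h : V -> R) x v : derivable h (L x) (L v) ->
    is_derive x v (fun x => h (L x)) ('D_(L v) h (L x)).
  rewrite /derivable /derive => dh.
  have E : (fun h0 : R => h0^-1 *: (((fun x => h (L x)) \o shift x) (h0 *: v) - h (L x))) =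
           (fun h0 : R => h0^-1 *: ((h \o shift (L x)) (h0 *: L v) - h (L x))).
    by apply/funext => t /=; rewrite (linearP L).
  by apply: DeriveDef; rewrite /derivable /derive E.
pose C := fun h : W -> R => exists2 F : V -> R, smooth F & h = fun x => F (L x).
apply: (@smooth_class _ _ C); last by exists f.
- move=> h [F sF ->]; split => [x|x v].
    exact: (@continuous_comp _ _ _ L F x (cL x) (@smooth_cont _ _ _ sF (L x))).
  by have [] := DL F x v (@smooth_derivable _ _ F _ _ sF).
- move=> h v [F sF ->]; exists (fun y => 'D_(L v) F y); first exact: smooth_D.
  apply/funext => x.
  by have [_ ->] := DL F x v (@smooth_derivable _ _ F _ _ sF).
Qed.

Lemma derive_linear {W : normedModType R} (L : {linear W -> V}) (f : V -> R) x v :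
  'D_v (fun x => f (L x)) x = 'D_(L v) f (L x).
Proof.
rewrite /derive.
suff -> : (fun h0 : R => h0^-1 *: (((fun x => f (L x)) \o shift x) (h0 *: v) - f (L x))) =
           (fun h0 : R => h0^-1 *: ((f \o shift (L x)) (h0 *: L v) - f (L x))) by [].
by apply/funext => t /=; rewrite (linearP L).
Qed.

(** The derivative of w = 1 / f is - w^2 f', a polynomial in w and f'. *)
Lemma smooth_inv (f : V -> R) : smooth f -> (forall x, 0 < f x) ->
  smooth (fun x => (f x)^-1).
Proof.
move=> sf f0; set w := (fun x => _).
pose B := fun h : V -> R => smooth h \/ h = w.
apply: (@gen_alg_smooth _ _ B); last by apply: gen_base; right.
- move=> h [/smooth_cont_derivable//|->]; split => [x|x v].
    by apply: continuousV; [rewrite gt_eqF|exact: smooth_cont].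
  by apply: derivableV; [rewrite gt_eqF|exact: smooth_derivable].
- move=> h v [sh|->]; first by apply: gen_base; left; exact: smooth_D.
  apply: (@gen_ext _ _ _ (fun x => (w x * w x) * (-1 * 'D_v f x))) => [x|].
    rewrite deriveV ?gt_eqF//; last exact: smooth_derivable.
    by rewrite /w /GRing.scale/= mulN1r mulrN mulNr -exprVn expr2.
  apply: gen_mul; first by apply: gen_mul; apply: gen_base; right.
  apply: gen_mul; first exact: (gen_cst _ (-1)).
  by apply: gen_base; left; exact: smooth_D.
Qed.

End smooth_comp.

(** * A smooth approximation of the absolute value *)

Section smooth_real.
Context {R : realType}.

Lemma is_derive_dirR (F : R -> R) (x v a : R) : is_derive x 1 F a -> is_derive x v F (a * v).
Proof.
move=> dF; have := @is_derive_dir_comp R R F id x v a dF (@derivable_id _ _ _ _).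
by rewrite derive_id.
Qed.

Lemma cont_derivable_is_derive (F G : R -> R) : (forall x : R, is_derive x 1 F (G x)) -> cont_derivable F.
Proof.
move=> dF; split => [x|x v]; last by have [] := is_derive_dirR v (dF x).
by apply/differentiable_continuous/derivable1_diffP; have [] := dF x.
Qed.

Lemma gen_alg_smoothR (B : (R -> R) -> Prop) :
  (forall F, B F -> exists2 G, gen_alg B G & forall x : R, is_derive x 1 F (G x)) ->
  forall F, gen_alg B F -> smooth F.
Proof.
move=> BD; apply: gen_alg_smooth => [F /BD[G _]|F v /BD[G BG dF]].
  exact: cont_derivable_is_derive.
apply: (gen_ext _ (gen_mul BG (gen_cst _ v))) => x.
by have [_ ->] := is_derive_dirR v (dF x).
Qed.

Lemma smooth_id : smooth (fun x : R => x).
Proof.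
apply: (@gen_alg_smoothR (fun h => h = (fun x => x))); last exact: gen_base.
move=> _ ->; exists (fun=> 1); first exact: (gen_cst _ 1).
by move=> x; exact: is_derive_id.
Qed.

Variable e : R.
Hypothesis e0 : 0 < e.

Definition hypot (s : R) := Num.sqrt (s ^+ 2 + e ^+ 2).

Lemma hypot_gt0 s : 0 < hypot s.
Proof. by rewrite sqrtr_gt0 ltr_wpDl// ?sqr_ge0// exprn_gt0. Qed.

Lemma is_derive_hypot (s : R) : is_derive s 1 hypot (s * (hypot s)^-1).
Proof.
have se0 : 0 < s ^+ 2 + e ^+ 2 by rewrite ltr_wpDl// ?sqr_ge0// exprn_gt0.
have d1 : is_derive s 1 (fun s : R => s ^+ 2 + e ^+ 2) (2 * s).
  by apply: is_derive_eq; rewrite addr0 /GRing.scale/=; ring.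
have := @is_derive1_comp _ Num.sqrt (fun s : R => s ^+ 2 + e ^+ 2) s _ _ (is_derive1_sqrt se0) d1.
rewrite (_ : _ * (2 * s) = s * (hypot s)^-1)// invfM mulrAC mulrC.
by rewrite -/(hypot s); field; rewrite gt_eqF ?hypot_gt0.
Qed.

(** The convex function sqrt (s^2 + e^2) - e lies between |s| - e and |s|, is smooth and
    vanishes at 0, so that its composition with a test function is a test
    function; phi and dphi are its first two derivatives. The L1-norm is reached
    as e tends to 0. *)
Definition Phi (s : R) := hypot s - e.
Definition phi (s : R) := s * (hypot s)^-1.
Definition dphi (s : R) := e ^+ 2 * ((hypot s)^-1) ^+ 3.

Lemma is_derive_Phi (s : R) : is_derive s 1 Phi (phi s).
Proof.
rewrite /phi -[X in is_derive _ _ _ X]addr0 -oppr0.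
exact: (is_deriveB (is_derive_hypot s) (is_derive_cst e s 1)).
Qed.

Lemma hypot_sq s : hypot s ^+ 2 = s ^+ 2 + e ^+ 2.
Proof. by rewrite sqr_sqrtr// addr_ge0// sqr_ge0. Qed.

Lemma is_derive_hypotV (s : R) : is_derive s 1 (fun s => (hypot s)^-1) (- s * ((hypot s)^-1) ^+ 3).
Proof.
have r0 := hypot_gt0 s.
have := is_deriveV (lt0r_neq0 r0) (is_derive_hypot s).
rewrite (_ : _ *: _ = - s * ((hypot s)^-1) ^+ 3)// /GRing.scale/=.
by field; rewrite gt_eqF.
Qed.

Lemma is_derive_phi (s : R) : is_derive s 1 phi (dphi s).
Proof.
have := is_deriveM (is_derive_id s 1) (is_derive_hypotV s).
rewrite (_ : _ + _ = dphi s)// /GRing.scale/= /dphi mulr1.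
have r0 := hypot_gt0 s.
have -> : e ^+ 2 = hypot s ^+ 2 - s ^+ 2 by rewrite hypot_sq addrC addKr.
by field; rewrite gt_eqF.
Qed.

Let B := fun h : R -> R => [\/ h = (fun x => x), h = hypot | h = (fun s => (hypot s)^-1)].

Let BD F : B F -> exists2 G, gen_alg B G & forall x : R, is_derive x 1 F (G x).
Proof.
have Bid : gen_alg B (fun x => x) by apply: gen_base; constructor 1.
have Brt : gen_alg B (fun s => (hypot s)^-1) by apply: gen_base; constructor 3.
move=> [->|->|->].
- exists (fun=> 1); first exact: (gen_cst _ 1).
  by move=> x; exact: is_derive_id.
- exists (fun s => s * (hypot s)^-1); last exact: is_derive_hypot.
  exact: gen_mul.
- exists (fun s => - s * ((hypot s)^-1) ^+ 3); last exact: is_derive_hypotV.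
  apply: (gen_ext _ (gen_mul (gen_mul (gen_cst _ (-1)) Bid) (gen_mul Brt (gen_mul Brt Brt)))).
  by move=> s; rewrite mulN1r !exprS expr0 mulr1.
Qed.

Lemma smooth_Phi : smooth Phi.
Proof.
apply: (gen_alg_smoothR BD); apply: gen_add; last exact: (gen_cst _ (- e)).
by apply: gen_base; constructor 2.
Qed.

Lemma smooth_phi : smooth phi.
Proof.
by apply: (gen_alg_smoothR BD); apply: gen_mul; apply: gen_base; [constructor 1|constructor 3].
Qed.

Lemma smooth_dphi : smooth dphi.
Proof.
have Brt : gen_alg B (fun s => (hypot s)^-1) by apply: gen_base; constructor 3.
apply: (gen_alg_smoothR BD).
apply: (gen_ext _ (gen_mul (gen_cst _ (e ^+ 2)) (gen_mul Brt (gen_mul Brt Brt)))).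
by move=> s; rewrite /dphi; congr (_ * _); rewrite !exprS expr0 mulr1.
Qed.

Lemma measurable_Phi : measurable_fun setT Phi.
Proof. by apply: continuous_measurable_fun => x; exact: (@smooth_cont _ _ _ smooth_Phi). Qed.

Lemma measurable_phi : measurable_fun setT phi.
Proof. by apply: continuous_measurable_fun => x; exact: (@smooth_cont _ _ _ smooth_phi). Qed.

Lemma measurable_dphi : measurable_fun setT dphi.
Proof. by apply: continuous_measurable_fun => x; exact: (@smooth_cont _ _ _ smooth_dphi). Qed.

Lemma norm_le_hypot s : `|s| <= hypot s.
Proof.
rewrite -(@ler_pXn2r _ 2)// ?nnegrE// ?hypot_sq ?(ltW (hypot_gt0 _))// real_normK ?num_real//.
by rewrite lerDl sqr_ge0.
Qed.

Lemma le_hypot s : e <= hypot s.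
Proof.
by rewrite -(@ler_pXn2r _ 2)// ?nnegrE// ?hypot_sq ?(ltW (hypot_gt0 _)) ?(ltW e0)// lerDr sqr_ge0.
Qed.

Lemma Phi_ge0 s : 0 <= Phi s.
Proof. by rewrite subr_ge0 le_hypot. Qed.

Lemma Phi0 : Phi 0 = 0.
Proof. by rewrite /Phi /hypot expr0n add0r sqrtr_sqr gtr0_norm// subrr. Qed.

Lemma phi0 : phi 0 = 0.
Proof. by rewrite /phi mul0r. Qed.

Lemma phi_le1 s : `|phi s| <= 1.
Proof.
rewrite normrM normfV (gtr0_norm (hypot_gt0 s)) ler_pdivrMr ?hypot_gt0// mul1r.
exact: norm_le_hypot.
Qed.

Lemma dphi_ge0 s : 0 <= dphi s.
Proof. by rewrite mulr_ge0// exprn_ge0// ?invr_ge0 ltW// hypot_gt0. Qed.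

Lemma dphi_le s : dphi s <= e^-1.
Proof.
have h : (hypot s)^-1 <= e^-1 by rewrite lef_pV2 ?posrE ?hypot_gt0// le_hypot.
rewrite /dphi; apply: (@le_trans _ _ (e ^+ 2 * e^-1 ^+ 3)).
  rewrite ler_pM2l ?exprn_gt0//; apply: lerXn2r => //.
    by rewrite nnegrE invr_ge0; exact/ltW/hypot_gt0.
  by rewrite nnegrE invr_ge0; exact/ltW.
by rewrite le_eqVlt; apply/orP; left; apply/eqP; field; rewrite gt_eqF.
Qed.

Lemma Phi_le s : Phi s <= `|s|.
Proof.
rewrite /Phi lerBlDr -(@ler_pXn2r _ 2)// ?nnegrE ?(ltW (hypot_gt0 _))//; last first.
  by rewrite addr_ge0// ltW.
rewrite hypot_sq -(real_normK (num_real s)) sqrrD lerD2r lerDl.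
by rewrite mulrn_wge0// mulr_ge0// ltW.
Qed.

Lemma norm_le_Phi s : `|s| <= Phi s + e.
Proof. by rewrite /Phi subrK norm_le_hypot. Qed.

(** The tangent line at b lies below Phi; after clearing denominators this is
    a b + e^2 <= hypot a * hypot b, Cauchy-Schwarz for (a, e) and (b, e). *)
Lemma Phi_convex a b : Phi b - Phi a <= phi b * (b - a).
Proof.
rewrite /Phi /phi opprB addrA subrK mulrAC ler_pdivlMr ?hypot_gt0//.
rewrite mulrBl -expr2 hypot_sq mulrBr -expr2 [X in _ <= X](_ : _ = b ^+ 2 + e ^+ 2 - (b * a + e ^+ 2)); last by ring.
rewrite lerD2l lerN2.
apply: (le_trans (ler_norm _)).
rewrite -(@ler_pXn2r _ 2)// ?nnegrE ?mulr_ge0// ?(ltW (hypot_gt0 _))//.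
rewrite real_normK ?num_real// exprMn !hypot_sq -subr_ge0.
rewrite (_ : _ - _ = (e * (a - b)) ^+ 2) ?sqr_ge0//; by ring.
Qed.

Lemma Phi_lip a b : `|Phi a - Phi b| <= `|a - b|.
Proof.
wlog h : a b / Phi b <= Phi a.
  have [h|/ltW h] := leP (Phi b) (Phi a); first by apply.
  by rewrite distrC [X in _ <= X]distrC; apply.
rewrite ger0_norm ?subr_ge0// (le_trans (Phi_convex b a))// (le_trans (ler_norm _))//.
by rewrite normrM ler_piMl// phi_le1.
Qed.

End smooth_real.

(** * A smooth step function *)

Section flat.
Context {R : realType}.
Implicit Types x y : R.

(** Each half of the exponential absorbs one factor y of the polynomial. *)
Lemma poly_expR_bound (p : {poly R}) (a : R) : 0 < a ->
  exists C : R, forall y : R, 0 <= y -> `|p.[y]| * expR (- (a * y)) <= C.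
Proof.
elim/poly_ind: p a => [|p c ih] a a0.
  by exists 0 => y y0; rewrite horner0 normr0 mul0r.
have a2 : 0 < a / 2 by rewrite divr_gt0.
have [C pC] := ih _ a2.
exists (C * (2 / a) + `|c|) => y y0.
have ay : 0 <= a / 2 * y by rewrite mulr_ge0// ltW.
have e1 : expR (- (a * y)) = expR (- (a / 2 * y)) * expR (- (a / 2 * y)).
  by rewrite -expRD; congr expR; lra.
have e2 : y * expR (- (a / 2 * y)) <= 2 / a.
  rewrite expRN ler_pdivrMr ?expR_gt0//.
  rewrite -ler_pdivrMl ?divr_gt0// invf_div.
  by apply: le_trans (expR_ge1Dx _); rewrite lerDr.
have e3 : expR (- (a * y)) <= 1 by rewrite expR_le1 oppr_le0 mulr_ge0// ltW.
rewrite hornerMXaddC (le_trans (ler_wpM2r (expR_ge0 _) (ler_normD _ _)))// mulrDl.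
apply: lerD; last by rewrite ler_piMr.
rewrite e1 normrM (ger0_norm y0).
set E := expR _ in e2 *; rewrite (_ : _ * _ = (`|p.[y]| * E) * (y * E)); last by ring.
by apply: ler_pM => //; rewrite ?mulr_ge0 ?expR_ge0//; exact: pC.
Qed.

(** The functions p(1/x) exp(-1/x), extended by 0 to x <= 0, form a family that is
    stable under differentiation, which gives the smoothness of all of them at
    once. *)
Definition flat (p : {poly R}) (x : R) : R :=
  if 0 < x then p.[x^-1] * expR (- x^-1) else 0.

(** Two spare powers of x come from bounding p(y) y^2 exp(-y). *)
Lemma flat_le p : exists C : R, forall x : R, `|flat p x| <= C * x ^+ 2.
Proof.
have [C pC] := poly_expR_bound (p * 'X ^+ 2) ltr01.
have C0 : 0 <= C.
  by apply: le_trans (pC 0 (lexx _)); rewrite mulr_ge0// expR_ge0.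
exists C => x; rewrite /flat; case: ifPn => [x0|_]; last first.
  by rewrite normr0 mulr_ge0// sqr_ge0.
have xV : 0 <= x^-1 by rewrite invr_ge0 ltW.
have := pC _ xV; rewrite mul1r hornerM hornerXn normrM normrX (ger0_norm xV).
by rewrite normrM (ger0_norm (expR_ge0 _)) mulrAC exprVn ler_pdivrMr ?exprn_gt0.
Qed.

Lemma is_derive_quad (F : R -> R) (C : R) : F 0 = 0 -> (forall x : R, `|F x| <= C * x ^+ 2) ->
  is_derive (0 : R) 1 F 0.
Proof.
move=> F0 FC.
have C0 : 0 <= C by have := FC 1; rewrite expr1n mulr1; exact: le_trans.
suff h : (fun h : R => h^-1 *: ((F \o shift 0) (h *: 1) - F 0)) @ 0^' --> (0 : R).
  by apply: DeriveDef; [apply/cvg_ex; exists 0|apply: cvg_lim h].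
apply/cvgr0Pnorm_le => e e0; near=> h.
rewrite /= addr0 F0 subr0 /GRing.scale/= mulr1 normrM.
have h0 : h != 0 by near: h; exact: nbhs_dnbhs_neq.
rewrite normfV ler_pdivrMl ?normr_gt0// (le_trans (FC h))//.
rewrite -[h ^+ 2]ger0_norm ?sqr_ge0// normrX expr2 mulrCA ler_pM2l ?normr_gt0//.
have h1 : `|h| <= e / (C + 1) by near: h; apply: dnbhs0_le; rewrite divr_gt0// ltr_wpDl.
apply: (@le_trans _ _ ((C + 1) * `|h|)); first by rewrite ler_wpM2r// lerDl.
by rewrite mulrC -ler_pdivlMr// ltr_wpDl.
Unshelve. all: by end_near. Qed.

Lemma is_derive_flat p (x : R) : is_derive x 1 (flat p) (flat ('X ^+ 2 * (p - p^`())) x).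
Proof.
have [x0|x0|->] := ltgtP x 0.
- apply: (@near_eq_is_derive _ _ _ (cst 0)).
    near=> y; rewrite /flat ifF//; apply/negbTE; rewrite -leNgt ltW//.
    by near: y; exact: lt_nbhsl.
  by rewrite /flat ifF ?ltNge ?(ltW x0)//; exact: is_derive_cst.
- apply: (@near_eq_is_derive _ _ _ (fun y : R => p.[y^-1] * expR (- y^-1))).
    near=> y; rewrite /flat ifT//.
    by near: y; exact: lt_nbhsr.
  have dV : is_derive x 1 (fun y : R => y^-1) (- x ^- 2).
    by have := is_deriveV (lt0r_neq0 x0) (is_derive_id x 1); rewrite /GRing.scale/= mulr1.
  have d1 := @is_derive1_comp _ (horner p) (fun y : R => y^-1) x _ _ (is_derive_poly p x^-1) dV.
  have d2 := @is_derive1_comp _ expR (fun y : R => - y^-1) x _ _ (is_derive_expR _) (is_deriveN dV).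
  have := is_deriveM d1 d2; rewrite /flat x0 !hornerE /GRing.scale/=.
  set A := (X in is_derive _ _ _ X -> _); set B := (X in _ -> is_derive _ _ _ X).
  have -> // : A = B; rewrite /A /B; field.
  by rewrite gt_eqF.
- have [C pC] := flat_le p; rewrite {2}/flat ltxx.
  by apply: (is_derive_quad _ pC); rewrite /flat ltxx.
Unshelve. all: by end_near. Qed.

Lemma smooth_flat p : smooth (flat p).
Proof.
pose B := fun h : R -> R => exists p, h = flat p.
apply: (@gen_alg_smoothR _ B); last by apply: gen_base; exists p.
move=> _ [q ->]; exists (flat ('X ^+ 2 * (q - q^`()))); last exact: is_derive_flat.
by apply: gen_base; eexists.
Qed.

Let e := flat 1.

Let eE x : 0 < x -> e x = expR (- x^-1).
Proof. by move=> x0; rewrite /e /flat x0 hornerE mul1r. Qed.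

Let e_ge0 x : 0 <= e x.
Proof. by rewrite /e /flat; case: ifP => // _; rewrite hornerE mul1r expR_ge0. Qed.

Let e_gt0 x : 0 < x -> 0 < e x.
Proof. by move=> x0; rewrite eE// expR_gt0. Qed.

Let e_le0 x : x <= 0 -> e x = 0.
Proof. by move=> x0; rewrite /e /flat ifF// ltNge x0. Qed.

Let e_homo x y : x <= y -> e x <= e y.
Proof.
move=> xy; have [x0|x0] := leP x 0; first by rewrite e_le0.
have y0 := lt_le_trans x0 xy.
by rewrite !eE// ler_expR lerN2 lef_pV2.
Qed.

Let den x := e x + e (1 - x).

Let den_gt0 x : 0 < den x.
Proof.
have [x0|x0] := leP x 0; last by rewrite ltr_pwDl// e_gt0.
by rewrite ltr_wpDl// e_gt0// subr_gt0 (le_lt_trans x0).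
Qed.

(** With e(x) = exp(-1/x), the quotient e(x) / (e(x) + e(1 - x)) rises from 0 at
    x = 0 to 1 at x = 1. *)
Definition sstep x := e x / den x.

Lemma smooth_sstep : smooth sstep.
Proof.
apply: smoothMf; first exact: smooth_flat.
apply: smooth_inv den_gt0; apply: smoothDf; first exact: smooth_flat.
apply: (smooth_comp (smooth_flat _)).
by apply: smoothBf; [exact: smooth_cst|exact: smooth_id].
Qed.

Lemma sstep0 x : x <= 0 -> sstep x = 0.
Proof. by move=> x0; rewrite /sstep e_le0// mul0r. Qed.

Lemma sstep1 x : 1 <= x -> sstep x = 1.
Proof.
move=> x1; rewrite /sstep /den (@e_le0 (1 - x)) ?subr_le0// addr0 divff//.
by rewrite gt_eqF// e_gt0// (lt_le_trans _ x1).
Qed.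

Lemma sstep_ge0 x : 0 <= sstep x.
Proof. by rewrite divr_ge0// ltW. Qed.

Lemma sstep_homo x y : x <= y -> sstep x <= sstep y.
Proof.
move=> xy; rewrite /sstep ler_pdivrMr// mulrAC ler_pdivlMr//.
rewrite /den !mulrDr mulrC lerD2l; apply: ler_pM => //; apply: e_homo => //.
by rewrite lerB.
Qed.

Lemma sstep_le1 x : sstep x <= 1.
Proof. by rewrite -(@sstep1 (x + `|1 - x|)) ?sstep_homo ?lerDl// -lerBlDl ler_norm. Qed.

Definition dstep (x : R) := 'D_1 sstep x.

Lemma is_derive_sstep (x : R) : is_derive x 1 sstep (dstep x).
Proof. by apply: derivableP; apply: smooth_derivable; exact: smooth_sstep. Qed.

Lemma smooth_dstep : smooth dstep.
Proof. exact: (smooth_D _ smooth_sstep). Qed.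

Lemma dstep_out x : x < 0 \/ 1 < x -> dstep x = 0.
Proof.
move=> [x0|x1].
  rewrite /dstep -(near_eq_derive (f := (cst 0 : R -> R))) ?derive_cst//.
  near=> y; rewrite sstep0//; apply: ltW.
  by near: y; exact: lt_nbhsl.
rewrite /dstep -(near_eq_derive (f := (cst 1 : R -> R))) ?derive_cst//.
near=> y; rewrite sstep1//; apply: ltW.
by near: y; exact: lt_nbhsr.
Unshelve. all: by end_near. Qed.

Lemma dstep_bounded : exists2 C, 0 < C & forall x, `|dstep x| <= C.
Proof.
have c : {within `[(0:R), 1], continuous (fun x => `|dstep x|)}.
  apply: continuous_subspaceT => x; apply: cvg_norm.
  exact: (@smooth_cont _ _ _ smooth_dstep x).
have [z zI zM] := EVT_max ler01 c.
exists (`|dstep z| + 1) => [|x]; first by rewrite ltr_wpDl.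
have [x0|x0] := ltP x 0; first by rewrite dstep_out ?normr0 ?addr_ge0//; left.
have [x1|x1] := ltP 1 x; first by rewrite dstep_out ?normr0 ?addr_ge0//; right.
by rewrite (le_trans (zM x _)) ?lerDl// in_itv/= x0.
Qed.

End flat.

(** * Integrable real-valued functions *)

Section L1_theory.
Context d (T : measurableType d) (R : realType) (mu : {measure set T -> \bar R}).
Implicit Types f g h : T -> R.

(** The estimates below take place in the field R, with real-valued functions and
    real integrals; extended reals only appear at both ends, when the hypotheses
    are unpacked and in the conclusion. *)
Definition L1 f := mu.-integrable setT (EFin \o f).

Lemma L1_meas f : L1 f -> measurable_fun setT f.
Proof. by move=> /measurable_int/measurable_EFinP. Qed.

Lemma L1P f : measurable_fun setT f -> (\int[mu]_x `|f x|%:E < +oo)%E -> L1 f.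
Proof. by move=> mf fi; apply/integrableP; split => //; exact/measurable_EFinP. Qed.

Lemma L1_lty f : L1 f -> (\int[mu]_x `|f x|%:E < +oo)%E.
Proof. by move=> /integrableP[]. Qed.

Lemma L1_ae_le f g : measurable_fun setT f -> L1 g ->
  {ae mu, forall x, `|f x| <= g x} -> L1 f.
Proof.
move=> mf ig fg; apply: L1P => //.
apply: le_lt_trans (L1_lty ig).
apply: ae_ge0_le_integral => //.
- by apply/measurable_EFinP/measurableT_comp.
- by apply/measurable_EFinP/measurableT_comp => //; exact: L1_meas.
- by apply: filterS fg => x fgx _; rewrite lee_fin; exact: le_trans fgx (ler_norm _).
Qed.

Lemma L1_le f g : measurable_fun setT f -> L1 g -> (forall x, `|f x| <= g x) -> L1 f.
Proof. by move=> mf ig fg; apply: L1_ae_le ig _ => //; exact: aeW. Qed.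

Lemma L1D f g : L1 f -> L1 g -> L1 (fun x => f x + g x).
Proof. by move=> If Ig; have := integrableD measurableT If Ig. Qed.

Lemma L1Z c f : L1 f -> L1 (fun x => c * f x).
Proof. by move=> If; have := integrableZl measurableT c If. Qed.

Lemma L1B f g : L1 f -> L1 g -> L1 (fun x => f x - g x).
Proof. by move=> If Ig; have := integrableB measurableT If Ig. Qed.

Lemma L1N f : L1 f -> L1 (fun x => - f x).
Proof. by move=> If; have := integrableN If. Qed.

Lemma L10 : L1 (fun=> 0).
Proof. exact: integrable0. Qed.

Lemma L1_sum (I : Type) (s : seq I) (h : I -> T -> R) :
  (forall i, L1 (h i)) -> L1 (fun x => \sum_(i <- s) h i x).
Proof.
move=> Ih; elim: s => [|i s ih].
  rewrite (_ : (fun x => _) = (fun=> 0)); first exact: L10.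
  by apply/funext => x; rewrite big_nil.
rewrite (_ : (fun x => _) = (fun x => h i x + \sum_(i <- s) h i x)); first exact: L1D.
by apply/funext => x; rewrite big_cons.
Qed.

Lemma L1_abs f : L1 f -> L1 (fun x => `|f x|).
Proof. by move=> /(integrable_norm); exact. Qed.

Lemma L1M_bd C f h : measurable_fun setT h -> (forall x, `|h x| <= C) -> L1 f ->
  L1 (fun x => f x * h x).
Proof.
move=> mh hC If; apply: (@L1_le _ (fun x => C * `|f x|)).
- exact: measurable_funM (L1_meas If) mh.
- exact/L1Z/L1_abs.
- by move=> x; rewrite normrM mulrC ler_wpM2r.
Qed.

Lemma L1M_sq f g : measurable_fun setT f -> measurable_fun setT g ->
  L1 (fun x => f x ^+ 2) -> L1 (fun x => g x ^+ 2) -> L1 (fun x => f x * g x).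
Proof.
move=> mf mg If Ig; apply: L1_le (L1D If Ig) _; first exact: measurable_funM.
move=> x; rewrite normrM -(real_normK (num_real (f x))) -(real_normK (num_real (g x))).
move: (normr_ge0 (f x)) (normr_ge0 (g x)); set a := `|f x|; set b := `|g x|; nra.
Qed.

Lemma L1_sqB f g : measurable_fun setT f -> measurable_fun setT g ->
  L1 (fun x => f x ^+ 2) -> L1 (fun x => g x ^+ 2) -> L1 (fun x => (f x - g x) ^+ 2).
Proof.
move=> mf mg If Ig; apply: L1_le (L1Z 2 (L1D If Ig)) _.
  by apply: measurable_funX; exact: measurable_funB.
move=> x; rewrite ger0_norm ?sqr_ge0// -subr_ge0.
rewrite (_ : _ - _ = (f x + g x) ^+ 2) ?sqr_ge0//; ring.
Qed.

Lemma L1_sqM_bd C f h : measurable_fun setT f -> measurable_fun setT h ->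
  (forall x, `|h x| <= C) -> L1 (fun x => f x ^+ 2) -> L1 (fun x => (h x * f x) ^+ 2).
Proof.
move=> mf mh hC If; apply: L1_le (L1Z (C ^+ 2) If) _.
  by apply: measurable_funX; exact: measurable_funM.
move=> x; rewrite ger0_norm ?sqr_ge0// exprMn ler_wpM2r ?sqr_ge0//.
rewrite -(real_normK (num_real (h x))) lerXn2r ?nnegrE//.
by rewrite (le_trans _ (hC x)).
Qed.

Lemma L1_norm_le f g : measurable_fun setT f -> L1 g -> (forall x, `|f x| <= `|g x|) -> L1 f.
Proof. by move=> mf /L1_abs ig fg; exact: L1_le ig fg. Qed.

Lemma L1_indicator D : measurable D -> (mu D < +oo)%E -> L1 (\1_D : T -> R).
Proof.
move=> mD fD; apply: L1P; first exact: measurable_indic.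
under eq_integral do rewrite ger0_norm ?indicE ?ler0n//.
by rewrite integral_indic// setIT.
Qed.

Lemma L1_patch f D : measurable D -> L1 f -> L1 (f \_ D).
Proof.
move=> mD If; apply: (L1_norm_le _ If).
  by apply/(measurable_restrictT _ mD).1; apply: measurable_funTS; exact: L1_meas.
by move=> x; rewrite /patch; case: ifP => // _; rewrite normr0.
Qed.

Lemma intRD f g : L1 f -> L1 g ->
  \int[mu]_x (f x + g x) = \int[mu]_x f x + \int[mu]_x g x.
Proof. by move=> If Ig; exact: RintegralD. Qed.

Lemma intRB f g : L1 f -> L1 g ->
  \int[mu]_x (f x - g x) = \int[mu]_x f x - \int[mu]_x g x.
Proof. by move=> If Ig; exact: RintegralB. Qed.

Lemma intRZ c f : L1 f -> \int[mu]_x (c * f x) = c * \int[mu]_x f x.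
Proof. by move=> If; exact: RintegralZl. Qed.

Lemma intRN f : L1 f -> \int[mu]_x (- f x) = - \int[mu]_x f x.
Proof.
move=> If; rewrite -mulN1r -intRZ//; apply: eq_Rintegral => x _.
by rewrite mulN1r.
Qed.

Lemma intR0 : \int[mu]_x (0 : R) = 0.
Proof. by rewrite /Rintegral integral0. Qed.

Lemma intR_sum (I : Type) (s : seq I) (h : I -> T -> R) : (forall i, L1 (h i)) ->
  \int[mu]_x (\sum_(i <- s) h i x) = \sum_(i <- s) \int[mu]_x h i x.
Proof.
move=> Ih; elim: s => [|i s ih].
  by rewrite big_nil -[RHS]intR0; apply: eq_Rintegral => x _; rewrite big_nil.
rewrite big_cons -ih -intRD//; last exact: L1_sum.
by apply: eq_Rintegral => x _; rewrite big_cons.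
Qed.

Lemma intR_ae_eq f g : measurable_fun setT f -> measurable_fun setT g ->
  {ae mu, forall x, f x = g x} -> \int[mu]_x f x = \int[mu]_x g x.
Proof.
move=> mf mg fg; congr fine; apply: ae_eq_integral => //; try exact/measurable_EFinP.
by apply: filterS fg => x /= -> _.
Qed.

Lemma L1_ae_eq f g : L1 f -> measurable_fun setT g -> {ae mu, forall x, f x = g x} -> L1 g.
Proof.
move=> If mg fg; apply: L1_ae_le (L1_abs If) _ => //.
by apply: filterS fg => x ->.
Qed.

Lemma intR_le f g : L1 f -> L1 g -> (forall x, f x <= g x) ->
  \int[mu]_x f x <= \int[mu]_x g x.
Proof. by move=> If Ig fg; apply: le_Rintegral. Qed.

Lemma intR_ae_le f g : L1 f -> L1 g -> {ae mu, forall x, f x <= g x} ->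
  \int[mu]_x f x <= \int[mu]_x g x.
Proof.
move=> If Ig fg.
rewrite (@intR_ae_eq f (fun x => Num.min (f x) (g x))).
- apply: intR_le => // [|x]; last by rewrite ge_min lexx orbT.
  apply: (L1_ae_eq If); first exact: measurable_minr (L1_meas If) (L1_meas Ig).
  by apply: filterS fg => x /min_idPl.
- exact: L1_meas.
- exact: measurable_minr (L1_meas If) (L1_meas Ig).
- by apply: filterS fg => x /min_idPl.
Qed.

Lemma intR_abs f : L1 f -> `|\int[mu]_x f x| <= \int[mu]_x `|f x|.
Proof. by move=> If; apply: le_normr_Rintegral. Qed.

Lemma intR_abs_le f g : L1 f -> L1 g -> (forall x, `|f x| <= g x) ->
  `|\int[mu]_x f x| <= \int[mu]_x g x.
Proof.
by move=> If Ig fg; apply: le_trans (intR_abs If) _; apply: intR_le => //; exact: L1_abs.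
Qed.

Lemma intR_ge0 f : (forall x, 0 <= f x) -> 0 <= \int[mu]_x f x.
Proof. by move=> f0; exact: Rintegral_ge0. Qed.

Lemma EFin_intR f : L1 f -> (\int[mu]_x f x)%:E = (\int[mu]_x (f x)%:E)%E.
Proof. by move=> If; rewrite /Rintegral fineK//; exact: integrable_fin_num. Qed.

Lemma intR_dominated_cvg (f_ : nat -> T -> R) f g : (forall n, measurable_fun setT (f_ n)) ->
  measurable_fun setT f -> L1 g ->
  {ae mu, forall x, f_ ^~ x @ \oo --> f x} ->
  {ae mu, forall x n, `|f_ n x| <= g x} ->
  L1 f /\ (\int[mu]_x f_ n x @[n --> \oo] --> \int[mu]_x f x).
Proof.
move=> mf_ mf Ig ff fg.
have [] := @dominated_convergence _ _ _ mu setT measurableT (fun n x => (f_ n x)%:E)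
  (EFin \o f) (EFin \o g).
- by move=> n; exact/measurable_EFinP.
- exact/measurable_EFinP.
- apply: filterS ff => x h _; apply/fine_cvgP; split; first exact: nearW.
  exact: h.
- exact: Ig.
- by apply: filterS fg => x h n _; exact: h.
move=> If _ cf.
split => //; rewrite /Rintegral.
by apply: fine_cvg; rewrite -/(Rintegral _ _ _) EFin_intR.
Qed.

(** By monotone convergence the sum of the series is integrable, hence it is an
    integrable majorant of the partial sums. *)
Lemma ae_series_dom (f_ : nat -> T -> R) (C : R) : (forall n, L1 (f_ n)) ->
  (forall n x, 0 <= f_ n x) -> (forall n, \int[mu]_x f_ n x <= C * (2^-1) ^+ n) ->
  exists2 S, L1 S & {ae mu, forall x N, series (fun n => f_ n x) N <= S x}.
Proof.
move=> If f0 fC.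
pose S x := (\sum_(n <oo) (f_ n x)%:E)%E.
have mS : measurable_fun setT S.
  apply: ge0_emeasurable_sum => // [n x _ _|n _]; first by rewrite lee_fin.
  exact/measurable_EFinP/L1_meas.
have IS : mu.-integrable setT S.
  apply/integrableP; split => //.
  rewrite (eq_integral S) => [|x _]; last first.
    by rewrite gee0_abs//; apply: nneseries_ge0 => n _ _; rewrite lee_fin.
  rewrite integral_nneseries//; last 2 first.
  - by move=> n; exact/measurable_EFinP/L1_meas.
  - by move=> n x _; rewrite lee_fin.
  have C0 : 0 <= C.
    by have := fC 0%N; rewrite expr0 mulr1; apply: le_trans; apply: intR_ge0 => x.
  apply: (@le_lt_trans _ _ (\sum_(n <oo) (C * (2^-1) ^+ n)%:E)%E).
    apply: lee_nneseries => n *; first by apply: integral_ge0 => x _; rewrite lee_fin.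
    by rewrite -EFin_intR// lee_fin.
  apply: (@le_lt_trans _ _ (C * 2)%:E); last exact: ltry.
  apply: lime_le; first by apply: is_cvg_nneseries => n _ _; rewrite lee_fin mulr_ge0// exprn_ge0.
  apply: nearW => n; rewrite sumEFin lee_fin big_mkord -mulr_sumr ler_wpM2l//.
  have -> : \sum_(i < n) (2^-1 : R) ^+ i = 2 * (1 - (2^-1) ^+ n).
    elim: n => [|n ih]; first by rewrite big_ord0 expr0 subrr mulr0.
    by rewrite big_ord_recr/= ih exprS; field.
  by rewrite ger_pMr// gerBl exprn_ge0.
exists (fun x => fine (S x)).
  have mS' : measurable_fun setT (fun x => fine (S x)).
    exact: measurableT_comp (fine_measurable measurableT) mS.
  apply: L1P => //; have /integrableP[_] := IS; apply: le_lt_trans.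
  apply: ge0_le_integral => //.
  - by apply/measurable_EFinP/measurableT_comp.
  - exact: measurableT_comp.
  - by move=> x _; case: (S x) => [r| |] //=; rewrite normr0 leey.
apply: filterS (integrable_ae measurableT IS) => x /(_ I) Sx n.
rewrite -lee_fin fineK// /S /series/= -sumEFin.
apply: (@nneseries_lim_ge _ (fun n => (f_ n x)%:E) xpredT 0%N n).
by move=> k _ _; rewrite lee_fin.
Qed.

Lemma ae_series (f_ : nat -> T -> R) (C : R) : (forall n, L1 (f_ n)) ->
  (forall n x, 0 <= f_ n x) -> (forall n, \int[mu]_x f_ n x <= C * (2^-1) ^+ n) ->
  {ae mu, forall x, cvgn (series (fun n => f_ n x))}.
Proof.
move=> If f0 fC; have [S _ fS] := ae_series_dom If f0 fC.
apply: filterS fS => x Sx; apply: nondecreasing_is_cvgn.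
  by apply/nondecreasing_seqP => n; rewrite seriesSr lerDl.
by exists (S x) => _ [n _ <-]; exact: Sx.
Qed.

(** This is the passage to a subsequence that converges almost everywhere. *)
Lemma ae_series0 (f_ : nat -> T -> R) (C : R) : (forall n, L1 (f_ n)) ->
  (forall n x, 0 <= f_ n x) -> (forall n, \int[mu]_x f_ n x <= C * (2^-1) ^+ n) ->
  {ae mu, forall x, f_ ^~ x @ \oo --> (0 : R)}.
Proof.
move=> If f0 fC; apply: filterS (ae_series If f0 fC) => x.
exact: cvg_series_cvg_0.
Qed.

End L1_theory.

(** * Fubini's theorem for real integrals *)

Section slices.
Context d1 d2 (T1 : measurableType d1) (T2 : measurableType d2) (R : realType).

Lemma meas_slice2 (h : T1 * T2 -> R) y : measurable_fun setT h ->
  measurable_fun setT (fun x => h (x, y)).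
Proof.
move=> mh; have := measurableT_comp mh (measurable_fun_pair (@measurable_id _ T1 setT) (measurable_cst y)).
by [].
Qed.

End slices.

Section fubini_real.
Context d1 d2 (T1 : measurableType d1) (T2 : measurableType d2) (R : realType).
Context (m1 : {sigma_finite_measure set T1 -> \bar R}).
Context (m2 : {sigma_finite_measure set T2 -> \bar R}).
Implicit Types h : T1 * T2 -> R.

Local Notation m12 := (m1 \x m2)%E.

(** The positive and the negative parts are measurable in x by Tonelli. *)
Lemma meas_intR1 h : measurable_fun setT h ->
  measurable_fun setT (fun x => \int[m2]_y h (x, y)).
Proof.
move=> mh; apply: (measurableT_comp (fine_measurable measurableT)).
rewrite (_ : (fun x => _) = (fun x => (\int[m2]_y ((EFin \o h)^\+ (x, y)) - \int[m2]_y ((EFin \o h)^\- (x, y)))%E)); last first.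
  by apply/funext => x; rewrite [LHS]integralE; congr (_ - _)%E; apply: eq_integral => y _; rewrite ?funeposE ?funenegE.
have mE : measurable_fun setT (EFin \o h) by exact/measurable_EFinP.
apply: emeasurable_funB.
  by apply: measurable_fun_fubini_tonelli_F => //; exact: measurable_funepos.
by apply: measurable_fun_fubini_tonelli_F => //; exact: measurable_funeneg.
Qed.

Lemma meas_intR2 h : measurable_fun setT h ->
  measurable_fun setT (fun y => \int[m1]_x h (x, y)).
Proof.
move=> mh; apply: (measurableT_comp (fine_measurable measurableT)).
rewrite (_ : (fun x => _) = (fun y => (\int[m1]_x ((EFin \o h)^\+ (x, y)) - \int[m1]_x ((EFin \o h)^\- (x, y)))%E)); last first.
  by apply/funext => x; rewrite [LHS]integralE; congr (_ - _)%E; apply: eq_integral => y _; rewrite ?funeposE ?funenegE.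
have mE : measurable_fun setT (EFin \o h) by exact/measurable_EFinP.
apply: emeasurable_funB.
  by apply: measurable_fun_fubini_tonelli_G => //; exact: measurable_funepos.
by apply: measurable_fun_fubini_tonelli_G => //; exact: measurable_funeneg.
Qed.

Lemma ae_L1_1 h : L1 m12 h -> {ae m1, forall x, L1 m2 (fun y => h (x, y))}.
Proof. by move=> Ih; exact: (ae_integrable1 Ih). Qed.

Lemma ae_L1_2 h : L1 m12 h -> {ae m2, forall y, L1 m1 (fun x => h (x, y))}.
Proof. by move=> Ih; exact: (ae_integrable2 Ih). Qed.

Lemma L1_intR1 h : L1 m12 h -> L1 m1 (fun x => \int[m2]_y h (x, y)).
Proof.
move=> Ih; have mh := L1_meas Ih.
have /integrableP[mF FI] := integrable_fubini_F Ih.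
apply: L1P; first exact: meas_intR1.
apply: le_lt_trans FI; apply: ge0_le_integral => //.
- by apply/measurable_EFinP/measurableT_comp => //; exact: meas_intR1.
- exact: measurableT_comp.
- move=> x _; rewrite /Rintegral /fubini_F; case: (integral _ _ _) => [r| |] //=.
  + by rewrite normr0 leey.
  + by rewrite normr0 leey.
Qed.

Lemma L1_intR2 h : L1 m12 h -> L1 m2 (fun y => \int[m1]_x h (x, y)).
Proof.
move=> Ih; have mh := L1_meas Ih.
have FI : (\int[m2]_y \int[m1]_x `|(EFin \o h) (x, y)| < +oo)%E.
  by apply/(integrable21ltyP _ _ _).1 => //; exact/measurable_EFinP.
apply: L1P; first exact: meas_intR2.
apply: le_lt_trans FI; apply: ge0_le_integral => //.
- by apply/measurable_EFinP/measurableT_comp => //; exact: meas_intR2.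
- apply: (@measurable_fun_fubini_tonelli_G _ _ _ _ _ m1 (fun z => `|(h z)%:E|%E)) => //.
  by apply: measurableT_comp => //; exact/measurable_EFinP.
- move=> y _; have my : measurable_fun setT (fun x => (h (x, y))%:E).
    by apply/measurable_EFinP; exact: meas_slice2.
  apply: le_trans (le_abse_integral _ measurableT my).
  rewrite /Rintegral; case: (integral _ _ _) => [r| |] //=.
  + by rewrite normr0 leey.
  + by rewrite normr0 leey.
Qed.

Lemma intR_fubini1 h : L1 m12 h -> \int[m1]_x \int[m2]_y h (x, y) = \int[m12]_z h z.
Proof.
move=> Ih; rewrite /Rintegral -(integral12_prod_meas1 Ih); congr fine.
apply: ae_eq_integral => //.
- by apply/measurable_EFinP; exact: meas_intR1 (L1_meas Ih).
- exact: measurable_fubini_F Ih.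
- by apply: filterS (ae_L1_1 Ih) => x Ix _; rewrite fineK//; exact: integrable_fin_num.
Qed.

Lemma intR_fubini2 h : L1 m12 h -> \int[m2]_y \int[m1]_x h (x, y) = \int[m12]_z h z.
Proof.
move=> Ih; rewrite /Rintegral -(integral21_prod_meas1 Ih); congr fine.
apply: ae_eq_integral => //.
- by apply/measurable_EFinP; exact: meas_intR2 (L1_meas Ih).
- exact: measurable_fubini_G Ih.
- by apply: filterS (ae_L1_2 Ih) => x Ix _; rewrite fineK//; exact: integrable_fin_num.
Qed.

(** The complement has null sections, hence is null by Tonelli. *)
Lemma ae_prod1 (P : set (T1 * T2)) : measurable P ->
  {ae m1, forall x, {ae m2, forall y, P (x, y)}} -> {ae m12, forall z, P z}.
Proof.
move=> mP aP; exists (~` P); split => //; first exact: measurableC.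
rewrite /= /product_measure1.
rewrite -[RHS](integral0 m1 setT).
apply: ae_eq_integral => //.
  by apply: measurable_fun_xsection; exact: measurableC.
apply: filterS aP => x aPx _ /=.
have mx := measurable_xsection x (measurableC mP).
have [A [mA A0 PA]] := aPx.
apply/eqP; rewrite eq_le measure_ge0 andbT -A0 le_measure ?inE// => y.
by rewrite /xsection /= inE => nP; exact: PA.
Qed.

End fubini_real.

Lemma measurable_cvg0 d (T : measurableType d) (R : realType) (D : nat -> T -> R) :
  (forall n, measurable_fun setT (D n)) ->
  measurable [set x | D ^~ x @ \oo --> (0 : R)].
Proof.
move=> mD.
rewrite (_ : [set x | _] = \bigcap_k \bigcup_N \bigcap_m
    [set x | `|D (N + m)%N x| < k.+1%:R^-1]).
  apply: bigcapT_measurable => k; apply: bigcupT_measurable => N.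
  apply: bigcapT_measurable => m.
  have mf : measurable_fun setT (fun x => `|D (N + m)%N x|) by exact: measurableT_comp.
  have := mf measurableT _ (measurable_itv `]-oo, k.+1%:R^-1[); rewrite setTI.
  by rewrite (_ : _ @^-1` _ = [set x | `|D (N + m)%N x| < k.+1%:R^-1])//; apply/seteqP; split => x /=; rewrite in_itv.
apply/seteqP; split => x /=.
  move=> /cvgr0Pnorm_lt Dx k _.
  have [|N _ HN] := Dx (k.+1%:R^-1); first by rewrite invr_gt0.
  by exists N => // m _; apply: HN => /=; exact: leq_addr.
move=> H; apply/cvgr0Pnorm_lt => e e0.
have [k ke] : exists k, k.+1%:R^-1 < e.
  by have [k] := ltr_add_invr e0; rewrite add0r; exists k.
have [N _ HN] := H k I.
exists N => // m /= Nm; apply: lt_trans ke.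
by have := HN (m - N)%N I; rewrite /= subnKC.
Qed.

(** * Lebesgue points and translations on the line *)

Section lebesgue_points.
Context {R : realType}.
Local Notation lam := (@lebesgue_measure R).
Implicit Types (k U : R -> R) (x y s t : R).

Lemma L1_lebesgue_pt k : L1 lam k -> {ae lam, forall x, lebesgue_pt k x}.
Proof.
by move=> Ik; apply/lebesgue_differentiation/open_integrable_locally => //; exact: openT.
Qed.

(** At a Lebesgue point the averages against any kernel w of size C on a small
    ball are controlled, whatever the shape of w; this applies both to one-sided
    windows and to the derivatives of cutoffs. *)
Lemma lebesgue_pt_weight k x : L1 lam k -> lebesgue_pt k x -> forall e, 0 < e ->
  exists2 D : R, 0 < D & forall (h C : R) (w : R -> R), 0 < h -> h < D -> 0 <= C ->
    measurable_fun setT w -> (forall y, `|w y| <= C * \1_(ball x h) y) ->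
    L1 lam (fun y => w y * (k y - k x)) /\
    `|\int[lam]_y (w y * (k y - k x))| <= C * (e * h).
Proof.
move=> Ik kx e e0.
have e2 : 0 < e / 2 by rewrite divr_gt0.
have mk := L1_meas Ik.
have /fine_cvgP[fd /cvgr0Pnorm_lt cd] := kx.
have nd := cd _ e2.
have [D /= D0 HD] : \forall h \near (0:R)^'+, davg k x h \is a fin_num /\ `|fine (davg k x h)| < e / 2.
  by apply: filterS2 fd nd => h /= h1 h2; split.
exists D => // h C w h0 hD C0 mw wC.
have hh : ball_ [eta Num.Def.normr] 0 D h by rewrite /ball_/= sub0r normrN gtr0_norm.
have [dfin dlt] := HD h hh h0.
have mB : measurable (ball x h) by exact: measurable_ball.
have lb : lam (ball x h) = (h *+ 2)%:E := lebesgue_measure_ball x (ltW h0).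
pose B y := `|k y - k x| * \1_(ball x h) y.
have IB : L1 lam B.
  have Ic : L1 lam (fun y => `|k x| * \1_(ball x h) y).
    apply/L1Z/L1P; first exact: measurable_indic.
    under eq_integral do rewrite ger0_norm//.
    rewrite integral_indic// setIT.
    suff : (lam (ball x h) < +oo)%E by [].
    by rewrite lb ltry.
  apply: (L1_le _ (L1D (L1_abs Ik) Ic)) => [|y].
    apply: measurable_funM; last exact: measurable_indic.
    by apply: measurableT_comp => //; apply: measurable_funB.
  rewrite normrM normr_id indicE; case: (y \in _); rewrite ?normr1 ?normr0 ?mulr1 ?mulr0 ?addr0//.
  exact: ler_normB.
have EB : \int[lam]_y B y <= e * h.
  move: dfin dlt; rewrite /davg /iavg.
  have -> : (\int[lam]_(y in ball x h) `|((center (k x) \o k) y)%:E| = (\int[lam]_y B y)%:E)%E.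
    rewrite EFin_intR// [LHS]integral_mkcond; apply: eq_integral => y _.
    rewrite patchE /B indicE; case: ifPn => yb; last by rewrite mulr0.
    by rewrite mulr1.
  rewrite lb.
  have h2 : h *+ 2 != 0 by rewrite mulrn_eq0/= gt_eqF.
  rewrite inver (negbTE h2) -EFinM /= => _.
  rewrite normrM ger0_norm ?invr_ge0 ?mulrn_wge0 ?(ltW h0)//.
  rewrite ger0_norm; last by apply: intR_ge0 => y; rewrite mulr_ge0// indicE ler0n.
  rewrite ltr_pdivrMl ?mulrn_wgt0// => /ltW; rewrite (_ : _ *+ 2 * _ = e * h)//.
  by rewrite mulr2n; field.
have IC : L1 lam (fun y => C * B y) by exact: L1Z.
have wB y : `|w y * (k y - k x)| <= C * B y.
  rewrite normrM /B [X in _ <= C * X]mulrC [X in _ <= X]mulrC.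
  by rewrite [X in _ <= X]mulrC mulrA; apply: ler_wpM2r => //; exact: wC.
have Iw : L1 lam (fun y => w y * (k y - k x)).
  by apply: (L1_le _ IC wB); apply: measurable_funM => //; exact: measurable_funB.
split => //; apply: le_trans (intR_abs_le Iw IC wB) _.
by rewrite intRZ// ler_wpM2l.
Qed.

Lemma L1_indic_itv (i : interval R) : (lam [set` i] < +oo)%E -> L1 lam \1_[set` i].
Proof.
by apply: L1_indicator.
Qed.

Lemma intR_indic_oc x y : x <= y -> \int[lam]_r \1_(`]x, y]) r = y - x.
Proof.
move=> xy; rewrite /Rintegral integral_indic// setIT /= lebesgue_measure_itv/= lte_fin.
case: ltP => // yx; have -> : x = y by apply/eqP; rewrite eq_le xy.
by rewrite subrr.
Qed.

Lemma L1_indic_oc x y : L1 lam \1_(`]x, y]).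
Proof.
apply: L1_indic_itv; rewrite lebesgue_measure_itv/=; case: ifP => // _.
by rewrite -EFinB ltry.
Qed.

Lemma avg_limit k x : L1 lam k -> lebesgue_pt k x ->
  (m.+1%:R * \int[lam]_y (k y * \1_(`]x - m.+1%:R^-1, x]) y)) @[m --> \oo] --> k x.
Proof.
move=> Ik kx; apply/cvgrPdist_le => e e0.
have e2 : 0 < e / 2 by rewrite divr_gt0.
have [D D0 HD] := lebesgue_pt_weight Ik kx e2.
have nD : \forall m \near \oo, 2 * m.+1%:R^-1 < D :> R.
  have D2 : 0 < D / 2 by rewrite divr_gt0.
  have [m hm] := ltr_add_invr D2; rewrite add0r in hm.
  exists m => // p /= mp; rewrite mulrC -ltr_pdivlMr//; apply: le_lt_trans hm.
  by rewrite lef_pV2 ?posrE// ler_nat.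
near=> m.
have mD : 2 * m.+1%:R^-1 < D by near: m.
set h := (m.+1%:R^-1 : R); have h0 : 0 < h by rewrite invr_gt0.
pose w y : R := \1_(`]x - h, x]) y.
have h20 : 0 < 2 * h by rewrite mulr_gt0.
have mw : measurable_fun setT w by exact: measurable_indic.
have wC y : `|w y| <= 1 * \1_(ball x (2 * h)) y.
  rewrite mul1r /w !indicE ger0_norm ?ler0n// ler_nat; case: (boolP (y \in `]x - h, x]%classic)) => //.
  rewrite inE/= in_itv/= => /andP[y1 y2]; rewrite mem_set// /ball/=.
  by rewrite ger0_norm ?subr_ge0//; lra.
have [Iw Hw] := HD _ _ _ h20 mD ler01 mw wC.
have Ik1 : L1 lam (fun y => k y * w y).
  refine (@L1M_bd _ _ R lam 1 k w mw _ Ik) => y.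
  by rewrite /w indicE ger0_norm ?ler0n// lern1 leq_b1.
have Iw1 : L1 lam (fun y => k x * w y) by apply: L1Z; exact: L1_indic_oc.
have : \int[lam]_y (w y * (k y - k x)) = \int[lam]_y (k y * w y) - k x * h.
  rewrite -[h](_ : x - (x - h) = _); last by rewrite opprB addrC subrK.
  rewrite -intR_indic_oc ?gerBl ?(ltW h0)// -intRZ; last exact: L1_indic_oc.
  by rewrite -intRB//; apply: eq_Rintegral => y _; rewrite mulrBr mulrC (mulrC (w y)).
move=> E; rewrite E in Hw.
rewrite -[k x](_ : m.+1%:R * (k x * h) = _); last by rewrite mulrC -mulrA mulVf// mulr1.
rewrite -mulrBr normrM distrC gtr0_norm// -ler_pdivlMl// -/h.
by apply: le_trans Hw _; rewrite mul1r mulrA mulrC divfK.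
Unshelve. all: by end_near. Qed.

End lebesgue_points.

Lemma ae_neq (R : realType) (t : R) : {ae @lebesgue_measure R, forall q, q != t}.
Proof.
exists [set t]; split => //; first exact: lebesgue_measure_set1.
by move=> x /= /negP; rewrite negbK => /eqP.
Qed.

Section translation.
Context {R : realType}.
Local Notation lam := (@lebesgue_measure R).
Variable h : R.

Let sh : measurableTypeR R -> measurableTypeR R := fun x => x + h.

Let msh : measurable_fun setT sh.
Proof. by apply: measurable_funD => //; exact: measurable_id. Qed.

Let lebesgue_measure_shift (A : set R) : measurable A ->
  pushforward lam sh A = lam A.
Proof.
move=> mA; apply/esym/lebesgue_measure_unique => //= _ [[a b]] _ <-.
rewrite /pushforward (_ : sh @^-1` _ = `]a - h, b - h]%classic).
  rewrite !lebesgue_measure_itv/= !lte_fin ltrD2r; case: ifP => // _.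
  by rewrite -!EFinB; congr (_%:E); ring.
by apply/seteqP; split => x /=; rewrite !in_itv/= /sh ltrBlDr lerBrDr.
Qed.

(** Lebesgue measure is the only measure with its values on half-open intervals. *)
Lemma intR_shift (k : R -> R) : L1 lam k ->
  L1 lam (fun x => k (x + h)) /\ \int[lam]_x k (x + h) = \int[lam]_x k x.
Proof.
move=> Ik; have mk := L1_meas Ik.
have msh' := msh.
have I1 : L1 lam (fun x => k (x + h)).
  apply: L1P; first exact: measurableT_comp mk msh.
  have /= := @ge0_integral_pushforward _ _ _ _ _ _ msh lam setT (fun x => `|k x|%:E)%E measurableT.
  rewrite preimage_setT => <-; last 2 first.
  - by apply/measurable_EFinP/measurableT_comp.
  - by move=> y _; rewrite lee_fin.
  rewrite (eq_measure_integral lam) => [|A mA _]; last exact: lebesgue_measure_shift.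
  exact: L1_lty Ik.
split => //; rewrite /Rintegral; congr fine.
have mE : measurable_fun setT (EFin \o k) by exact/measurable_EFinP.
have I2 : lam.-integrable (sh @^-1` setT) ((EFin \o k) \o sh) by rewrite preimage_setT.
have := integral_pushforward msh mE I2 measurableT.
rewrite preimage_setT /= => <-.
by apply: eq_measure_integral => A mA _; exact: lebesgue_measure_shift.
Qed.

End translation.

(** * Time cutoffs *)

Section time_cutoffs.
Context {R : realType}.
Local Notation lam := (@lebesgue_measure R).
Implicit Types (k U : R -> R) (a r s t : R).

Lemma cont_meas (f : R -> R) : continuous f -> measurable_fun (setT : set (measurableTypeR R)) f.
Proof. exact: continuous_measurable_fun. Qed.

(** It rises from 0 to 1 on [s, s + 1/a] and falls back to 0 on [t, t + 1/a]; it
    tends to the indicator of ]s, t] as a grows. *)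
Definition cutoff a s t r := sstep (a * (r - s)) - sstep (a * (r - t)).
Definition dcutoff a s t r := a * dstep (a * (r - s)) - a * dstep (a * (r - t)).

Let aff_smooth a s : smooth (fun r : R => a * (r - s)).
Proof.
apply: smoothMf; first exact: smooth_cst.
by apply: smoothBf; [exact: smooth_id|exact: smooth_cst].
Qed.

Let is_derive_aff a s r : is_derive r 1 (fun r : R => a * (r - s)) a.
Proof.
have := is_deriveZ a (is_deriveB (is_derive_id r 1) (is_derive_cst s r 1)).
by rewrite subr0 /GRing.scale/= mulr1.
Qed.

Let is_derive_step a s r :
  is_derive r 1 (fun r : R => sstep (a * (r - s))) (a * dstep (a * (r - s))).
Proof.
have := @is_derive1_comp _ sstep (fun r => a * (r - s)) r _ _ (is_derive_sstep _) (is_derive_aff a s r).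
by rewrite mulrC.
Qed.

Lemma smooth_cutoff a s t : smooth (cutoff a s t).
Proof. by apply: smoothBf; apply: smooth_comp => //; exact: smooth_sstep. Qed.

Lemma is_derive_cutoff a s t r : is_derive r 1 (cutoff a s t) (dcutoff a s t r).
Proof. exact: is_deriveB. Qed.

Lemma cutoff_ge0 a s t r : 0 < a -> s <= t -> 0 <= cutoff a s t r.
Proof.
by move=> a0 st; rewrite subr_ge0 sstep_homo// ler_pM2l// lerB.
Qed.

Lemma cutoff_le1 a s t r : cutoff a s t r <= 1.
Proof. by rewrite /cutoff lerBlDr ler_wpDr ?sstep_ge0 ?sstep_le1. Qed.

Lemma cutoff_out a s t r : 0 < a -> s <= t -> r <= s \/ t + a^-1 <= r -> cutoff a s t r = 0.
Proof.
move=> a0 st [rs|tr]; rewrite /cutoff.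
  rewrite !sstep0 ?subrr// ?pmulr_rle0 ?subr_le0//.
  exact: le_trans st.
have h : 1 <= a * (r - t) by rewrite -ler_pdivrMl// mulr1 lerBrDl.
rewrite !sstep1 ?subrr//; apply: le_trans h _.
by rewrite ler_pM2l// lerB.
Qed.

Let cdstep a s : continuous (fun r : R => dstep (a * (r - s))).
Proof.
by move=> r; apply: (@smooth_cont _ _ (fun r : R => dstep (a * (r - s)))); apply: smooth_comp => //; exact: smooth_dstep.
Qed.

Let csstep a s : continuous (fun r : R => sstep (a * (r - s))).
Proof.
by move=> r; apply: (@smooth_cont _ _ (fun r : R => sstep (a * (r - s)))); apply: smooth_comp => //; exact: smooth_sstep.
Qed.

Let dstep_bd a s (C : R) : 0 < a -> (forall x, `|dstep x| <= C) ->
  forall r, `|dstep (a * (r - s))| <= C * \1_(ball s (2 * a^-1)) r.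
Proof.
move=> a0 HC r; rewrite indicE; case: (boolP (r \in _)) => rb; first by rewrite mulr1 HC.
rewrite mulr0 dstep_out ?normr0//.
have [rs|rs] := ltP r s; first by left; rewrite pmulr_rlt0// subr_lt0.
right; rewrite -ltr_pdivrMl// mulr1; rewrite ltNge; apply: contra rb => h.
rewrite inE /ball/= ler0_norm ?subr_le0// opprB (le_lt_trans h)// mulr_natl.
by rewrite mulr2n ltrDl invr_gt0.
Qed.

Let mdstep a s : measurable_fun (setT : set (measurableTypeR R)) (fun r : R => dstep (a * (r - s))).
Proof. by apply: cont_meas; exact: cdstep. Qed.

Let L1_dstep a s : 0 < a -> L1 lam (fun r => dstep (a * (r - s))).
Proof.
move=> a0; have [C C0 /(dstep_bd s a0) HC] := @dstep_bounded R.
apply: (@L1_le _ _ _ lam _ (fun r => C * \1_(ball s (2 * a^-1)) r)) => //.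
apply: L1Z; rewrite ball_itv; apply: L1_indic_itv.
by rewrite lebesgue_measure_itv/=; case: ifP => // _; rewrite -EFinB ltry.
Qed.

(** The derivative of the rising part integrates to 1. *)
Let intR_dstep a s : 0 < a -> \int[lam]_r (a * dstep (a * (r - s))) = 1.
Proof.
move=> a0; have ai : 0 < a^-1 by rewrite invr_gt0.
have -> : \int[lam]_r (a * dstep (a * (r - s))) =
          \int[lam]_(r in `[s, s + a^-1]) (a * dstep (a * (r - s))).
  rewrite [RHS]Rintegral_mkcond; apply: eq_Rintegral => r _.
  rewrite patchE; case: ifPn => //; rewrite notin_setE/= in_itv/= => /negP.
  rewrite negb_and -!ltNge => /orP h; rewrite dstep_out ?mulr0//.
  case: h => h; [left|right]; first by rewrite pmulr_rlt0// subr_lt0.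
  by rewrite -ltr_pdivrMl// mulr1 ltrBrDl.
rewrite /Rintegral.
rewrite (@continuous_FTC2 _ _ (fun r => sstep (a * (r - s)))).
- have -> : a * (s + a^-1 - s) = 1 by field; rewrite gt_eqF.
  by rewrite subrr mulr0 (sstep1 (lexx 1)) (sstep0 (lexx 0)) -EFinB subr0.
- by rewrite ltrDl.
- apply: continuous_subspaceT => r; apply: cvgM; first exact: cvg_cst.
  exact: cdstep.
- split => [r _|  |]; first by have [] := is_derive_step a s r.
  + by apply: cvg_at_right_filter; exact: csstep.
  + by apply: cvg_at_left_filter; exact: csstep.
- by move=> r _; rewrite derive1E; have [_ ->] := is_derive_step a s r.
Qed.

Lemma L1_dstepM a s U : L1 lam U -> L1 lam (fun r => a * dstep (a * (r - s)) * U r).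
Proof.
move=> IU; have [C C0 HC] := @dstep_bounded R.
have := @L1M_bd _ _ R lam C U (fun r => dstep (a * (r - s))) (mdstep a s) (fun r => HC _) IU.
move=> /(L1Z a); rewrite (_ : (fun _ => _) = (fun r => a * dstep (a * (r - s)) * U r))//.
by apply/funext => r; rewrite mulrCA mulrC.
Qed.

(** The derivatives a * dstep (a * (r - s)) form an approximate identity on the right
    of s. *)
Lemma step_limit U s : L1 lam U -> lebesgue_pt U s ->
  (\int[lam]_r (m.+1%:R * dstep (m.+1%:R * (r - s)) * U r)) @[m --> \oo] --> U s.
Proof.
move=> IU Us; apply/cvgrPdist_le => e e0.
have [C C0 HC] := @dstep_bounded R.
have e2 : 0 < e / (2 * C) by rewrite divr_gt0// mulr_gt0.
have [D D0 HD] := lebesgue_pt_weight IU Us e2.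
have nD : \forall m \near \oo, 2 * m.+1%:R^-1 < D :> R.
  have D2 : 0 < D / 2 by rewrite divr_gt0.
  have [m hm] := ltr_add_invr D2; rewrite add0r in hm.
  exists m => // p /= mp; rewrite mulrC -ltr_pdivlMr//; apply: le_lt_trans hm.
  by rewrite lef_pV2 ?posrE// ler_nat.
near=> m.
have mD : 2 * m.+1%:R^-1 < D by near: m.
set a := (m.+1%:R : R); have a0 : 0 < a by [].
have h0 : 0 < 2 * a^-1 by rewrite mulr_gt0// invr_gt0.
have wC := dstep_bd s a0 HC.
have [Iw Hw] := HD _ _ _ h0 mD (ltW C0) (mdstep a s) wC.
have E : \int[lam]_r (a * dstep (a * (r - s)) * U r) - U s =
         a * \int[lam]_y (dstep (a * (y - s)) * (U y - U s)).
  rewrite -intRZ// -[X in _ - X]mulr1 -(intR_dstep s a0) -intRZ; last exact/L1Z/L1_dstep.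
  rewrite -intRB; [|exact: L1_dstepM|exact/L1Z/L1Z/L1_dstep].
  by apply: eq_Rintegral => r _; ring.
rewrite distrC E normrM gtr0_norm// -ler_pdivlMl//.
apply: le_trans Hw _; rewrite le_eqVlt; apply/orP; left; apply/eqP.
by field; rewrite !gt_eqF.
Unshelve. all: by end_near. Qed.

Lemma sstep_limit s r : sstep (m.+1%:R * (r - s)) @[m --> \oo] --> ((s < r)%R%:R : R).
Proof.
have [sr|rs] := ltP s r.
  have d0 : 0 < r - s by rewrite subr_gt0.
  have [N hN] := ltr_add_invr d0; rewrite add0r in hN.
  apply: cvg_near_cst; near=> m; rewrite sstep1// mulrC -ler_pdivrMr// mul1r.
  apply: le_trans (ltW hN); rewrite lef_pV2 ?posrE// ler_nat.
  by near: m; exists N.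
apply: cvg_near_cst; apply: nearW => m; rewrite sstep0//.
by rewrite pmulr_rle0// subr_le0.
Unshelve. all: by end_near. Qed.

Lemma meas_cutoff a s t : measurable_fun (setT : set (measurableTypeR R)) (cutoff a s t).
Proof. by apply: cont_meas => r; exact: (@smooth_cont _ _ _ (smooth_cutoff a s t)). Qed.

Lemma cutoff_norm a s t r : 0 < a -> s <= t -> `|cutoff a s t r| <= 1.
Proof. by move=> a0 st; rewrite ger0_norm ?cutoff_ge0// cutoff_le1. Qed.

Lemma cutoff_limit K s t : L1 lam K -> s < t ->
  (\int[lam]_r (cutoff m.+1%:R s t r * K r)) @[m --> \oo] -->
  \int[lam]_r (K r * \1_(`]s, t]) r).
Proof.
move=> IK st; have mK := L1_meas IK.
apply: (@intR_dominated_cvg _ _ _ lam (fun m r => cutoff m.+1%:R s t r * K r) _ (fun r => `|K r|) _ _ _ _ _).2.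
- by move=> m; apply: measurable_funM => //; exact: meas_cutoff.
- by apply: measurable_funM => //; exact: measurable_indic.
- exact: L1_abs.
- apply: aeW => r; rewrite mulrC; apply: cvgM; last exact: cvg_cst.
  rewrite (_ : \1__ _ = (s < r)%R%:R - (t < r)%R%:R); first by apply: cvgB; exact: sstep_limit.
  rewrite indicE; case: (boolP (r \in _)); rewrite ?inE ?notin_setE/= in_itv/=.
    by move=> /andP[-> rt]; rewrite ltNge rt subr0.
  move=> /negP; rewrite negb_and -leNgt -ltNge => /orP[rs|tr].
    by rewrite !ltNge rs (le_trans rs (ltW st)) subr0.
  by rewrite tr (lt_trans st tr) subrr.
- by apply: aeW => r m; rewrite normrM ler_piMl// cutoff_norm// ltW.
Qed.

(** A function U with weak derivative - K differs from a primitive of - K by a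
    constant, here in integrated form between two Lebesgue points of U: the
    derivative of the cutoff yields U s - U t in the limit. *)
Lemma du_bois_reymond U K s t : L1 lam U -> L1 lam K -> s < t ->
  lebesgue_pt U s -> lebesgue_pt U t ->
  (exists N, forall m, (N <= m)%N ->
    \int[lam]_r (dcutoff m.+1%:R s t r * U r) = \int[lam]_r (cutoff m.+1%:R s t r * K r)) ->
  U s - U t = \int[lam]_r (K r * \1_(`]s, t]) r).
Proof.
move=> IU IK st Us Ut [N HN].
have c1 := cvgB (step_limit IU Us) (step_limit IU Ut).
have c2 := cutoff_limit IK st.
suff c3 : \int[lam]_r (cutoff m.+1%:R s t r * K r) @[m --> \oo] --> U s - U t.
  exact: (cvg_unique _ c3 c2).
apply: cvg_trans (c1 _); apply: near_eq_cvg; near=> m.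
rewrite -HN; last by near: m; exists N.
transitivity (\int[lam]_r (m.+1%:R * dstep (m.+1%:R * (r - s)) * U r) -
  \int[lam]_r (m.+1%:R * dstep (m.+1%:R * (r - t)) * U r)); first by [].
rewrite -intRB; [|exact: L1_dstepM|exact: L1_dstepM].
by apply: eq_Rintegral => r _; rewrite mulrBl.
Unshelve. all: by end_near. Qed.

Lemma ge0_of_cutoffs K s t : L1 lam K -> s < t ->
  (exists N, forall m, (N <= m)%N -> 0 <= \int[lam]_r (cutoff m.+1%:R s t r * K r)) ->
  0 <= \int[lam]_r (K r * \1_(`]s, t]) r).
Proof.
move=> IK st [N HN]; apply: (@closed_cvg _ _ _ _ _ [set x : R | 0 <= x] _ _ _ (cutoff_limit IK st)).
  exact: closed_ge.
by exists N => // m /=; exact: HN.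
Qed.

End time_cutoffs.

(** * Steklov averages *)

Section steklov.
Context d (X : measurableType d) (R : realType).
Context (mu : {sigma_finite_measure set X -> \bar R}).
Local Notation lam := (@lebesgue_measure R).
Local Notation Y := (X * measurableTypeR R)%type.
Local Notation m := (mu \x lam)%E.
Implicit Types (k g : Y -> R) (a b h : R).

Lemma ae_fst (P : set X) : {ae mu, forall x, P x} -> {ae m, forall z, P z.1}.
Proof.
move=> [A [mA A0 PA]]; exists (A `*` setT); split.
- exact: measurableX.
- have A0' : (mu A = 0)%E by exact: A0.
  by rewrite (@product_measure1E _ _ _ _ _ mu lam A setT mA measurableT) [X in (X * _)%E]A0' mul0e.
- by move=> [x r] /= nP; split => //; exact: PA.
Qed.

Lemma ae_snd (P : set (measurableTypeR R)) :
  {ae lam, forall x, P x} -> {ae m, forall z, P z.2}.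
Proof.
move=> [A [mA A0 PA]]; exists (setT `*` A); split.
- exact: measurableX.
- have A0' : (lam A = 0)%E by exact: A0.
  by rewrite (@product_measure1E _ _ _ _ _ mu lam setT A measurableT mA) [X in (_ * X)%E]A0' mule0.
- by move=> [x r] /= nP; split => //; exact: PA.
Qed.

Let win h : set (Y * measurableTypeR R) := [set p | p.1.2 - h < p.2 <= p.1.2].

Let mwin h : measurable (win h).
Proof.
pose f1 (p : Y * measurableTypeR R) : R := p.2 - (p.1.2 - h).
pose f2 (p : Y * measurableTypeR R) : R := p.1.2 - p.2.
have m1 : measurable_fun setT (fun p : Y * measurableTypeR R => p.1.2).
  exact: measurableT_comp measurable_snd measurable_fst.
have m2 : measurable_fun setT (fun p : Y * measurableTypeR R => p.2).
  exact: measurable_snd.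
have mf1 : measurable_fun setT f1.
  by apply: measurable_funB => //; apply: measurable_funB.
have mf2 : measurable_fun setT f2 by apply: measurable_funB.
have := measurableI _ _ (mf1 measurableT _ (measurable_itv `]0, +oo[))
  (mf2 measurableT _ (measurable_itv `[0, +oo[)).
rewrite !setTI; congr measurable; apply/seteqP; split => p /=;
  rewrite !in_itv/= !andbT /f1 /f2 subr_gt0 subr_ge0 /win /=.
  by move=> [-> ->].
by move=> /andP.
Qed.

Let winE h z q : \1_(win h) (z, q) = \1_(`]z.2 - h, z.2]) q :> R.
Proof.
by rewrite !indicE; congr (_%:R); apply/idP/idP; rewrite !inE /win/= in_itv/=.
Qed.

Definition time_int k a b (x : X) := \int[lam]_q (k (x, q) * \1_(`]a, b]) q).

(** Backward in time, to match the increments of a solution from r - h to r. *)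
Definition steklov h k (z : Y) : R := h^-1 * \int[lam]_q (k (z.1, q) * \1_(`]z.2 - h, z.2]) q).

Let meas_ker h k : measurable_fun setT k ->
  measurable_fun setT (fun p : Y * measurableTypeR R => k (p.1.1, p.2) * \1_(win h) p).
Proof.
move=> mk; apply: measurable_funM.
  have m1 : measurable_fun setT (fun p : Y * measurableTypeR R => p.1.1).
    exact: measurableT_comp measurable_fst measurable_fst.
  exact: measurableT_comp mk (measurable_fun_pair m1 measurable_snd).
exact: measurable_indic (mwin h).
Qed.

Lemma meas_steklov h k : measurable_fun setT k -> measurable_fun setT (steklov h k).
Proof.
move=> mk; apply: measurable_funM => //.
have := @meas_intR1 _ _ _ _ R lam _ (meas_ker h mk).
by congr (measurable_fun _ _); apply/funext => z; apply: eq_Rintegral => q _; rewrite winE.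
Qed.

Lemma L1_mul_oc a b (f : R -> R) : L1 lam f -> L1 lam (fun q => f q * \1_(`]a, b]) q).
Proof.
move=> If; refine (@L1M_bd _ _ R lam 1 f (\1_(`]a, b]) : R -> R) _ _ If) => [|y].
  exact: measurable_indic.
by rewrite indicE ger0_norm ?ler0n// lern1 leq_b1.
Qed.

(** The integral of (f - c)^2 over the window is nonnegative when c is the mean of
    f. *)
Lemma cauchy_schwarz_oc a b (f : R -> R) : a < b -> L1 lam f -> L1 lam (fun q => f q ^+ 2) ->
  (\int[lam]_q (f q * \1_(`]a, b]) q)) ^+ 2 <=
  (b - a) * \int[lam]_q (f q ^+ 2 * \1_(`]a, b]) q).
Proof.
move=> ab If If2; have ba : 0 < b - a by rewrite subr_gt0.
set J := \int[lam]_q (f q * _); set Q := \int[lam]_q _.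
pose c := J / (b - a).
have : 0 <= \int[lam]_q ((f q - c) ^+ 2 * \1_(`]a, b]) q).
  by apply: intR_ge0 => q; rewrite mulr_ge0 ?sqr_ge0// indicE ler0n.
have -> : \int[lam]_q ((f q - c) ^+ 2 * \1_(`]a, b]) q) =
    Q - (2 * c) * J + c ^+ 2 * (b - a).
  have i1 : L1 lam (fun q => f q ^+ 2 * \1_(`]a, b]) q) := L1_mul_oc _ _ If2.
  have i2 : L1 lam (fun q => (2 * c) * (f q * \1_(`]a, b]) q)) := L1Z _ (L1_mul_oc _ _ If).
  have i3 : L1 lam (fun q => c ^+ 2 * \1_(`]a, b]) q) := L1Z _ (L1_indic_oc a b).
  rewrite /J -(intR_indic_oc (ltW ab)) -intRZ; last exact: L1_mul_oc.
  rewrite -intRZ; last exact: L1_indic_oc.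
  rewrite -intRB// -intRD//; last exact: L1B.
  by apply: eq_Rintegral => q _; ring.
rewrite /c => H.
have : 0 <= (b - a) * (Q - 2 * (J / (b - a)) * J + (J / (b - a)) ^+ 2 * (b - a)).
  by rewrite mulr_ge0// ltW.
rewrite -subr_ge0; congr (0 <= _); field.
by rewrite gt_eqF.
Qed.

(** By Tonelli: each time q belongs to the windows that end in [q, q + h[, of
    total length h. *)
Lemma steklov_ge0E h k : 0 < h -> (forall z, 0 <= k z) -> L1 m k ->
  L1 m (steklov h k) /\ \int[m]_z steklov h k z = \int[m]_z k z.
Proof.
move=> h0 k0 Ik; have mk := L1_meas Ik.
pose H (p : Y * measurableTypeR R) : \bar R := (k (p.1.1, p.2) * \1_(win h) p)%:E.
have H0 p : (0 <= H p)%E by rewrite lee_fin mulr_ge0// indicE ler0n.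
have mH : measurable_fun setT H by apply/measurable_EFinP; exact: meas_ker.
pose E z := (\int[lam]_q H (z, q))%E.
have mE : measurable_fun setT E by exact: measurable_fun_fubini_tonelli_F.
have E0 z : (0 <= E z)%E by apply: integral_ge0.
have winH x q r : H ((x, r), q) = (k (x, q) * \1_(`[q, q + h[) r)%:E.
  rewrite /H winE /=; congr (_ * _)%:E; rewrite !indicE; congr (_%:R); congr nat_of_bool.
  by apply/idP/idP; rewrite !inE/= !in_itv/= ltrBlDr => /andP[-> ->].
have inner x q : (\int[lam]_r H ((x, r), q) = (h * k (x, q))%:E)%E.
  have I1 : L1 lam \1_(`[q, q + h[).
    apply: L1_indic_itv; rewrite lebesgue_measure_itv/=; case: ifP => // _.
    by rewrite -EFinB ltry.
  transitivity (\int[lam]_r (k (x, q) * \1_(`[q, q + h[) r)%:E)%E.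
    by apply: eq_integral => r _; exact: winH.
  rewrite -EFin_intR; last exact: L1Z.
  rewrite intRZ// mulrC; congr (_ * _)%:E.
  rewrite /Rintegral integral_indic// setIT /= lebesgue_measure_itv/= lte_fin ltrDl h0.
  by rewrite -EFinB /= addrC addKr.
have hk0 z : (0 <= (h * k z)%:E)%E by rewrite lee_fin mulr_ge0// ltW.
have mhk : measurable_fun setT (fun z => (h * k z)%:E).
  by apply/measurable_EFinP; apply: measurable_funM.
have IE : (\int[m]_z E z = \int[m]_z (h * k z)%:E)%E.
  rewrite (@fubini_tonelli1 _ _ _ _ R mu lam E mE E0) (@fubini_tonelli1 _ _ _ _ R mu lam _ mhk hk0).
  apply: eq_integral => x _; rewrite /fubini_F /E.
  have mHx : measurable_fun setT (fun p : measurableTypeR R * measurableTypeR R => H ((x, p.1), p.2)).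
    apply: (measurableT_comp mH); apply: measurable_fun_pair => //.
    by apply: measurable_fun_pair => //; exact: measurable_cst.
  rewrite (@fubini_tonelli _ _ _ _ R lam lam _ mHx)//.
  by apply: eq_integral => q _; exact: inner.
have steE : {ae m, forall z, (steklov h k z)%:E = (h^-1%:E * E z)%E}.
  have := ae_fst (ae_L1_1 Ik); apply: filterS => -[x r] /= Ix.
  rewrite /steklov /E EFinM EFin_intR/=; last exact: L1_mul_oc.
  by congr (_ * _)%E; apply: eq_integral => q _; rewrite /H winE.
have ms := meas_steklov h mk.
have s0 z : 0 <= steklov h k z.
  rewrite /steklov mulr_ge0 ?invr_ge0 ?(ltW h0)//; apply: intR_ge0 => q.
  by rewrite mulr_ge0// indicE ler0n.
have Is : (\int[m]_z (steklov h k z)%:E = \int[m]_z (k z)%:E)%E.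
  rewrite (@ae_eq_integral _ _ _ m setT (fun z => h^-1%:E * E z)%E)//.
  - rewrite ge0_integralZl// ?lee_fin ?invr_ge0 ?(ltW h0)//.
    rewrite IE -ge0_integralZl// ?lee_fin ?invr_ge0 ?(ltW h0)//.
    by apply: eq_integral => z _; rewrite -EFinM mulKf// gt_eqF.
  - exact/measurable_EFinP.
  - exact: measurable_funeM.
  - by apply: filterS steE => z -> _.
split; last by rewrite /Rintegral Is.
apply: L1P => //; under eq_integral do rewrite ger0_norm//.
by rewrite Is; apply: le_lt_trans (L1_lty Ik); apply: ge0_le_integral => //;
  [move=> z _; rewrite lee_fin|exact/measurable_EFinP|apply/measurable_EFinP; exact: measurableT_comp|move=> z _; rewrite lee_fin ler_norm].
Qed.

Let hh n : R := n.+1%:R^-1.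

(** Almost every section is integrable in time, and almost every time is a
    Lebesgue point of it. *)
Lemma steklov_ae k : L1 m k -> {ae m, forall z, (steklov (hh n) k z) @[n --> \oo] --> k z}.
Proof.
move=> Ik; have mk := L1_meas Ik.
have : {ae m, forall z, (fun n => steklov (hh n) k z - k z) @ \oo --> (0 : R)}.
  apply: (ae_prod1 (P := [set z | (fun n => steklov (hh n) k z - k z) @ \oo --> (0 : R)])).
    by apply: measurable_cvg0 => n; apply: measurable_funB => //; exact: meas_steklov.
  apply: filterS (ae_L1_1 Ik) => x Ix.
  apply: (@filterS _ _ (ae_filter_ringOfSetsType lam) _ _ _ (L1_lebesgue_pt Ix)) => r rp /=.
  have c := avg_limit Ix rp.
  rewrite -(subrr (k (x, r))); apply: cvgB; last exact: cvg_cst.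
  by apply: cvg_trans c; apply: near_eq_cvg; apply: nearW => n; rewrite /steklov/= /hh invrK.
apply: filterS => z c; rewrite -[X in _ --> X]add0r.
apply: cvg_trans (cvgD c (cvg_cst (k z))); apply: near_eq_cvg; apply: nearW => n /=.
by rewrite /= subrK.
Qed.

(** At a point f_n is at most min (f_n, w) + (w_n - w) + max (w - w_n, 0). The first and
    the last term are dominated by w and tend to 0, and the integral of the middle
    one is at most 0. *)
Lemma scheffe (f_ w_ : nat -> Y -> R) (w : Y -> R) :
  (forall n z, 0 <= f_ n z) -> (forall n, L1 m (f_ n)) ->
  (forall n z, 0 <= w_ n z) -> (forall n, L1 m (w_ n)) -> L1 m w ->
  (forall n, {ae m, forall z, f_ n z <= w_ n z}) ->
  {ae m, forall z, f_ ^~ z @ \oo --> (0 : R)} ->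
  {ae m, forall z, w_ ^~ z @ \oo --> w z} ->
  (forall n, \int[m]_z w_ n z <= \int[m]_z w z) ->
  \int[m]_z f_ n z @[n --> \oo] --> (0 : R).
Proof.
move=> f0 If w0 Iw_ Iw fw fc wc wi.
have mf n := L1_meas (If n); have mw_ n := L1_meas (Iw_ n); have mw := L1_meas Iw.
have wge0 : {ae m, forall z, 0 <= w z}.
  apply: filterS wc => z c; apply: (@closed_cvg _ _ _ _ _ [set x : R | 0 <= x] _ _ _ c).
    exact: closed_ge.
  by apply: nearW => n /=.
pose p n z := Num.min (f_ n z) `|w z|.
have mp n : measurable_fun setT (p n) by apply: measurable_minr => //; exact: measurableT_comp.
have [_ cp] : L1 m (fun=> 0) /\ (\int[m]_z p n z @[n --> \oo] --> \int[m]_z (0 : R)).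
  apply: (intR_dominated_cvg _ _ (L1_abs Iw)) => //.
    apply: filterS fc => z c; apply: (@squeeze_cvgr _ _ _ _ (fun=> 0) (f_ ^~ z)) => //.
      by apply: nearW => n; rewrite /p le_min f0 normr_ge0 ge_min lexx.
    exact: cvg_cst.
  by apply: aeW => z n; rewrite /p ger0_norm ?ge_min ?lexx ?orbT// le_min f0 normr_ge0.
pose q n z := Num.max (w z - w_ n z) 0.
have mq n : measurable_fun setT (q n).
  by apply: measurable_maxr => //; exact: measurable_funB.
have [_ cq] : L1 m (fun=> 0) /\ (\int[m]_z q n z @[n --> \oo] --> \int[m]_z (0 : R)).
  apply: (intR_dominated_cvg _ _ (L1_abs Iw)) => //.
    apply: filterS wc => z c.
    have c0 : (fun n => `|w z - w_ n z|) @ \oo --> (0 : R).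
      by rewrite -(normr0 R) -(subrr (w z)); apply: cvg_norm; apply: cvgB => //; exact: cvg_cst.
    apply: (@squeeze_cvgr _ _ _ _ (fun=> 0) (fun n => `|w z - w_ n z|)) => //.
      by apply: nearW => n; rewrite /q le_max lexx orbT ge_max ler_norm normr_ge0.
    exact: cvg_cst.
  apply: aeW => z n; rewrite /q ger0_norm; last by rewrite le_max lexx orbT.
  by rewrite ge_max normr_ge0 andbT (le_trans _ (ler_norm _))// gerBl.
have Iq n : L1 m (q n).
  apply: (L1_le (mq n) (L1_abs Iw)) => z; rewrite /q ger0_norm; last by rewrite le_max lexx orbT.
  by rewrite ge_max normr_ge0 andbT (le_trans _ (ler_norm _))// gerBl.
have Ip n : L1 m (p n).
  by apply: (L1_le (mp n) (L1_abs Iw)) => z; rewrite /p ger0_norm ?ge_min ?lexx ?orbT// le_min f0 normr_ge0.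
rewrite intR0 in cp cq.
have c2 : \int[m]_z p n z + \int[m]_z q n z @[n --> \oo] --> (0 : R).
  by rewrite -[X in _ --> X](addr0 (0 : R)); exact: cvgD.
apply: (@squeeze_cvgr _ _ _ _ (fun=> 0) (fun n => \int[m]_z p n z + \int[m]_z q n z)) => //; last exact: cvg_cst.
apply: nearW => n; rewrite intR_ge0//=.
apply: (@le_trans _ _ (\int[m]_z (p n z + ((w_ n z - w z) + q n z)))).
  apply: intR_ae_le => //; first by do 2?apply: L1D => //; exact: L1B.
  have := fw n; apply: filterS2 wge0 => z wz fwz.
  rewrite /p /q (ger0_norm wz).
  case: (leP (f_ n z) (w z)) => h1; case: (leP (w z - w_ n z) 0) => h2; lra.
rewrite intRD//; last by apply: L1D => //; exact: L1B.
rewrite intRD//; last exact: L1B.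
rewrite intRB// addrA lerD2r gerDl subr_le0; exact: wi.
Qed.

Lemma steklov_le h k : 0 < h -> L1 m k -> {ae m, forall z, `|steklov h k z| <= steklov h (fun z => `|k z|) z}.
Proof.
move=> h0 Ik; have := ae_fst (ae_L1_1 Ik); apply: filterS => -[x r] /= Ix.
rewrite /steklov /= normrM gtr0_norm ?invr_gt0// ler_wpM2l ?invr_ge0 ?(ltW h0)//.
apply: intR_abs_le; [exact: L1_mul_oc|exact: L1_mul_oc (L1_abs Ix)|move=> q].
by rewrite normrM indicE [X in _ * X <= _]ger0_norm.
Qed.

Lemma steklov_sq_le h g : 0 < h -> L1 m g -> L1 m (fun z => g z ^+ 2) ->
  {ae m, forall z, (steklov h g z) ^+ 2 <= steklov h (fun z => g z ^+ 2) z}.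
Proof.
move=> h0 Ig Ig2; have := ae_fst (ae_L1_1 Ig); have := ae_fst (ae_L1_1 Ig2).
apply: filterS2 => -[x r] /= Ix2 Ix.
have rh : r - h < r by rewrite gtrBl.
have := cauchy_schwarz_oc rh Ix Ix2; rewrite subKr => H.
rewrite /steklov /= exprMn expr2 -mulrA ler_pM2l ?invr_gt0// -ler_pdivlMl ?invr_gt0// invrK.
exact: H.
Qed.

Lemma L1_steklov h k : 0 < h -> L1 m k -> L1 m (steklov h k).
Proof.
move=> h0 Ik; have [I1 _] := steklov_ge0E h0 (fun z => normr_ge0 (k z)) (L1_abs Ik).
by apply: (L1_ae_le _ I1); [apply: meas_steklov; exact: L1_meas Ik|exact: steklov_le].
Qed.

(** The averages of |k| dominate those of k, converge almost everywhere and have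
    the integral of |k|. *)
Lemma steklov_cvg_L1 k : L1 m k -> \int[m]_z `|steklov (hh n) k z - k z| @[n --> \oo] --> (0 : R).
Proof.
move=> Ik; have hh0 n : 0 < hh n by rewrite invr_gt0.
have Ia := L1_abs Ik; have a0 z := normr_ge0 (k z).
have Is n := (steklov_ge0E (hh0 n) a0 Ia).1.
apply: (@scheffe _ (fun n z => steklov (hh n) (fun z => `|k z|) z + `|k z|) (fun z => `|k z| + `|k z|)).
- by move=> n z.
- by move=> n; apply/L1_abs/L1B => //; exact: L1_steklov.
- move=> n z; rewrite addr_ge0// /steklov mulr_ge0 ?invr_ge0 ?(ltW (hh0 n))//.
  by apply: intR_ge0 => q; rewrite mulr_ge0// indicE ler0n.
- by move=> n; exact: L1D.
- exact: L1D.
- move=> n; have := steklov_le (hh0 n) Ik; apply: filterS => z h.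
  by apply: le_trans (ler_normB _ _) _; rewrite lerD2r.
- apply: filterS (steklov_ae Ik) => z c.
  by rewrite -(normr0 R) -(subrr (k z)); apply: cvg_norm; apply: cvgB => //; exact: cvg_cst.
- by apply: filterS (steklov_ae Ia) => z c; apply: cvgD => //; exact: cvg_cst.
- by move=> n; rewrite !intRD// (steklov_ge0E (hh0 n) a0 Ia).2.
Qed.

Lemma L1_steklov_sq h g : 0 < h -> L1 m g -> L1 m (fun z => g z ^+ 2) ->
  L1 m (fun z => (steklov h g z) ^+ 2).
Proof.
move=> h0 Ig Ig2; have [I1 _] := steklov_ge0E h0 (fun z => sqr_ge0 (g z)) Ig2.
apply: (L1_ae_le _ I1).
  by apply: measurable_funX; apply: meas_steklov; exact: L1_meas Ig.
by apply: filterS (steklov_sq_le h0 Ig Ig2) => z; rewrite ger0_norm ?sqr_ge0.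
Qed.

(** The same with g^2 in place of |k|, by Jensen's inequality (steklov_sq_le). *)
Lemma steklov_cvg_L2 g : L1 m g -> L1 m (fun z => g z ^+ 2) ->
  \int[m]_z (steklov (hh n) g z - g z) ^+ 2 @[n --> \oo] --> (0 : R).
Proof.
move=> Ig Ig2; have hh0 n : 0 < hh n by rewrite invr_gt0.
have a0 z := sqr_ge0 (g z).
have Is n := (steklov_ge0E (hh0 n) a0 Ig2).1.
apply: (@scheffe _ (fun n z => 2 * (steklov (hh n) (fun z => g z ^+ 2) z + g z ^+ 2))
   (fun z => 2 * (g z ^+ 2 + g z ^+ 2))).
- by move=> n z; exact: sqr_ge0.
- move=> n; apply: L1_sqB => //; [apply: meas_steklov; exact: L1_meas Ig|exact: L1_meas Ig|exact: L1_steklov_sq].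
- move=> n z; rewrite mulr_ge0// addr_ge0// /steklov mulr_ge0 ?invr_ge0 ?(ltW (hh0 n))//.
  by apply: intR_ge0 => q; rewrite mulr_ge0 ?sqr_ge0// indicE ler0n.
- by move=> n; exact/L1Z/L1D.
- exact/L1Z/L1D.
- move=> n; have := steklov_sq_le (hh0 n) Ig Ig2; apply: filterS => z h.
  apply: (@le_trans _ _ (2 * (steklov (hh n) g z ^+ 2 + g z ^+ 2))); last by rewrite ler_pM2l// lerD2r.
  by rewrite -subr_ge0 (_ : _ - _ = (steklov (hh n) g z + g z) ^+ 2) ?sqr_ge0//; ring.
- apply: filterS (steklov_ae Ig) => z c.
  have c0 : (fun n => steklov (hh n) g z - g z) @ \oo --> (0 : R).
    by rewrite -(subrr (g z)); apply: cvgB => //; exact: cvg_cst.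
  by rewrite -[X in _ --> X](mulr0 (0 : R)); exact: (cvgM c0 c0).
- by apply: filterS (steklov_ae Ig2) => z c; apply: cvgM; [exact: cvg_cst|apply: cvgD => //; exact: cvg_cst].
- by move=> n; rewrite !intRZ ?intRD//; [rewrite (steklov_ge0E (hh0 n) a0 Ig2).2|exact: L1D|exact: L1D].
Qed.

End steklov.

(** * Limits in L1 and L2 *)

Section L1_more.
Context d (T : measurableType d) (R : realType) (mu : {measure set T -> \bar R}).
Implicit Types f g : T -> R.

(** Convergence to 0 in L2 implies weak convergence, by Young's inequality with a
    weight. *)
Lemma cvg_int_mul_L2 (D : nat -> T -> R) (W : T -> R) :
  (forall i, measurable_fun setT (D i)) -> (forall i, L1 mu (fun x => D i x ^+ 2)) ->
  measurable_fun setT W -> L1 mu (fun x => W x ^+ 2) ->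
  \int[mu]_x (D i x) ^+ 2 @[i --> \oo] --> (0 : R) ->
  \int[mu]_x (D i x * W x) @[i --> \oo] --> (0 : R).
Proof.
move=> mD ID mW IW D0; apply/cvgr0Pnorm_le => e e0.
pose Q := \int[mu]_x (W x ^+ 2).
have Q0 : 0 <= Q by apply: intR_ge0 => x; exact: sqr_ge0.
pose l := e / (Q + 1).
have l0 : 0 < l by rewrite divr_gt0// ltr_wpDl.
have le0 : 0 < l * e by rewrite mulr_gt0.
move/cvgr0Pnorm_le : D0 => /(_ _ le0) D0.
near=> i.
have IDW : L1 mu (fun x => D i x * W x) by exact: L1M_sq.
have I2 : L1 mu (fun x => (2^-1 * l^-1) * D i x ^+ 2 + (2^-1 * l) * W x ^+ 2).
  by apply: L1D; exact: L1Z.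
apply: (le_trans (intR_abs_le IDW I2 _)) => [x|].
  rewrite normrM -(real_normK (num_real (D i x))) -(real_normK (num_real (W x))).
  rewrite -subr_ge0.
  have -> : 2^-1 / l * `|D i x| ^+ 2 + 2^-1 * l * `|W x| ^+ 2 - `|D i x| * `|W x|
     = (2^-1 * l^-1) * (`|D i x| - l * `|W x|) ^+ 2 by field; rewrite gt_eqF.
  by rewrite mulr_ge0 ?sqr_ge0// mulr_ge0// invr_ge0 ltW.
rewrite intRD; [|exact: L1Z|exact: L1Z].
rewrite !intRZ// -/Q.
have h1 : \int[mu]_x (D i x) ^+ 2 <= l * e.
  by apply: le_trans (ler_norm _) _; near: i.
have h2 : 2^-1 / l * (\int[mu]_x (D i x) ^+ 2) <= 2^-1 * e.
  apply: (@le_trans _ _ (2^-1 / l * (l * e))); first by rewrite ler_wpM2l// mulr_ge0// invr_ge0 ltW.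
  by rewrite -mulrA mulKf// gt_eqF.
have h3 : 2^-1 * l * Q <= 2^-1 * e.
  rewrite -mulrA ler_pM2l// /l -mulrA ger_pMr// mulrC ler_pdivrMr ?ltr_wpDl//.
  by rewrite mul1r lerDl.
lra.
Unshelve. all: by end_near. Qed.

(** Absolute continuity of the integral in a form that avoids sets: the part of
    |f| above the height M has small mass. *)
Lemma L1_small_sets f : L1 mu f -> forall e, 0 < e ->
  exists2 M : R, 0 <= M & forall h : T -> R, measurable_fun setT h ->
    (forall x, 0 <= h x <= 1) -> L1 mu h ->
    \int[mu]_x (`|f x| * h x) <= M * (\int[mu]_x h x) + e.
Proof.
move=> If e e0; have mf := L1_meas If.
pose q (i : nat) x := Num.max (`|f x| - i%:R) 0.
have mq i : measurable_fun setT (q i).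
  apply: measurable_maxr => //; apply: measurable_funB => //; exact: measurableT_comp.
have qle i x : `|q i x| <= `|f x|.
  rewrite /q ger0_norm; last by rewrite le_max lexx orbT.
  by rewrite ge_max normr_ge0 andbT gerBl ler0n.
have [_] : L1 mu (fun=> 0) /\ (\int[mu]_x q i x @[i --> \oo] --> \int[mu]_x (0 : R)).
  apply: (intR_dominated_cvg mq _ (L1_abs If)) => //; last by apply: aeW => x i; exact: qle.
  apply: aeW => x; apply: cvg_near_cst; near=> i.
  rewrite /q; apply/max_idPr; rewrite subr_le0; near: i; exact: nbhs_infty_ger.
rewrite intR0 => /cvgr0Pnorm_le /(_ _ e0) [i _ /(_ i (leqnn i)) Hi].
exists i%:R; first exact: ler0n.
move=> h mh h01 Ih.
have Iq : L1 mu (q i) := L1_le (mq i) (L1_abs If) (qle i).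
have Ifh : L1 mu (fun x => `|f x| * h x).
  refine (@L1M_bd _ _ R mu 1 (fun x => `|f x|) h mh _ (L1_abs If)) => x.
  by have /andP[h0 h1] := h01 x; rewrite ger0_norm.
apply: (@le_trans _ _ (\int[mu]_x (i%:R * h x + q i x))).
  apply: intR_le => //; first by apply: L1D => //; exact: L1Z.
  move=> x; have /andP[h0 h1] := h01 x; rewrite /q.
  have := normr_ge0 (f x); set a := `|f x| => a0.
  have [ai|ia] := leP (a - i%:R) 0; first by rewrite addr0 ler_wpM2r// -subr_le0.
  rewrite -lerBlDl -mulrBl; apply: ler_piMr => //; exact: ltW.
rewrite intRD//; last exact: L1Z.
rewrite intRZ// lerD2l; exact: le_trans (ler_norm _) Hi.
Unshelve. all: by end_near. Qed.

(** The series of the increments is dominated by an integrable function. *)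
Lemma L1_complete_fast (f_ : nat -> T -> R) (C : R) : (forall i, L1 mu (f_ i)) ->
  (forall i, \int[mu]_x `|f_ i.+1 x - f_ i x| <= C * 2^-1 ^+ i) ->
  exists2 f, L1 mu f & \int[mu]_x `|f_ i x - f x| @[i --> \oo] --> (0 : R).
Proof.
move=> If fC; have mf i := L1_meas (If i).
pose D i x := `|f_ i.+1 x - f_ i x|.
have ID i : L1 mu (D i) by apply/L1_abs/L1B.
have D0 i x : 0 <= D i x by exact: normr_ge0.
have [S IS DS] := ae_series_dom ID D0 fC.
have cf := ae_series ID D0 fC.
pose f x := fine (limn_esup (fun i => (f_ i x)%:E)).
have mf' : measurable_fun setT f.
  apply: (measurableT_comp (fine_measurable measurableT)).
  by apply: measurable_fun_limn_esup => i; exact/measurable_EFinP.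
have ff : {ae mu, forall x, f_ ^~ x @ \oo --> f x}.
  apply: filterS cf => x cx.
  have c2 : cvgn (f_ ^~ x).
    have c3 : cvgn (series (fun i => f_ i.+1 x - f_ i x)) by exact: normed_cvg.
    have E : f_ ^~ x = (fun i => f_ 0%N x + series (fun i => f_ i.+1 x - f_ i x) i).
      apply/funext => i; rewrite /series/= telescope_sumr// addrC subrK//.
    rewrite E; apply: is_cvgD => //; exact: is_cvg_cst.
  have ce : (fun i => (f_ i x)%:E) @ \oo --> (limn (f_ ^~ x))%:E by apply: cvg_EFin => //; exact: nearW.
  rewrite /f; have -> : limn_esup (fun i => (f_ i x)%:E) = (limn (f_ ^~ x))%:E.
    by rewrite is_cvg_limn_esupE; [exact/cvg_lim|apply/cvg_ex; eexists; exact: ce].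
  exact: c2.
have Ifin : L1 mu f.
  apply: (L1_ae_le mf' (L1D (L1_abs (If 0%N)) (L1_abs IS))).
  apply: filterS2 DS ff => x Sx fx.
  apply: (@closed_cvg _ _ _ _ _ [set y : R | `|y| <= `|f_ 0%N x| + `|S x|] _ _ _ fx).
    have -> : [set y : R | `|y| <= `|f_ 0%N x| + `|S x|] = (@Num.norm R R) @^-1` [set y | y <= `|f_ 0%N x| + `|S x|] by [].
    by apply: closed_comp => [y _|]; [exact: norm_continuous|exact: closed_le].
  apply: nearW => i /=.
  have -> : f_ i x = f_ 0%N x + \sum_(0 <= j < i) (f_ j.+1 x - f_ j x).
    by rewrite telescope_sumr// addrC subrK.
  apply: le_trans (ler_normD _ _) _; rewrite lerD2l.
  apply: le_trans (ler_norm_sum _ _ _) _; exact: le_trans (Sx i) (ler_norm _).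
exists f => //.
have [_] : L1 mu (fun=> 0) /\ (\int[mu]_x `|f_ i x - f x| @[i --> \oo] --> \int[mu]_x (0 : R)); last by rewrite intR0.
apply: (intR_dominated_cvg _ _ (L1Z 2 (L1_abs IS))) => //.
- by move=> i; apply: measurableT_comp => //; exact: measurable_funB.
- apply: filterS ff => x c; rewrite -(normr0 R) -(subrr (f x)); apply: cvg_norm.
  by apply: cvgB => //; exact: cvg_cst.
- apply: filterS2 DS ff => x Sx fx i; rewrite normr_id distrC.
  apply: (@closed_cvg _ _ _ _ _ [set y : R | `|y - f_ i x| <= 2 * `|S x|] _ _ _ fx).
    have -> : [set y : R | `|y - f_ i x| <= 2 * `|S x|] = (fun y => `|y - f_ i x|) @^-1` [set y | y <= 2 * `|S x|] by [].
    apply: closed_comp => [y _|]; last exact: closed_le.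
    by apply: cvg_norm; apply: cvgB; [exact: cvg_id|exact: cvg_cst].
  have B j : `|f_ j x - f_ 0%N x| <= `|S x|.
    have -> : f_ j x - f_ 0%N x = \sum_(0 <= l < j) (f_ l.+1 x - f_ l x) by rewrite telescope_sumr.
    apply: le_trans (ler_norm_sum _ _ _) _; exact: le_trans (Sx j) (ler_norm _).
  apply: nearW => j /=; rewrite -(subrKA (f_ 0%N x)).
  apply: le_trans (ler_normD _ _) _; rewrite mulr_natl mulr2n; apply: lerD => //.
  by rewrite distrC.
Qed.

Lemma L1_complete (f_ : nat -> T -> R) : (forall i, L1 mu (f_ i)) ->
  (forall e : R, 0 < e -> exists N, forall i j, (N <= i)%N -> (N <= j)%N ->
     \int[mu]_x `|f_ i x - f_ j x| <= e) ->
  exists2 f, L1 mu f & forall e : R, 0 < e -> exists N, forall i, (N <= i)%N ->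
    \int[mu]_x `|f_ i x - f x| <= e.
Proof.
move=> If cf.
have h2 (i : nat) : 0 < (2^-1 : R) ^+ i by rewrite exprn_gt0.
pose N i := sval (cid (cf _ (h2 i))).
have HN i : forall p q, (N i <= p)%N -> (N i <= q)%N -> \int[mu]_x `|f_ p x - f_ q x| <= 2^-1 ^+ i.
  by rewrite /N; case: cid.
pose M i := (i + \sum_(j < i.+1) N j)%N.
have MN i : (N i <= M i)%N by rewrite /M big_ord_recr/= addnA leq_addl.
have MS i : (M i <= M i.+1)%N by rewrite /M [X in (_ <= _ + X)%N]big_ord_recr/= leq_add// leq_addr.
have [|i|f Ifi cfi] := @L1_complete_fast (fun i => f_ (M i)) 1.
- by move=> i.
- by rewrite mul1r; apply: HN => //; exact: leq_trans (MS i).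
exists f => // e e0; have e2 : 0 < e / 2 by rewrite divr_gt0.
have [K HK] := cf _ e2.
move/cvgr0Pnorm_le : cfi => /(_ _ e2) [L _ HL].
exists K => i Ki.
have [p [pL Kp]] : exists p, (L <= p)%N /\ (K <= M p)%N.
  exists (L + K)%N; split; first exact: leq_addr.
  by rewrite /M -addnA addnCA leq_addr.
apply: (@le_trans _ _ (\int[mu]_x (`|f_ i x - f_ (M p) x| + `|f_ (M p) x - f x|))).
  apply: intR_le; [exact/L1_abs/L1B|by apply: L1D; exact/L1_abs/L1B|move=> x].
  by rewrite -(subrKA (f_ (M p) x)); exact: ler_normD.
rewrite intRD; [|exact/L1_abs/L1B|exact/L1_abs/L1B].
have h1 := HK _ _ Ki Kp; have h3 := le_trans (ler_norm _) (HL _ pL).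
lra.
Qed.

End L1_more.

(** * Chains of good times *)

Section chain.
Context {R : realType}.
Implicit Types (E F al f : R -> R) (s t r : R).

(** The bound on an increment involves the values of F at both end points, which
    are not controlled at a given time. It improves to a bound by the integral f
    of F: cut [s, t] into cells of length d and move from s to t through one time
    r_j in each cell with d * F r_j at most the mass of F on the cell. All end
    points in the interior are then paid for by f, and the contribution
    d * (F s + F t) of s and t vanishes with d. *)
Lemma chain_bound (G : set R) E F al f s t : G s -> G t -> s < t ->
  (forall r, G r -> 0 <= F r) ->
  (forall r1 r2, G r1 -> G r2 -> s <= r1 -> r1 < r2 -> r2 <= t ->
     `|E r2 - E r1| <= al r2 - al r1 + (r2 - r1) * (F r2 + F r1)) ->
  (forall x y, s <= x -> x < y -> y <= t ->
     exists r, [/\ G r, x < r < y & (y - x) * F r <= f y - f x]) ->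
  `|E t - E s| <= al t - al s + 4 * (f t - f s).
Proof.
move=> Gs Gt st F0 step pick.
have ts : 0 < t - s by rewrite subr_gt0.
have key (m : nat) : let d := (t - s) / m.+1%:R in
    `|E t - E s| <= al t - al s + 4 * (f t - f s) + d * (F s + F t).
  move=> d; have d0 : 0 < d by rewrite divr_gt0.
  have dm : m.+1%:R * d = t - s by rewrite /d mulrC divfK// gt_eqF.
  pose p (j : nat) := s + j%:R * d.
  have pS j : p j.+1 = p j + d by rewrite /p -natr1 mulrDl mul1r addrA.
  have p0 : p 0%N = s by rewrite /p mul0r addr0.
  have pm : p m.+1 = t by rewrite /p dm addrC subrK.
  have ple i j : (i <= j)%N -> p i <= p j.
    by move=> ij; rewrite lerD2l ler_wpM2r ?(ltW d0)// ler_nat.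
  (* the slack 2 * (d * F r) pays for the next step, whose length is at most 2 * d *)
  have cell j : (j <= m)%N -> exists r, [/\ G r, p j < r < p j.+1,
      d * F r <= f (p j.+1) - f (p j) &
      `|E r - E s| + 2 * (d * F r) <= al r - al s + 4 * (f (p j.+1) - f s) + d * F s].
    have pk i : (i <= m)%N -> exists r, [/\ G r, p i < r < p i.+1 & d * F r <= f (p i.+1) - f (p i)].
      move=> im; have := pick (p i) (p i.+1); rewrite -{1}p0 ple//.
      rewrite -{1}pm (ple i.+1 m.+1)// pS ltrDl d0 => /(_ isT isT isT).
      by rewrite (_ : p i + d - p i = d)//; ring.
    elim: j => [_|j ih jm].
      have [r [Gr /andP[r1 r2] Fr]] := pk 0%N isT.
      exists r; split=> //; first by rewrite r1.
      rewrite p0 in r1 Fr *.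
      have rt : r <= t by rewrite -pm (le_trans (ltW r2))// ple.
      have := step _ _ Gs Gr (lexx _) r1 rt.
      have rd : r - s <= d by rewrite lerBlDl -p0 -pS ltW.
      have F1 := F0 _ Gs; have F2 := F0 _ Gr.
      have : (r - s) * (F r + F s) <= d * (F r + F s) by rewrite ler_wpM2r// addr_ge0.
      rewrite mulrDr => h1 h2; nra.
    have [r [Gr /andP[r1 r2] Fr Hr]] := ih (ltnW jm).
    have [r' [Gr' /andP[r1' r2'] Fr']] := pk _ jm.
    exists r'; split=> //; first by rewrite r1'.
    have rr' : r < r' by exact: lt_trans r2 r1'.
    have r't : r' <= t by rewrite -pm (le_trans (ltW r2'))// ple.
    have sr : s <= r by rewrite -p0 (le_trans (ple 0%N j _))// ltW.
    have st1 := step _ _ Gr Gr' sr rr' r't.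
    have rd : r' - r <= 2 * d by move: r1 r2'; rewrite !pS; lra.
    have F1 := F0 _ Gr; have F2 := F0 _ Gr'.
    have h1 : (r' - r) * (F r' + F r) <= 2 * d * (F r' + F r) by rewrite ler_wpM2r// addr_ge0.
    have tri : `|E r' - E s| <= `|E r' - E r| + `|E r - E s|.
      by rewrite -(subrKA (E r)); exact: ler_normD.
    lra.
  have [r [Gr /andP[r1 r2] Fr Hr]] := cell m (leqnn m).
  rewrite pm in r2 Fr Hr.
  have sr : s <= r by rewrite -p0 (le_trans (ple 0%N m _))// ltW.
  have st1 := step _ _ Gr Gt sr r2 (lexx _).
  have rd : t - r <= d by move: r1; rewrite -pm pS; lra.
  have F1 := F0 _ Gr; have F2 := F0 _ Gt; have F3 := F0 _ Gs.
  have h1 : (t - r) * (F t + F r) <= d * (F t + F r) by rewrite ler_wpM2r// addr_ge0.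
  have tri : `|E t - E s| <= `|E t - E r| + `|E r - E s|.
    by rewrite -(subrKA (E r)); exact: ler_normD.
  have := mulr_ge0 (ltW d0) F1; lra.
(* d * (F s + F t) is made small by the number of cells *)
apply/ler_addgt0Pr => e e0.
have FF : 0 <= F s + F t by rewrite addr_ge0// F0.
have q0 : 0 < e / ((t - s) * (F s + F t) + 1) by rewrite divr_gt0// ltr_wpDl// mulr_ge0// ltW.
have [m hm] := ltr_add_invr q0; rewrite add0r in hm.
apply: le_trans (key m) _; rewrite lerD2l.
rewrite mulrAC; set A := (t - s) * _.
have A0 : 0 <= A by rewrite mulr_ge0// ltW.
have : m.+1%:R^-1 * (A + 1) < e by rewrite -ltr_pdivlMr// ltr_wpDl.
have : 0 < (m.+1%:R^-1 : R) by rewrite invr_gt0.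
set x := _^-1; move=> x0; rewrite mulrDr mulr1 => h2.
by rewrite mulrC; lra.
Qed.

Local Notation lam := (@lebesgue_measure R).

Definition win_int f s t := \int[lam]_q (f q * \1_(`]s, t]) q).

Lemma win_int_add f s r t : L1 lam f -> s <= r -> r <= t -> win_int f s t = win_int f s r + win_int f r t.
Proof.
move=> If sr rt; rewrite /win_int -intRD; [|exact: L1_mul_oc|exact: L1_mul_oc].
apply: eq_Rintegral => q _; rewrite -mulrDr; congr (_ * _).
rewrite !indicE !mem_setE !in_itv/=.
have [qr|rq] := leP q r; last by rewrite andbF add0r /= (le_lt_trans sr rq).
by rewrite addr0 andbT (le_trans qr rt) andbT.
Qed.

Lemma win_int_ge0 f s t : (forall q, 0 <= f q) -> 0 <= win_int f s t.
Proof. by move=> f0; apply: intR_ge0 => q; rewrite mulr_ge0// indicE ler0n. Qed.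

Lemma win_intD f h s t : L1 lam f -> L1 lam h -> win_int (fun q => f q + h q) s t = win_int f s t + win_int h s t.
Proof.
move=> If Ih; rewrite /win_int -intRD; [|exact: L1_mul_oc|exact: L1_mul_oc].
by apply: eq_Rintegral => q _; rewrite mulrDl.
Qed.

Lemma win_intZ c f s t : L1 lam f -> win_int (fun q => c * f q) s t = c * win_int f s t.
Proof.
move=> If; rewrite /win_int -intRZ; last exact: L1_mul_oc.
by apply: eq_Rintegral => q _; rewrite mulrA.
Qed.

Lemma win_int_mono f s s' t t' : L1 lam f -> (forall q, 0 <= f q) ->
  s' <= s -> s <= t -> t <= t' -> win_int f s t <= win_int f s' t'.
Proof.
move=> If f0 h1 h2 h3.
rewrite (@win_int_add f s' s t')// ?(le_trans h2)// (@win_int_add f s t t')//.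
by have := win_int_ge0 s' s f0; have := win_int_ge0 t t' f0; lra.
Qed.

Lemma win_int_small f : L1 lam f -> (forall q, 0 <= f q) -> forall e, 0 < e ->
  exists2 D, 0 < D & forall s t, s <= t -> t - s < D -> win_int f s t <= e.
Proof.
move=> If f0 e e0; have e2 : 0 < e / 2 by rewrite divr_gt0.
have [M M0 HM] := L1_small_sets If e2.
exists (e / 2 / (M + 1)); first by rewrite divr_gt0// ltr_wpDl.
move=> s t st tsD.
have := HM (\1_(`]s, t])) _ _ _; rewrite intR_indic_oc// => H.
have {}H : \int[lam]_x (`|f x| * \1_(`]s, t]) x) <= M * (t - s) + e / 2.
  apply: H; [exact: measurable_indic| |exact: L1_indic_oc].
  by move=> x; rewrite indicE ler0n lern1 leq_b1.
have E : win_int f s t = \int[lam]_x (`|f x| * \1_(`]s, t]) x).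
  by apply: eq_Rintegral => q _; rewrite ger0_norm.
rewrite E; apply: le_trans H _.
have ts0 : 0 <= t - s by rewrite subr_ge0.
have : (t - s) * (M + 1) < e / 2 by rewrite -ltr_pdivlMr// ltr_wpDl.
rewrite mulrDr mulr1 mulrC; lra.
Qed.

(** Otherwise F would exceed its mean on a set of full measure. *)
Lemma exists_below_average (G : set R) F s t : L1 lam F -> s < t ->
  {ae lam, forall r, s < r < t -> G r} ->
  exists r, [/\ G r, s < r < t & (t - s) * F r <= win_int F s t].
Proof.
move=> IF st fG; apply: contrapT => nex.
have ts : 0 < t - s by rewrite subr_gt0.
pose c := win_int F s t / (t - s).
have gt_c r : G r -> s < r < t -> c < F r.
  move=> Gr rst; rewrite ltNge; apply/negP => Fc; apply: nex; exists r; split => //.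
  by rewrite mulrC -ler_pdivlMr.
pose D q := (F q - c) * \1_(`]s, t]) q.
have ID : L1 lam D.
  have : L1 lam (fun q => F q * \1_(`]s, t]) q - c * \1_(`]s, t]) q).
    by apply: L1B; [exact: L1_mul_oc|exact/L1Z/L1_indic_oc].
  by congr (L1 lam _); apply/funext => q; rewrite /D mulrBl.
have RD0 : \int[lam]_q D q = 0.
  transitivity (\int[lam]_q (F q * \1_(`]s, t]) q - c * \1_(`]s, t]) q)).
    by apply: eq_Rintegral => q _; rewrite /D mulrBl.
  rewrite intRB; [|exact: L1_mul_oc|exact/L1Z/L1_indic_oc].
  rewrite intRZ; last exact: L1_indic_oc.
  by rewrite intR_indic_oc ?(ltW st)// -/(win_int F s t) /c divfK ?subrr// gt_eqF.
have nt := ae_neq t.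
have Dge : {ae lam, forall q, 0 <= D q}.
  apply: (@filterS2 _ _ (ae_filter_ringOfSetsType lam) _ _ _ _ fG nt) => q Gq qt.
  rewrite /D indicE; case: (boolP (q \in _)); rewrite ?mulr0// mulr1 inE/= in_itv/= => /andP[q1 q2].
  have q3 : s < q < t by rewrite q1 lt_neqAle qt.
  by rewrite subr_ge0; apply: ltW; apply: gt_c => //; exact: Gq.
have mD := L1_meas ID.
have Dz : {ae lam, forall q, D q = 0}.
  have : (\int[lam]_q `|(EFin \o D) q| = 0)%E.
    have -> : (\int[lam]_q `|(EFin \o D) q| = \int[lam]_q (`|D q|)%:E)%E by [].
    rewrite -EFin_intR; last exact: L1_abs.
    rewrite -[RHS]/(0%:E) -RD0; congr (_%:E); apply: (@intR_ae_eq _ _ _ lam) => //; first exact: measurableT_comp.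
    by apply: (@filterS _ _ (ae_filter_ringOfSetsType lam) _ _ _ Dge) => q; exact: ger0_norm.
  have mDE : measurable_fun setT (EFin \o D) by exact/measurable_EFinP.
  move=> /(ae_eq_integral_abs lam measurableT mDE).
  by apply: (@filterS _ _ (ae_filter_ringOfSetsType lam)) => q /(_ I) /= [].
have : {ae lam, forall q, ~ (s < q < t)}.
  apply: (@filterS2 _ _ (ae_filter_ringOfSetsType lam) _ _ _ _ fG Dz) => q Gq Dq0 q3.
  have := gt_c q (Gq q3) q3; rewrite -subr_gt0; move: Dq0; rewrite /D indicE mem_set ?mulr1.
    by move=> ->; rewrite ltxx.
  by rewrite /= in_itv/=; case/andP : q3 => -> /ltW ->.
move=> [A [mA A0 sA]].
have : (lam `]s, t[ <= lam A)%E.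
  rewrite le_measure ?inE// => q /=; rewrite in_itv/= => q3; apply: sA => /=; exact.
have A0' : lam A = 0%E by exact: A0.
rewrite A0' lebesgue_measure_itv/= lte_fin st -EFinB lee_fin leNgt ts //.
Qed.

End chain.

(** * Continuity in L1 from the tested equation *)

Lemma cross_sub (R : zmodType) (a b c d e : R) :
  a = b + c -> a = d + e -> e - b = c - d.
Proof. by move=> -> bc; apply/eqP; rewrite subr_eq addrAC (addrC c) bc addrC addKr. Qed.

Lemma arith_sharp (R : realFieldType) (h it is_ et es eta bh B L : R) : 0 < h ->
  B - eta / 3 <= bh -> - L <= B ->
  `|it - h * et| <= h * (eta / 3) -> `|is_ - h * es| <= h * (eta / 3) ->
  it - is_ <= - (h * bh) -> et - es <= L + eta.
Proof.
move=> h0 h1 h2; rewrite !ler_norml => /andP[h3 _] /andP[_ h4] h5.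
have : h * (et - es) <= h * (L + eta).
  have : h * (B - eta / 3) <= h * bh by rewrite ler_wpM2l// ltW.
  have : h * - L <= h * B by rewrite ler_wpM2l// ltW.
  lra.
by rewrite ler_pM2l.
Qed.

Lemma cvg_sum_fin (R : realType) (I : Type) (r : seq I) (F : I -> nat -> R) (l : I -> R) :
  (forall i, F i j @[j --> \oo] --> l i) ->
  \sum_(i <- r) F i j @[j --> \oo] --> \sum_(i <- r) l i.
Proof.
move=> Fl; elim: r => [|i r ih].
  rewrite big_nil; under eq_fun do rewrite big_nil; exact: cvg_cst.
by rewrite big_cons; under eq_fun do rewrite big_cons; apply: cvgD.
Qed.

Lemma arith_chain (R : realFieldType) (a b c d e f : R) : a <= b + c -> c <= e / 2 ->
  d <= f -> a + d + e / 2 <= b + f + e.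
Proof. lra. Qed.

Lemma intR_eq0_ae d (T : measurableType d) (R : realType) (mu : {measure set T -> \bar R})
  (f : T -> R) : L1 mu f -> (forall x, 0 <= f x) -> \int[mu]_x f x = 0 ->
  {ae mu, forall x, f x = 0}.
Proof.
move=> If f0 Rf.
have : (\int[mu]_x `|(EFin \o f) x| = 0)%E.
  have -> : (\int[mu]_x `|(EFin \o f) x| = \int[mu]_x (f x)%:E)%E.
    by apply: eq_integral => r _ /=; rewrite ger0_norm.
  by rewrite -EFin_intR// Rf.
have mE : measurable_fun setT (EFin \o f) by apply/measurable_EFinP; exact: L1_meas If.
move=> /(ae_eq_integral_abs mu measurableT mE).
by apply: filterS => x /(_ I) /= [].
Qed.

Section window.
Context d (X : measurableType d) (R : realType).
Context (mu : {sigma_finite_measure set X -> \bar R}).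
Local Notation lam := (@lebesgue_measure R).
Local Notation Y := (X * measurableTypeR R)%type.
Local Notation m := (mu \x lam)%E.

Lemma meas_window (s t : R) : measurable_fun setT (fun z : Y => \1_(`]s, t]) z.2 : R).
Proof. by apply: (measurableT_comp _ measurable_snd); exact: measurable_indic. Qed.

Lemma window_bd (s t q : R) : `|\1_(`]s, t]) q : R| <= 1.
Proof. by rewrite indicE ger0_norm ?ler0n// lern1 leq_b1. Qed.

Lemma L1_window (f : Y -> R) s t : L1 m f -> L1 m (fun z => f z * \1_(`]s, t]) z.2).
Proof. by move=> If; exact: (@L1M_bd _ _ R m 1 f _ (meas_window s t) (fun z => window_bd s t z.2) If). Qed.

Lemma intR_window2 (f : Y -> R) s t : L1 m f ->
  \int[m]_z (f z * \1_(`]s, t]) z.2) = win_int (fun q => \int[mu]_x f (x, q)) s t.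
Proof.
move=> If; rewrite -(intR_fubini2 (L1_window s t If)); apply: eq_Rintegral => q _.
rewrite indicE; case: (_ \in _) => /=; rewrite ?mulr1 ?mulr0.
  by apply: eq_Rintegral => x _; rewrite mulr1.
by rewrite -[RHS](intR0 mu); apply: eq_Rintegral => x _; rewrite mulr0.
Qed.

Lemma intR_window1 (f : Y -> R) s t : L1 m f ->
  \int[m]_z (f z * \1_(`]s, t]) z.2) = \int[mu]_x \int[lam]_q (f (x, q) * \1_(`]s, t]) q).
Proof. by move=> If; rewrite -(intR_fubini1 (L1_window s t If)). Qed.

Lemma steklov_mul_cvg (g V : Y -> R) (s t : R) : L1 m g -> L1 m (fun z => g z ^+ 2) ->
  measurable_fun setT V -> L1 m (fun z => V z ^+ 2) ->
  \int[m]_z (steklov j.+1%:R^-1 g z * V z * \1_(`]s, t]) z.2) @[j --> \oo] -->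
  \int[m]_z (g z * V z * \1_(`]s, t]) z.2).
Proof.
move=> Ig Ig2 mV IV; have mg := L1_meas Ig.
have h0 j : 0 < (j.+1%:R^-1 : R) by rewrite invr_gt0.
have mS j : measurable_fun setT (steklov j.+1%:R^-1 g) by exact: meas_steklov.
have c0 : \int[m]_z ((steklov j.+1%:R^-1 g z - g z) * (V z * \1_(`]s, t]) z.2)) @[j --> \oo] --> (0 : R).
  apply: cvg_int_mul_L2.
  - by move=> j; exact: measurable_funB.
  - by move=> j; apply: L1_sqB => //; exact: L1_steklov_sq.
  - by apply: measurable_funM => //; exact: meas_window.
  - have := @L1_sqM_bd _ _ R m 1 _ _ mV (meas_window s t) (fun z => window_bd s t z.2) IV.
    by congr (L1 m _); apply/funext => z; congr (_ ^+ 2); exact: mulrC.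
  - exact: steklov_cvg_L2.
apply/cvgrPdist_le => eta eta0.
have /cvgr0Pnorm_le /(_ _ eta0) := c0; apply: filterS => j; apply: le_trans.
have I1 : L1 m (fun z => steklov j.+1%:R^-1 g z * V z * \1_(`]s, t]) z.2).
  by apply/L1_window/L1M_sq => //; exact: L1_steklov_sq.
have I2 : L1 m (fun z => g z * V z * \1_(`]s, t]) z.2) by exact/L1_window/L1M_sq.
rewrite distrC -intRB// le_eqVlt; apply/orP; left; apply/eqP; congr (`|_|).
by apply: eq_Rintegral => z _; rewrite -!mulrBl mulrA.
Qed.

End window.

(** The setting keeps what the argument uses of a solution: H is the class of
    admissible tests with their gradients, G a set of good times of full measure at
    which the slices of u belong to H, and the equation is only tested with
    phi (v) for v in H. *)
Section core.
Context d (X : measurableType d) (R : realType).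
Context (mu : {sigma_finite_measure set X -> \bar R}) (n : nat).
Local Notation lam := (@lebesgue_measure R).
Local Notation Y := (X * measurableTypeR R)%type.
Local Notation m := (mu \x lam)%E.
Variables (Om : set X) (T nu : R).
Hypotheses (mOm : measurable Om) (fOm : (mu Om < +oo)%E) (nu0 : 0 <= nu).
Variables (u k : Y -> R) (g : 'I_n -> Y -> R).
Hypotheses (u_out : forall x t, ~ Om x -> u (x, t) = 0).
Hypotheses (Iu : L1 m u) (Ik : L1 m k) (Ig : forall i, L1 m (g i)).
Hypotheses (Ig2 : forall i, L1 m (fun z => g i z ^+ 2)).
Variable H : (X -> R) -> ('I_n -> X -> R) -> Prop.
Hypotheses (H_L1 : forall v p, H v p -> L1 mu v).
Hypotheses (H_meas : forall v p, H v p -> forall i, measurable_fun setT (p i)).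
Hypotheses (H_L2 : forall v p, H v p -> forall i, L1 mu (fun x => p i x ^+ 2)).
Hypotheses (H_sub : forall v p v' p', H v p -> H v' p' ->
  H (fun x => v x - v' x) (fun i x => p i x - p' i x)).
Variable G : set R.
Hypotheses (G_sub : forall t, G t -> 0 < t < T).
Hypotheses (G_full : {ae lam, forall t, 0 < t < T -> G t}).
Hypotheses (G_H : forall t, G t -> H (fun x => u (x, t)) (fun i x => g i (x, t))).

Hypothesis weak : forall (s t e : R) v p, G s -> G t -> s < t -> 0 < e -> H v p ->
  \int[mu]_x ((u (x, t) - u (x, s)) * phi e (v x)) =
  - (\int[mu]_x (time_int k s t x * phi e (v x)) +
     nu * \sum_i \int[mu]_x (time_int (g i) s t x * (dphi e (v x) * p i x))).

Let a q := \int[mu]_x `|k (x, q)|.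
Let F q := \sum_i \int[mu]_x (g i (x, q) ^+ 2).
Let S (p : 'I_n -> X -> R) := \sum_i \int[mu]_x (p i x ^+ 2).

Let mk : measurable_fun setT k := L1_meas Ik.
Let mg i : measurable_fun setT (g i) := L1_meas (Ig i).
Let mu_ : measurable_fun setT u := L1_meas Iu.

Let Ia : L1 lam a. Proof. exact: (L1_intR2 (L1_abs Ik)). Qed.
Let a0 q : 0 <= a q. Proof. exact: intR_ge0. Qed.
Let IF : L1 lam F. Proof. by apply: L1_sum => i; exact: (L1_intR2 (Ig2 i)). Qed.
Let F0 q : 0 <= F q.
Proof. by apply: sumr_ge0 => i _; apply: intR_ge0 => x; exact: sqr_ge0. Qed.
Lemma L1_time_k s t : L1 mu (time_int k s t).
Proof. exact: (L1_intR1 (L1_window s t Ik)). Qed.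

Let time_k_le s t : \int[mu]_x `|time_int k s t x| <= win_int a s t.
Proof.
rewrite -(intR_window2 _ _ (L1_abs Ik)) intR_window1; last exact: L1_abs.
apply: intR_ae_le; [exact/L1_abs/L1_time_k|exact: (L1_intR1 (L1_window s t (L1_abs Ik)))|].
apply: filterS (ae_L1_1 Ik) => x Ix.
apply: intR_abs_le; [exact: L1_mul_oc|exact: L1_mul_oc (L1_abs Ix)|move=> q].
by rewrite normrM indicE [X in _ * X <= _]ger0_norm.
Qed.

Let meas_time_g i s t : measurable_fun setT (time_int (g i) s t).
Proof. exact: L1_meas (L1_intR1 (L1_window s t (Ig i))). Qed.

Let time_g_sq_ae i s t : s < t -> {ae mu, forall x, time_int (g i) s t x ^+ 2 <=
  (t - s) * \int[lam]_q (g i (x, q) ^+ 2 * \1_(`]s, t]) q)}.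
Proof.
move=> st; apply: filterS2 (ae_L1_1 (Ig i)) (ae_L1_1 (Ig2 i)) => x I1 I2.
exact: cauchy_schwarz_oc.
Qed.

Lemma L2_time_g i s t : s < t -> L1 mu (fun x => time_int (g i) s t x ^+ 2).
Proof.
move=> st; apply: (L1_ae_le _ (L1Z (t - s) (L1_intR1 (L1_window s t (Ig2 i))))).
  exact: measurable_funX.
by apply: filterS (time_g_sq_ae i st) => x; rewrite ger0_norm ?sqr_ge0.
Qed.

Let time_g_le i s t : s < t -> \int[mu]_x (time_int (g i) s t x ^+ 2) <=
  (t - s) * win_int (fun q => \int[mu]_x (g i (x, q) ^+ 2)) s t.
Proof.
move=> st; rewrite -(intR_window2 _ _ (Ig2 i)) intR_window1//.
rewrite -intRZ; last exact: (L1_intR1 (L1_window s t (Ig2 i))).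
by apply: intR_ae_le; [exact: L2_time_g|exact: (L1Z _ (L1_intR1 (L1_window s t (Ig2 i))))|exact: time_g_sq_ae].
Qed.

Let meas_phi (e : R) (v : X -> R) : 0 < e -> measurable_fun setT v -> measurable_fun setT (fun x => phi e (v x)).
Proof.
move=> e0 mv; exact: (measurableT_comp (measurable_phi e0) mv).
Qed.

Let meas_dphi (e : R) (v : X -> R) : 0 < e -> measurable_fun setT v -> measurable_fun setT (fun x => dphi e (v x)).
Proof.
move=> e0 mv; exact: (measurableT_comp (measurable_dphi e0) mv).
Qed.

Let dphi_bd (e s : R) : 0 < e -> `|dphi e s| <= e^-1.
Proof. by move=> e0; rewrite ger0_norm ?dphi_le ?dphi_ge0. Qed.

(** The tested equation controls the increment of u against phi (v): the source
    enters with weight |phi| <= 1, the diffusion through dphi <= 1/e and Young's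
    inequality. *)
Let step_bound (s t e : R) v p : G s -> G t -> s < t -> 0 < e -> H v p ->
  `|\int[mu]_x ((u (x, t) - u (x, s)) * phi e (v x))| <=
  win_int a s t + nu / e / 2 * (win_int F s t + (t - s) * S p).
Proof.
move=> Gs Gt st e0 Hv; have ts : 0 < t - s by rewrite subr_gt0.
rewrite (weak Gs Gt st e0 Hv) normrN; apply: le_trans (ler_normD _ _) _; apply: lerD.
  apply: le_trans (time_k_le s t); apply: intR_abs_le.
  - refine (@L1M_bd _ _ R mu 1 _ (fun x => phi e (v x)) _ _ (L1_time_k s t)).
      by apply: meas_phi => //; exact: L1_meas (H_L1 Hv).
    by move=> x; exact: phi_le1.
  - exact/L1_abs/L1_time_k.
  - by move=> x; rewrite normrM ler_piMr// phi_le1.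
rewrite normrM (ger0_norm nu0) -!mulrA ler_wpM2l//.
apply: le_trans (ler_norm_sum _ _ _) _.
have IFE : win_int F s t = \sum_i win_int (fun q => \int[mu]_x (g i (x, q) ^+ 2)) s t.
  rewrite /win_int -intR_sum; last by move=> i; apply: L1_mul_oc; exact: (L1_intR2 (Ig2 i)).
  by apply: eq_Rintegral => q _; rewrite /F mulr_suml.
rewrite IFE /S mulr_sumr -big_split/= !mulr_sumr; apply: ler_sum => i _.
have mp := H_meas Hv i; have Ip := H_L2 Hv i.
have mv := L1_meas (H_L1 Hv).
have IJ := L2_time_g i st.
have IB : L1 mu (fun x => e^-1 / 2 * ((t - s)^-1 * time_int (g i) s t x ^+ 2 + (t - s) * p i x ^+ 2)).
  by apply: L1Z; apply: L1D; exact: L1Z.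
apply: (@le_trans _ _ (\int[mu]_x (e^-1 / 2 * ((t - s)^-1 * time_int (g i) s t x ^+ 2 + (t - s) * p i x ^+ 2)))).
  apply: intR_abs_le => //.
    apply: L1M_sq => //; first by apply: measurable_funM => //; exact: meas_dphi.
    refine (@L1_sqM_bd _ _ R mu e^-1 (p i) (fun x => dphi e (v x)) mp _ _ Ip).
      exact: meas_dphi.
    by move=> x; exact: dphi_bd.
  move=> x; have := dphi_bd (v x) e0; move: (dphi e (v x)) => dd h1.
  rewrite mulrCA !normrM.
  apply: (@le_trans _ _ (e^-1 * (`|time_int (g i) s t x| * `|p i x|))).
    by rewrite ler_wpM2r//.
  rewrite -mulrA ler_wpM2l ?invr_ge0 ?(ltW e0)//.
  rewrite -(real_normK (num_real (time_int (g i) s t x))) -(real_normK (num_real (p i x))).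
  set A1 := `|time_int (g i) s t x|; set B := `|p i x|.
  rewrite -subr_ge0 (_ : _ - _ = (2^-1 * (t - s)^-1) * (A1 - (t - s) * B) ^+ 2).
    by rewrite mulr_ge0 ?sqr_ge0// mulr_ge0// invr_ge0 ltW.
  by field; rewrite gt_eqF.
rewrite intRZ; last by apply: L1D; exact: L1Z.
rewrite intRD; [|exact: L1Z|exact: L1Z].
rewrite !intRZ// -!mulrA ler_wpM2l ?invr_ge0 ?(ltW e0)//.
rewrite ler_wpM2l// lerD2r ler_pdivrMl//.
exact: time_g_le.
Qed.

(** The smoothed L1-distance of u (t) to c. *)
Let E (e : R) (c : X -> R) t := \int[mu]_x Phi e (u (x, t) - c x).

Let meas_Phi (e : R) (v : X -> R) : 0 < e -> measurable_fun setT v -> measurable_fun setT (fun x => Phi e (v x)).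
Proof.
move=> e0 mv; exact: (measurableT_comp (measurable_Phi e0) mv).
Qed.

Let L1_Phi (e : R) (v : X -> R) : 0 < e -> L1 mu v -> L1 mu (fun x => Phi e (v x)).
Proof.
move=> e0 Iv; apply: (L1_norm_le _ Iv); first by apply: meas_Phi => //; exact: L1_meas Iv.
by move=> x; rewrite ger0_norm ?Phi_ge0// Phi_le.
Qed.

Let L1_phiM (e : R) (v f : X -> R) : 0 < e -> measurable_fun setT v -> L1 mu f -> L1 mu (fun x => f x * phi e (v x)).
Proof.
move=> e0 mv If; refine (@L1M_bd _ _ R mu 1 f (fun x => phi e (v x)) _ _ If).
  exact: meas_phi.
by move=> x; exact: phi_le1.
Qed.

(** By convexity of Phi the increment is bounded by testing with
    phi (u (t) - c). *)
Let E_convex (s t e : R) c : G s -> G t -> 0 < e -> L1 mu c ->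
  E e c t - E e c s <= \int[mu]_x ((u (x, t) - u (x, s)) * phi e (u (x, t) - c x)).
Proof.
move=> Gs Gt e0 Ic.
have Is := H_L1 (G_H Gs); have It := H_L1 (G_H Gt).
rewrite /E -intRB; [|by apply: L1_Phi => //; exact: L1B|by apply: L1_Phi => //; exact: L1B].
apply: intR_le.
- by apply: L1B; apply: L1_Phi => //; exact: L1B.
- by apply: L1_phiM => //; [exact: L1_meas (L1B It Ic)|exact: L1B].
move=> x; rewrite mulrC.
apply: le_trans (Phi_convex e0 _ _) _.
by rewrite le_eqVlt; apply/orP; left; apply/eqP; congr (_ * _); ring.
Qed.

Let S_sub (p q : 'I_n -> X -> R) : (forall i, measurable_fun setT (p i)) -> (forall i, measurable_fun setT (q i)) ->
  (forall i, L1 mu (fun x => p i x ^+ 2)) -> (forall i, L1 mu (fun x => q i x ^+ 2)) ->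
  S (fun i x => p i x - q i x) <= 2 * (S p + S q).
Proof.
move=> mp mq Ip Iq; rewrite /S -big_split/= mulr_sumr; apply: ler_sum => i _.
rewrite -intRD// -intRZ; last exact: L1D.
apply: intR_le; [exact: L1_sqB|exact/L1Z/L1D|move=> x].
by rewrite -subr_ge0 (_ : _ - _ = (p i x + q i x) ^+ 2) ?sqr_ge0//; ring.
Qed.

(** Testing at the later time bounds the increment from above, testing at the
    earlier time bounds it from below. The gradients at s and t enter through F s
    and F t, since the test functions depend on the slices of u at these times. *)
Let E_step (s t e : R) c pc : G s -> G t -> s < t -> 0 < e -> H c pc ->
  `|E e c t - E e c s| <= win_int a s t + nu / e * win_int F s t + (t - s) * (nu / e * S pc) +
    (t - s) * (nu / e * F t + nu / e * F s).
Proof.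
move=> Gs Gt st e0 Hc.
have N0 : 0 <= nu / e by rewrite divr_ge0// ltW.
have ts : 0 < t - s by rewrite subr_gt0.
have bd r : G r -> win_int a s t + nu / e / 2 * (win_int F s t + (t - s) * S (fun i x => g i (x, r) - pc i x)) <=
    win_int a s t + nu / e * win_int F s t + (t - s) * (nu / e * S pc) + (t - s) * (nu / e * F r).
  move=> Gr; rewrite -!addrA lerD2l.
  have := @S_sub (fun i x => g i (x, r)) pc (H_meas (G_H Gr)) (H_meas Hc) (H_L2 (G_H Gr)) (H_L2 Hc).
  set Sx := S _; rewrite -[S (fun i x => g i (x, r))]/(F r) => h.
  have h1 : (t - s) * Sx <= (t - s) * (2 * (F r + S pc)) by rewrite ler_wpM2l// ltW.
  have h2 := win_int_ge0 s t F0.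
  set N := nu / e in N0 *.
  have h3 : N / 2 * (win_int F s t + (t - s) * Sx) <= N / 2 * (win_int F s t + (t - s) * (2 * (F r + S pc))).
    by apply: ler_wpM2l; [rewrite divr_ge0|rewrite lerD2l].
  have h4 := mulr_ge0 N0 h2.
  apply: le_trans h3 _; rewrite -subr_ge0.
  rewrite (_ : _ - _ = N * win_int F s t / 2); first by rewrite divr_ge0.
  by field.
have Ft : 0 <= (t - s) * (nu / e * F t) by rewrite !mulr_ge0// ?invr_ge0 ltW.
have Fs : 0 <= (t - s) * (nu / e * F s) by rewrite !mulr_ge0// ?invr_ge0 ltW.
rewrite [(t - s) * (_ + _)]mulrDr ler_norml; apply/andP; split.
  have h := E_convex Gt Gs e0 (H_L1 Hc).
  have Hv := H_sub (G_H Gs) Hc.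
  have := le_trans (step_bound Gs Gt st e0 Hv) (bd _ Gs).
  have -> : \int[mu]_x ((u (x, t) - u (x, s)) * phi e (u (x, s) - c x)) =
          - \int[mu]_x ((u (x, s) - u (x, t)) * phi e (u (x, s) - c x)).
    rewrite -intRN; first by apply: eq_Rintegral => x _; rewrite -mulNr opprB.
    apply: L1_phiM => //; first exact: L1_meas (H_L1 Hv).
    exact: (L1B (H_L1 (G_H Gs)) (H_L1 (G_H Gt))).
  rewrite normrN => h2; have := le_trans h (le_trans (ler_norm _) h2); lra.
have h := E_convex Gs Gt e0 (H_L1 Hc).
have h2 := le_trans (step_bound Gs Gt st e0 (H_sub (G_H Gt) Hc)) (bd _ Gt).
have := le_trans h (le_trans (ler_norm _) h2); lra.
Qed.

Let low_energy_time (s t : R) : 0 <= s -> s < t -> t <= T ->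
  exists r, [/\ G r, s < r < t & (t - s) * F r <= win_int F s t].
Proof.
move=> s0 st tT; apply: (exists_below_average IF st).
apply: (@filterS _ _ (ae_filter_ringOfSetsType lam) _ _ _ G_full) => r Gr /andP[sr rt].
by apply: Gr; rewrite (le_lt_trans s0 sr) (lt_le_trans rt tT).
Qed.

(** Along a chain of good times the terms F s and F t of the single step disappear. *)
Let E_increment (s t e : R) c pc : G s -> G t -> s < t -> 0 < e -> H c pc ->
  `|E e c t - E e c s| <= win_int a s t + 5 * (nu / e * win_int F s t) + (t - s) * (nu / e * S pc).
Proof.
move=> Gs Gt st e0 Hc; set N := nu / e.
have N0 : 0 <= N by rewrite divr_ge0// ltW.
have /andP[s0 sT] := G_sub Gs; have /andP[t0 tT] := G_sub Gt.
have ad (f : R -> R) (r1 r2 : R) : L1 lam f -> 0 <= r1 -> r1 <= r2 -> win_int f 0 r2 - win_int f 0 r1 = win_int f r1 r2.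
  by move=> If h1 h2; rewrite (@win_int_add _ f 0 r1 r2)// addrC addKr.
have := @chain_bound R G (E e c) (fun r => N * F r)
   (fun r => win_int a 0 r + N * win_int F 0 r + r * (N * S pc)) (fun r => N * win_int F 0 r) s t Gs Gt st.
have e1 (r1 r2 : R) : 0 <= r1 -> r1 <= r2 ->
   win_int a 0 r2 + N * win_int F 0 r2 + r2 * (N * S pc) - (win_int a 0 r1 + N * win_int F 0 r1 + r1 * (N * S pc))
   = win_int a r1 r2 + N * win_int F r1 r2 + (r2 - r1) * (N * S pc).
  by move=> h1 h2; rewrite -(ad a r1 r2)// -(ad F r1 r2)//; ring.
rewrite (e1 s t (ltW s0) (ltW st)) -[N * win_int F 0 t - _]mulrBr (ad F s t IF (ltW s0) (ltW st)).
move=> h; apply: le_trans (h _ _ _) _.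
- by move=> r _; rewrite mulr_ge0.
- move=> r1 r2 G1 G2 sr1 r12 r2t.
  have r10 := ltW (lt_le_trans s0 sr1).
  by rewrite (e1 r1 r2 r10 (ltW r12)); exact: E_step.
- move=> x y sx xy yt.
  have x0 := ltW (lt_le_trans s0 sx).
  have [r [Gr xry Fr]] := low_energy_time x0 xy (ltW (le_lt_trans yt tT)).
  exists r; split=> //; rewrite -mulrBr (ad F x y IF x0 (ltW xy)) mulrCA.
  exact: ler_wpM2l.
lra.
Qed.

Let muOm : R := fine (mu Om).

Let norm_le_E (e : R) v : 0 < e -> L1 mu v -> (forall x, ~ Om x -> v x = 0) ->
  \int[mu]_x `|v x| <= \int[mu]_x Phi e (v x) + e * muOm.
Proof.
move=> e0 Iv vout.
have I1 : L1 mu \1_Om by exact: L1_indicator.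
have -> : e * muOm = \int[mu]_x (e * \1_Om x).
  by rewrite intRZ// /Rintegral integral_indic// setIT.
rewrite -intRD; [|exact: L1_Phi|exact: L1Z].
apply: intR_le; [exact: L1_abs|by apply: L1D; [exact: L1_Phi|exact: L1Z]|move=> x].
rewrite indicE; case: (boolP (x \in Om)) => [_|/negP xO]; first by rewrite mulr1 norm_le_Phi.
rewrite vout ?normr0 ?Phi0 ?mulr0 ?addr0//.
by move=> Ox; apply: xO; rewrite inE.
Qed.

(** For s < t choose a time r in between at which the energy F r is at most its
    mean, and compare both slices with c = u (r): the increments of the smoothed
    distance to u (r) are small with the window, uniformly in r, and the distance
    vanishes at r itself. *)
Lemma unif_cont_L1 (eta : R) : 0 < eta -> exists2 D : R, 0 < D &
  forall s t : R, G s -> G t -> s <= t -> t - s < D -> \int[mu]_x `|u (x, t) - u (x, s)| <= eta.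
Proof.
move=> eta0.
have mO : 0 <= muOm by rewrite fine_ge0.
(* replacing |v| by Phi v costs e * muOm <= eta / 4 for each of the two slices *)
pose e := eta / 4 / (muOm + 1).
have e0 : 0 < e by rewrite divr_gt0 ?divr_gt0// ltr_wpDl.
have N0 : 0 <= nu / e by rewrite divr_ge0// ltW.
(* 5 from E_increment and 1 from the energy of the slice at r *)
pose hh q := a q + 6 * (nu / e * F q).
have Ih : L1 lam hh by apply: (L1D Ia); do 2 apply: L1Z.
have h0 q : 0 <= hh q by rewrite /hh; apply: addr_ge0 => //; apply: mulr_ge0 => //; exact: mulr_ge0.
have eta8 : 0 < eta / 4 by rewrite divr_gt0.
have [D D0 HD] := win_int_small Ih h0 eta8.
exists D => // s t Gs Gt; rewrite le_eqVlt => /predU1P[->|st] tsD.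
  rewrite (_ : \int[mu]_x _ = 0) ?(ltW eta0)// -[RHS](intR0 mu).
  by apply: eq_Rintegral => x _; rewrite subrr normr0.
have /andP[s0 sT] := G_sub Gs; have /andP[t0 tT] := G_sub Gt.
have [r [Gr /andP[sr rt] Fr]] := low_energy_time (ltW s0) st (ltW tT).
have Hs := HD _ _ (ltW st) tsD.
have hhE x y : win_int hh x y = win_int a x y + 6 * (nu / e * win_int F x y).
  by rewrite /hh win_intD ?win_intZ//; [exact: L1Z|do 2 apply: L1Z].
have Is := H_L1 (G_H Gs); have It := H_L1 (G_H Gt); have Ir := H_L1 (G_H Gr).
have Err : E e (fun x => u (x, r)) r = 0.
  rewrite /E -[RHS](intR0 mu); apply: eq_Rintegral => x _; by rewrite subrr Phi0.
have FS : S (fun i x => g i (x, r)) = F r by [].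
have bd x y z : G x -> G y -> x < y -> s <= x -> y <= t -> E e (fun x => u (x, r)) z >= 0 ->
    E e (fun x => u (x, r)) z <= `|E e (fun x => u (x, r)) y - E e (fun x => u (x, r)) x| ->
    E e (fun x => u (x, r)) z <= eta / 4.
  move=> Gx Gy xy sx yt Ez0 Ez.
  have := le_trans Ez (E_increment Gx Gy xy e0 (G_H Gr)); rewrite FS => h.
  apply: le_trans h _; apply: le_trans Hs; rewrite hhE.
  have m1 := win_int_mono Ia a0 sx (ltW xy) yt; have m2 := win_int_mono IF F0 sx (ltW xy) yt.
  have xyF : (y - x) * F r <= win_int F s t.
    by apply: le_trans Fr; rewrite ler_wpM2r// lerB.
  have m3 : nu / e * win_int F x y <= nu / e * win_int F s t by rewrite ler_wpM2l.
  have m4 : (y - x) * (nu / e * F r) <= nu / e * win_int F s t.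
    by rewrite mulrCA ler_wpM2l.
  lra.
have Ege z : 0 <= E e (fun x => u (x, r)) z by apply: intR_ge0 => x; exact: Phi_ge0.
have Et : E e (fun x => u (x, r)) t <= eta / 4.
  apply: (bd r t) => //; [exact: ltW|]; by rewrite Err subr0 ler_norm.
have Es : E e (fun x => u (x, r)) s <= eta / 4.
  apply: (bd s r) => //; [exact: ltW|]; by rewrite Err sub0r normrN ler_norm.
have out q x : ~ Om x -> u (x, q) - u (x, r) = 0 by move=> Ox; rewrite !u_out// subrr.
have n1 := norm_le_E e0 (L1B It Ir) (out t).
have n2 := norm_le_E e0 (L1B Is Ir) (out s).
have eO : e * muOm <= eta / 4.
  rewrite /e -mulrA ler_piMr ?(ltW eta8)// mulrC ler_pdivrMr ?ltr_wpDl//.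
  by rewrite mul1r lerDl.
apply: (@le_trans _ _ (\int[mu]_x (`|u (x, t) - u (x, r)| + `|u (x, s) - u (x, r)|))).
  apply: intR_le; [exact/L1_abs/L1B|by apply: L1D; exact/L1_abs/L1B|move=> x].
  by rewrite -(subrKA (u (x, r))) [X in _ <= _ + X]distrC; exact: ler_normD.
rewrite intRD; [|exact/L1_abs/L1B|exact/L1_abs/L1B].
move: n1 n2; rewrite -/(E e (fun x => u (x, r)) t) -/(E e (fun x => u (x, r)) s); lra.
Qed.


Variable ff : Y -> R.
Hypothesis Iff : L1 m ff.
Hypothesis k_phi : forall (e s t : R), 0 < e -> 0 < s -> s < t -> t < T ->
  - (\int[m]_z (`|ff z| * \1_(`]s, t]) z.2)) <=
  \int[m]_z (k z * phi e (u z) * \1_(`]s, t]) z.2).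

Let E0 (e r : R) := \int[mu]_x Phi e (u (x, r)).

Let IPhi (e : R) : 0 < e -> L1 m (fun z => Phi e (u z)).
Proof.
move=> e0; apply: (L1_norm_le _ Iu).
  exact: (measurableT_comp (measurable_Phi e0) mu_).
by move=> x; rewrite ger0_norm ?Phi_ge0// Phi_le.
Qed.

Let IE0 (e : R) : 0 < e -> L1 lam (E0 e).
Proof. by move=> e0; exact: (L1_intR2 (IPhi e0)). Qed.

Let G_full_shift (h : R) : {ae lam, forall r, 0 < r - h < T -> G (r - h)}.
Proof.
have [A [mA A0 sA]] := G_full.
have aeA : {ae lam, forall x, 0 = \1_A x :> R}.
  exists A; split => // x /= hx; apply: contrapT => nA; apply: hx.
  by rewrite indicE memNset.
have mA1 : measurable_fun setT (\1_A : R -> R) by exact: measurable_indic.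
have IA : L1 lam \1_A by exact: (L1_ae_eq (L10 lam) mA1 aeA).
have [IB RB0] := intR_shift (- h) IA.
have RA : \int[lam]_r \1_A r = 0 by have <- := @intR_ae_eq _ _ _ lam (fun=> 0) _ (measurable_cst (0 : R)) mA1 aeA; exact: intR0.
rewrite RA in RB0.
have B0 (x : R) : 0 <= \1_A (x - h) :> R by rewrite indicE ler0n.
have := intR_eq0_ae IB B0 RB0.
apply: (@filterS _ _ (ae_filter_ringOfSetsType lam)) => r /eqP.
rewrite indicE pnatr_eq0 eqb0 => /negP rA rT; apply: contrapT => nG; apply: rA.
by rewrite inE; apply: sA => /= /(_ rT).
Qed.

Let unif_sym (eta : R) : 0 < eta -> exists2 D : R, 0 < D &
  forall s t : R, G s -> G t -> `|s - t| < D -> \int[mu]_x `|u (x, s) - u (x, t)| <= eta.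
Proof.
move=> eta0; have [D D0 HD] := unif_cont_L1 eta0; exists D => // r t Gr Gt rtD.
have [rt|tr] := leP t r.
  by apply: HD => //; rewrite -(ger0_norm (_ : 0 <= r - t)) ?subr_ge0.
rewrite (_ : \int[mu]_x _ = \int[mu]_x `|u (x, t) - u (x, r)|); last first.
  by apply: eq_Rintegral => x _; rewrite distrC.
by apply: HD => //; [exact: ltW|rewrite -(ger0_norm (_ : 0 <= t - r)) ?subr_ge0 1?ltW// distrC].
Qed.

Let E0_cont (e t eta : R) : 0 < e -> G t -> 0 < eta -> exists2 D : R, 0 < D &
  forall r, G r -> `|r - t| < D -> `|E0 e r - E0 e t| <= eta.
Proof.
move=> e0 Gt eta0; have [D D0 HD] := unif_sym eta0; exists D => // r Gr rtD.
have Ir := H_L1 (G_H Gr); have It := H_L1 (G_H Gt).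
rewrite /E0 -intRB; [|exact: L1_Phi|exact: L1_Phi].
apply: le_trans (intR_abs_le (g := fun x => `|u (x, r) - u (x, t)|) _ _ _) (HD _ _ Gr Gt rtD).
- by apply: L1B; exact: L1_Phi.
- exact/L1_abs/L1B.
- by move=> x; exact: Phi_lip.
Qed.


(** The integrand obtained from the tested equation on ]r - h, r] divided by h. *)
Let flux (e h : R) (z : Y) :=
  steklov h k z * phi e (u z) + nu * \sum_i steklov h (g i) z * (dphi e (u z) * g i z).

Let mphi (e : R) : 0 < e -> measurable_fun setT (fun z => phi e (u z)).
Proof.
move=> e0; exact: (measurableT_comp (measurable_phi e0) mu_).
Qed.

Let mdphi (e : R) : 0 < e -> measurable_fun setT (fun z => dphi e (u z)).
Proof.
move=> e0; exact: (measurableT_comp (measurable_dphi e0) mu_).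
Qed.

Let ID2 (e : R) i : 0 < e -> L1 m (fun z => (dphi e (u z) * g i z) ^+ 2).
Proof.
move=> e0; refine (@L1_sqM_bd _ _ R m e^-1 (g i) (fun x => dphi e (u x)) (mg i) (mdphi e0) _ (Ig2 i)).
by move=> x; exact: dphi_bd.
Qed.

Let mD (e : R) i : 0 < e -> measurable_fun setT (fun z => dphi e (u z) * g i z).
Proof. by move=> e0; apply: measurable_funM => //; exact: mdphi. Qed.

Let IkP (e : R) (f : Y -> R) : 0 < e -> L1 m f -> L1 m (fun z => f z * phi e (u z)).
Proof.
move=> e0 If; refine (@L1M_bd _ _ R m 1 f (fun x => phi e (u x)) (mphi e0) _ If).
by move=> x; exact: phi_le1.
Qed.

Let ISD (e : R) i (f : Y -> R) : 0 < e -> measurable_fun setT f -> L1 m (fun z => f z ^+ 2) ->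
  L1 m (fun z => f z * (dphi e (u z) * g i z)).
Proof. by move=> e0 mf If; apply: L1M_sq => //; [exact: mD|exact: ID2]. Qed.

Let L1_flux (e h : R) : 0 < e -> 0 < h -> L1 m (flux e h).
Proof.
move=> e0 h0; apply: L1D; first by apply: IkP => //; exact: L1_steklov.
apply: L1Z; apply: L1_sum => i; apply: ISD => //; first exact: meas_steklov.
exact: L1_steklov_sq.
Qed.

(** Only the test at the later time r is used here, on the window ]r - h, r]. *)
Let backward_step (e h r : R) : 0 < e -> 0 < h -> G r -> G (r - h) ->
  E0 e r - E0 e (r - h) <= - (h * \int[mu]_x flux e h (x, r)).
Proof.
move=> e0 h0 Gr Grh; have rh : r - h < r by rewrite gtrBl.
have EE q : E0 e q = E e (fun=> 0) q.
  by apply: eq_Rintegral => x _; rewrite subr0.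
have Hr := G_H Gr; have mr := L1_meas (H_L1 Hr).
rewrite !EE; apply: le_trans (E_convex Grh Gr e0 (L10 mu)) _.
have -> : \int[mu]_x ((u (x, r) - u (x, r - h)) * phi e (u (x, r) - 0)) =
    \int[mu]_x ((u (x, r) - u (x, r - h)) * phi e (u (x, r))).
  by apply: eq_Rintegral => x _; rewrite subr0.
rewrite (weak Grh Gr rh e0 Hr) le_eqVlt; apply/orP; left; apply/eqP; congr (- _).
have IA : L1 mu (fun x => time_int k (r - h) r x * phi e (u (x, r))).
  by apply: L1_phiM => //; exact: L1_time_k.
have IJ i : L1 mu (fun x => time_int (g i) (r - h) r x * (dphi e (u (x, r)) * g i (x, r))).
  apply: L1M_sq => //; [|exact: L2_time_g|].
    by apply: measurable_funM; [exact: meas_dphi|exact: (H_meas Hr)].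
  refine (@L1_sqM_bd _ _ R mu e^-1 (fun x => g i (x, r)) (fun x => dphi e (u (x, r))) _ _ _ _).
  - exact: (H_meas Hr).
  - exact: meas_dphi.
  - by move=> x; exact: dphi_bd.
  - exact: (H_L2 Hr).
transitivity (\int[mu]_x (time_int k (r - h) r x * phi e (u (x, r)) +
    nu * \sum_i time_int (g i) (r - h) r x * (dphi e (u (x, r)) * g i (x, r)))).
  by rewrite intRD//; [rewrite intRZ ?intR_sum//; exact: L1_sum|apply: L1Z; exact: L1_sum].
rewrite -intRZ; last first.
  apply: L1D.
    have := L1Z h^-1 IA; congr (L1 mu _); apply/funext => x.
    exact: mulrA.
  apply: L1Z; apply: L1_sum => i; have := L1Z h^-1 (IJ i); congr (L1 mu _); apply/funext => x.
  exact: mulrA.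
apply: eq_Rintegral => x _; rewrite /flux /steklov /= mulrDr; congr (_ + _).
  by rewrite -/(time_int k (r - h) r x) !mulrA divff ?mul1r// gt_eqF.
rewrite mulrCA; congr (_ * _); rewrite mulr_sumr; apply: eq_bigr => i _.
by rewrite -/(time_int (g i) (r - h) r x) !mulrA divff ?mul1r// gt_eqF.
Qed.

(** Integrating the backward steps over r in ]s, t] leaves on the left the windows
    of length h that end at t and at s, and on the right the flux on ]s, t]. *)
Let averaged_step (e h s t : R) : 0 < e -> 0 < h -> h < s -> s <= t -> t <= T ->
  win_int (E0 e) (t - h) t - win_int (E0 e) (s - h) s <= - (h * \int[m]_z (flux e h z * \1_(`]s, t]) z.2)).
Proof.
move=> e0 h0 hs st tT.
have IE := IE0 e0; have IB := L1_intR2 (L1_flux e0 h0).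
have [Is Rs] := intR_shift (- h) IE.
have ih s' t' : s' <= t' -> s' - h <= t' - h by move=> ?; rewrite lerD2r.
have e1 : win_int (fun r => E0 e (r - h)) s t = win_int (E0 e) (s - h) (t - h).
  have [_ R2] := intR_shift (- h) (L1_mul_oc (s - h) (t - h) IE).
  rewrite /win_int -R2; apply: eq_Rintegral => q _; congr (_ * _).
  by rewrite !indicE !mem_setE !in_itv/= ltrD2r lerD2r.
have e2 : win_int (E0 e) s t - win_int (E0 e) (s - h) (t - h) =
    win_int (E0 e) (t - h) t - win_int (E0 e) (s - h) s.
  have hh0 x : x - h <= x by rewrite gerBl ltW.
  apply: cross_sub (@win_int_add _ (E0 e) (s - h) s t IE (hh0 s) st).
  exact: (@win_int_add _ (E0 e) (s - h) (t - h) t IE (ih _ _ st) (hh0 t)).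
rewrite -e2 -e1 (intR_window2 _ _ (L1_flux e0 h0)) -(win_intZ h s t IB).
pose Q q := \int[mu]_x flux e h (x, q).
have IL : L1 lam (fun q => E0 e q * \1_(`]s, t]) q - E0 e (q - h) * \1_(`]s, t]) q).
  by apply: L1B; [exact: (L1_mul_oc _ _ IE)|exact: (L1_mul_oc _ _ Is)].
have IQ : L1 lam (fun q => h * Q q * \1_(`]s, t]) q).
  exact: (L1_mul_oc _ _ (L1Z h IB)).
rewrite /win_int -(intRB (L1_mul_oc _ _ IE) (L1_mul_oc _ _ Is)) -(intRN IQ).
apply: (intR_ae_le IL (L1N IQ)).
apply: (@filterS3 _ _ (ae_filter_ringOfSetsType lam) _ _ _ _ _ G_full (G_full_shift h) (ae_neq t)) => r h1 h2 rt.
rewrite indicE; case: (boolP (r \in _)) => [|_]; last by rewrite (mulr0 (E0 e r)) (mulr0 (E0 e (r - h))) (mulr0 (h * Q r)) subrr oppr0.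
rewrite inE/= in_itv/= => /andP[sr rlt].
rewrite (mulr1 (E0 e r)) (mulr1 (E0 e (r - h))) (mulr1 (h * Q r)).
have r0 : 0 < r by exact: lt_trans (lt_trans h0 hs) sr.
have rT : r < T by apply: (lt_le_trans _ tT); rewrite lt_neqAle rt.
apply: (backward_step e0 h0).
  by apply: h1; rewrite r0 rT.
apply: h2; rewrite subr_gt0 (lt_trans hs sr)/=.
by apply: (lt_trans _ rT); rewrite gtrBl.
Qed.


Let hh (j : nat) : R := j.+1%:R^-1.
Let hh0 j : 0 < hh j. Proof. by rewrite invr_gt0. Qed.

Let flux_cvg (e s t : R) : 0 < e ->
  (\int[m]_z (flux e (hh j) z * \1_(`]s, t]) z.2)) @[j --> \oo] -->
  \int[m]_z (k z * phi e (u z) * \1_(`]s, t]) z.2) +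
  nu * \sum_i \int[m]_z (g i z * (dphi e (u z) * g i z) * \1_(`]s, t]) z.2).
Proof.
move=> e0.
have BE j : \int[m]_z (flux e (hh j) z * \1_(`]s, t]) z.2) =
    \int[m]_z (steklov (hh j) k z * phi e (u z) * \1_(`]s, t]) z.2) +
    nu * \sum_i \int[m]_z (steklov (hh j) (g i) z * (dphi e (u z) * g i z) * \1_(`]s, t]) z.2).
  have I1 : L1 m (fun z => steklov (hh j) k z * phi e (u z) * \1_(`]s, t]) z.2).
    by apply/L1_window/IkP => //; exact: L1_steklov.
  have I2 i : L1 m (fun z => steklov (hh j) (g i) z * (dphi e (u z) * g i z) * \1_(`]s, t]) z.2).
    by apply/L1_window/ISD => //; [exact: meas_steklov|exact: L1_steklov_sq].
  rewrite -intR_sum// -intRZ; last exact: L1_sum.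
  rewrite -intRD//; last by apply: L1Z; exact: L1_sum.
  by apply: eq_Rintegral => z _; rewrite /flux mulrDl; congr (_ + _); rewrite -mulrA mulr_suml.
have {}BE : (fun j => \int[m]_z (flux e (hh j) z * \1_(`]s, t]) z.2)) =
    (fun j => \int[m]_z (steklov (hh j) k z * phi e (u z) * \1_(`]s, t]) z.2) +
    nu * \sum_i \int[m]_z (steklov (hh j) (g i) z * (dphi e (u z) * g i z) * \1_(`]s, t]) z.2)).
  by apply/funext.
rewrite BE; apply: cvgD; last first.
  apply: cvgMr; apply: cvg_sum_fin => i.
  exact: (steklov_mul_cvg (Ig i) (Ig2 i) (mD i e0) (ID2 i e0)).
apply/cvgrPdist_le => eta eta0.
have /cvgr0Pnorm_le /(_ _ eta0) := steklov_cvg_L1 Ik; apply: filterS => j; apply: le_trans.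
have Is := L1_steklov (hh0 j) Ik.
rewrite -intRB; [|exact/L1_window/IkP|exact/L1_window/IkP].
apply: le_trans (ler_norm _).
apply: intR_abs_le; [by apply: L1B; exact/L1_window/IkP|exact/L1_abs/L1B|move=> z].
rewrite -!mulrBl -mulrA normrM distrC ler_piMr// normrM.
by apply: mulr_ile1 => //; [exact: phi_le1|exact: window_bd].
Qed.

(** Divide the averaged step by h and let h tend to 0: the left side tends to the
    increment of E0 by continuity, the diffusion has a sign since dphi >= 0, and
    the drift contributes at least minus the mass of the source. *)
Let E0_growth (e s t : R) : 0 < e -> G s -> G t -> s < t ->
  E0 e t - E0 e s <= \int[m]_z (`|ff z| * \1_(`]s, t]) z.2).
Proof.
move=> e0 Gs Gt st.
have /andP[s0 sT] := G_sub Gs; have /andP[t0 tT] := G_sub Gt.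
have kp := k_phi e0 s0 st tT.
set L := \int[m]_z (`|ff z| * _) in kp *.
have gp : 0 <= nu * \sum_i \int[m]_z (g i z * (dphi e (u z) * g i z) * \1_(`]s, t]) z.2).
  rewrite mulr_ge0//; apply: sumr_ge0 => i _; apply: intR_ge0 => z.
  by rewrite mulrCA -expr2 mulr_ge0 ?indicE ?ler0n// mulr_ge0 ?sqr_ge0// dphi_ge0.
have Bl := @flux_cvg e s t e0; set B := _ + _ in Bl.
have BL : - L <= B by apply: le_trans kp _; rewrite lerDl.
apply/ler_addgt0Pr => eta eta0; have eta3 : 0 < eta / 3 by rewrite divr_gt0.
have [Ds Ds0 HDs] := E0_cont e0 Gs eta3.
have [Dt Dt0 HDt] := E0_cont e0 Gt eta3.
have hl : hh j @[j --> \oo] --> (0 : R) by exact: cvg_harmonic.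
have cB : \forall j \near \oo, B - eta / 3 <= \int[m]_z (flux e (hh j) z * \1_(`]s, t]) z.2).
  have /cvgrPdist_le /(_ _ eta3) := Bl; apply: filterS => i.
  by rewrite ler_norml => /andP[_]; rewrite lerBlDl -lerBlDr.
near \oo => j.
have hs : hh j < s by near: j; exact: (cvgr_lt _ hl).
have hDs : hh j < Ds by near: j; exact: (cvgr_lt _ hl).
have hDt : hh j < Dt by near: j; exact: (cvgr_lt _ hl).
have Bj : B - eta / 3 <= \int[m]_z (flux e (hh j) z * \1_(`]s, t]) z.2) by near: j.
have h0 := hh0 j; set h := hh j in h0 hs hDs hDt Bj.
have := averaged_step e0 h0 hs (ltW st) (ltW tT).
have IE := IE0 e0.
have win r D : G r -> h < r -> 0 < D -> h < D ->
   (forall q, G q -> `|q - r| < D -> `|E0 e q - E0 e r| <= eta / 3) ->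
   `|win_int (E0 e) (r - h) r - h * E0 e r| <= h * (eta / 3).
  move=> Gr hr D0 hD' HD; have rh : r - h <= r by rewrite gerBl ltW.
  have /andP[r0 rT] := G_sub Gr.
  have Ic c : L1 lam (fun q : R => c * \1_(`]r - h, r]) q) by exact/L1Z/L1_indic_oc.
  have Rc c : \int[lam]_q (c * \1_(`]r - h, r]) q) = h * c.
    by rewrite intRZ ?intR_indic_oc ?subKr 1?mulrC//; exact: L1_indic_oc.
  rewrite -!Rc /win_int -intRB//; last exact: L1_mul_oc.
  apply: le_trans (intR_abs _) _; first by apply: L1B => //; exact: L1_mul_oc.
  apply: intR_ae_le => //; first by apply/L1_abs/L1B => //; exact: L1_mul_oc.
  apply: (@filterS _ _ (ae_filter_ringOfSetsType lam) _ _ _ G_full) => q Gq.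
  rewrite indicE; case: (boolP (q \in _)) => [|_]; last by rewrite (mulr0 (E0 e q)) (mulr0 (E0 e r)) subrr normr0 mulr0.
  rewrite inE/= in_itv/= => /andP[q1 q2]; rewrite (mulr1 (E0 e q)) (mulr1 (E0 e r)) mulr1.
  apply: HD.
    by apply: Gq; rewrite (le_lt_trans q2 rT) (lt_trans _ q1)// subr_gt0.
  rewrite distrC ger0_norm ?subr_ge0//.
  by apply: lt_trans hD'; rewrite ltrBlDl -ltrBlDr.
have hst : h < t by exact: lt_trans hs st.
have := win s Ds Gs hs Ds0 hDs HDs; have := win t Dt Gt hst Dt0 hDt HDt.
exact: (arith_sharp h0 Bj BL).
Unshelve. all: by end_near.
Qed.

(** As e tends to 0 the smoothed norms tend to the L1-norms, uniformly since Om has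
    finite measure. *)
Lemma L1_norm_growth (s t : R) : G s -> G t -> s < t -> \int[mu]_x `|u (x, t)| <=
  \int[mu]_x `|u (x, s)| + \int[m]_z (`|ff z| * \1_(`]s, t]) z.2).
Proof.
move=> Gs Gt st; apply/ler_addgt0Pr => eta eta0.
have mO : 0 <= muOm by rewrite fine_ge0.
pose e := eta / (muOm + 1).
have e0 : 0 < e by rewrite divr_gt0// ltr_wpDl.
have eO : e * muOm <= eta.
  rewrite /e -mulrA ler_piMr ?(ltW eta0)// mulrC ler_pdivrMr ?ltr_wpDl//.
  by rewrite mul1r lerDl.
have Is := H_L1 (G_H Gs); have It := H_L1 (G_H Gt).
have n1 := norm_le_E e0 It (fun x Ox => u_out t Ox).
have n2 : E0 e s <= \int[mu]_x `|u (x, s)|.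
  by apply: intR_le; [exact: L1_Phi|exact: L1_abs|move=> x; exact: Phi_le].
have := E0_growth e0 Gs Gt st; rewrite -/(E0 e t) in n1.
move: n1 n2 eO; set A := \int[m]_z _; set U := \int[mu]_x _; set V := \int[mu]_x _.
move: A U V (E0 e t) (E0 e s) (e * muOm) => A U V x y z n1 n2 n3 n4.
apply: le_trans n1 _; apply: lerD => //.
by rewrite lerBlDr in n4; apply: le_trans n4 _; rewrite addrC lerD2r.
Qed.


Hypothesis T0 : 0 < T.

Let dense_G (t D : R) : 0 <= t <= T -> 0 < D -> exists2 r, G r & `|r - t| < D.
Proof.
move=> /andP[t0 tT] D0; pose s := Num.max 0 (t - D); pose t' := Num.min T (t + D).
have s0 : 0 <= s by rewrite le_max lexx.
have t'T : t' <= T by rewrite ge_min lexx.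
have st' : s < t'.
  rewrite gt_max !lt_min T0 ltr_wpDl//= (lt_le_trans _ tT) ?gtrBl//=.
  by rewrite ltrBlDr -addrA ltrDl addr_gt0.
have [r [Gr /andP[sr rt'] _]] := low_energy_time s0 st' t'T; exists r => //.
move: sr rt'; rewrite gt_max lt_min => /andP[_ h1] /andP[_ h2].
by rewrite ltr_norml ltrBrDl h1 ltrBlDl.
Qed.

Let norm_tri (f h l : X -> R) : L1 mu f -> L1 mu h -> L1 mu l ->
  \int[mu]_x `|f x - l x| <= \int[mu]_x `|f x - h x| + \int[mu]_x `|h x - l x|.
Proof.
move=> If Ih Il; rewrite -intRD; [|exact/L1_abs/L1B|exact/L1_abs/L1B].
apply: intR_le; [exact/L1_abs/L1B|by apply: L1D; exact/L1_abs/L1B|move=> x].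
by rewrite -(subrKA (h x)); exact: ler_normD.
Qed.

Let norm_sym (f h : X -> R) : \int[mu]_x `|f x - h x| = \int[mu]_x `|h x - f x|.
Proof. by apply: eq_Rintegral => x _; rewrite distrC. Qed.

Let norm_abs (f h : X -> R) : L1 mu f -> L1 mu h ->
  \int[mu]_x `|f x| <= \int[mu]_x `|h x| + \int[mu]_x `|f x - h x|.
Proof.
move=> If Ih; rewrite -intRD; [|exact/L1_abs|exact/L1_abs/L1B].
apply: intR_le; [exact/L1_abs|by apply: L1D; [exact/L1_abs|exact/L1_abs/L1B]|move=> x].
by rewrite -lerBlDl; exact: lerB_dist.
Qed.

(** Along good times that tend to t the slices are Cauchy in L1. *)
Let L1_limit_exists : exists w : R -> X -> R, forall t, 0 <= t <= T ->
  [/\ L1 mu (w t), forall x, ~ Om x -> w t x = 0 &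
    forall eta : R, 0 < eta -> exists2 D : R, 0 < D & forall r, G r -> `|r - t| < D ->
      \int[mu]_x `|u (x, r) - w t x| <= eta].
Proof.
suff : forall t, exists wt : X -> R, 0 <= t <= T -> [/\ L1 mu wt, forall x, ~ Om x -> wt x = 0 &
    forall eta : R, 0 < eta -> exists2 D : R, 0 < D & forall r, G r -> `|r - t| < D ->
      \int[mu]_x `|u (x, r) - wt x| <= eta].
  by move=> /choice[w Hw]; exists w.
move=> t; have [tT|] := boolP (0 <= t <= T); last by exists (fun=> 0).
have /choice[r Hr] : forall j : nat, exists r : R, G r /\ `|r - t| < (hh j).
  by move=> j; have [r Gr rt] := dense_G tT (hh0 j); exists r.
have Gr j := (Hr j).1; have rt j := (Hr j).2.
have Iu_ s (Gs : G s) := H_L1 (G_H Gs).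
have hle i j : (i <= j)%N -> hh j <= hh i by move=> ij; rewrite lef_pV2 ?posrE// ler_nat.
have hl (D : R) : 0 < D -> exists N, hh N < D.
  by move=> D0; have [N] := ltr_add_invr D0; rewrite add0r; exists N.
have [w Iw Hw] : exists2 w, L1 mu w & forall e : R, 0 < e -> exists N, forall i, (N <= i)%N ->
    \int[mu]_x `|u (x, r i) - w x| <= e.
  apply: (L1_complete (f_ := fun i x => u (x, r i))) => [i|e e0]; first exact: Iu_.
  have [D D0 HD] := unif_sym e0; have D2 : 0 < D / 2 by rewrite divr_gt0.
  have [N hN] := hl _ D2; exists N => i j Ni Nj; apply: HD => //.
  rewrite (splitr D) -(subrKA t); apply: le_lt_trans (ler_normD _ _) _.
  rewrite ltrD//; first exact: (lt_trans (rt i) (le_lt_trans (hle _ _ Ni) hN)).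
  by rewrite distrC; exact: (lt_trans (rt j) (le_lt_trans (hle _ _ Nj) hN)).
have IwO : L1 mu (w \_ Om) by exact: L1_patch.
exists (w \_ Om) => _; split => //.
  by move=> x Ox; rewrite patchE memNset.
move=> eta eta0; have eta2 : 0 < eta / 2 by rewrite divr_gt0.
have [D D0 HD] := unif_sym eta2; have [N1 HN1] := Hw _ eta2.
have D2 : 0 < D / 2 by rewrite divr_gt0.
have [N2 hN2] := hl _ D2.
exists (D / 2) => // s Gs sD.
have IwE : \int[mu]_x `|u (x, s) - (w \_ Om) x| <= \int[mu]_x `|u (x, s) - w x|.
  apply: intR_le; [exact/L1_abs/L1B/IwO/Iu_|exact/L1_abs/L1B/Iw/Iu_|move=> x].
  rewrite patchE; case: (boolP (x \in Om)) => // /negP xO.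
  by rewrite u_out ?subr0 ?normr0// => Ox; apply: xO; rewrite inE.
apply: le_trans IwE _; pose N := maxn N1 N2.
apply: le_trans (norm_tri (Iu_ _ Gs) (Iu_ _ (Gr N)) Iw) _; rewrite (splitr eta) lerD//.
  apply: HD => //; rewrite (splitr D) -(subrKA t); apply: le_lt_trans (ler_normD _ _) _.
  rewrite ltrD// distrC.
  exact: (lt_trans (rt N) (le_lt_trans (hle _ _ (leq_maxr _ _)) hN2)).
by apply: HN1; exact: leq_maxl.
Qed.

Theorem L1_continuous_representative : exists w : R -> X -> R,
  [/\ forall t, 0 <= t <= T -> L1 mu (w t) /\ (forall x, ~ Om x -> w t x = 0),
      forall t (eta : R), 0 <= t <= T -> 0 < eta -> exists2 D : R, 0 < D &
        forall s, 0 <= s <= T -> `|s - t| < D -> \int[mu]_x `|w s x - w t x| <= eta,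
      forall t, G t -> {ae mu, forall x, w t x = u (x, t)} &
      forall s t, 0 <= s -> s <= t -> t <= T -> \int[mu]_x `|w t x| <=
        \int[mu]_x `|w s x| + \int[m]_z (`|ff z| * \1_(`]s, t]) z.2)].
Proof.
have [w Hw] := L1_limit_exists; exists w.
have Iu_ s (Gs : G s) := H_L1 (G_H Gs).
have Iw t (tT : 0 <= t <= T) : L1 mu (w t) by case: (Hw _ tT).
split.
- by move=> t tT; case: (Hw _ tT).
- move=> t eta tT eta0; have eta2 : 0 < eta / 2 by rewrite divr_gt0.
  have [_ _ /(_ _ eta2) [D D0 HD]] := Hw _ tT.
  exists (D / 2); first by rewrite divr_gt0.
  move=> s sT stD; have [_ _ /(_ _ eta2) [D' D'0 HD']] := Hw _ sT.
  have M0 : 0 < Num.min D' (D / 2) by rewrite lt_min D'0 divr_gt0.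
  have [r Gr] := dense_G sT M0; rewrite lt_min => /andP[r1 r2].
  apply: le_trans (norm_tri (Iw _ sT) (Iu_ _ Gr) (Iw _ tT)) _.
  rewrite (splitr eta) lerD//; first by rewrite norm_sym; exact: HD'.
  apply: HD => //; rewrite (splitr D) -(subrKA s); apply: le_lt_trans (ler_normD _ _) _.
  by rewrite ltrD.
- move=> t Gt; have /andP[t0 tT] := G_sub Gt.
  have tT' : 0 <= t <= T by rewrite !ltW.
  have ID : L1 mu (fun x => `|u (x, t) - w t x|) by exact/L1_abs/L1B/(Iw _ tT')/(Iu_ _ Gt).
  have : {ae mu, forall x, `|u (x, t) - w t x| = 0}.
    apply: intR_eq0_ae => //; apply/eqP; rewrite eq_le intR_ge0// andbT.
    apply/ler_addgt0Pr => eta eta0; rewrite add0r.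
    have [_ _ /(_ _ eta0) [D D0 HD]] := Hw _ tT'.
    by apply: HD => //; rewrite subrr normr0.
  by apply: filterS => x /normr0P; rewrite subr_eq0 => /eqP.
- move=> s t s0; rewrite le_eqVlt => /predU1P[->|st] tT.
    by rewrite lerDl; apply: intR_ge0 => z; rewrite mulr_ge0// indicE ler0n.
  apply/ler_addgt0Pr => eta eta0; have eta2 : 0 < eta / 2 by rewrite divr_gt0.
  have sT' : 0 <= s <= T by rewrite s0 (le_trans (ltW st)).
  have tT' : 0 <= t <= T by rewrite tT (le_trans s0 (ltW st)).
  have [_ _ /(_ _ eta2) [Ds Ds0 HDs]] := Hw _ sT'.
  have [_ _ /(_ _ eta2) [Dt Dt0 HDt]] := Hw _ tT'.
  pose mid := (s + t) / 2.
  have sm : s < mid by rewrite midf_lt.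
  have mt : mid < t by rewrite midf_lt.
  have sr1 : s < Num.min mid (s + Ds) by rewrite lt_min sm ltrDl.
  have m1T : Num.min mid (s + Ds) <= T by rewrite ge_min (le_trans (ltW mt) tT).
  have [r1 [G1 /andP[sr r1m] _]] := low_energy_time s0 sr1 m1T.
  have r2t : Num.max mid (t - Dt) < t by rewrite gt_max mt gtrBl.
  have m20 : 0 <= Num.max mid (t - Dt) by rewrite le_max (le_trans s0 (ltW sm)).
  have [r2 [G2 /andP[mr2 rt] _]] := low_energy_time m20 r2t tT.
  move: r1m; rewrite lt_min => /andP[r1m r1D].
  move: mr2; rewrite gt_max => /andP[mr2 r2D].
  have r12 : r1 < r2 by exact: lt_trans r1m mr2.
  have d1 : \int[mu]_x `|u (x, r1) - w s x| <= eta / 2.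
    by apply: HDs => //; rewrite ger0_norm ?subr_ge0 ?(ltW sr)// ltrBlDl.
  have d2 : \int[mu]_x `|u (x, r2) - w t x| <= eta / 2.
    by apply: HDt => //; rewrite distrC ger0_norm ?subr_ge0 ?(ltW rt)// ltrBlDl -ltrBlDr.
  have n1 := norm_abs (Iu_ _ G1) (Iw _ sT').
  have n2 := norm_abs (Iw _ tT') (Iu_ _ G2); rewrite norm_sym in n2.
  have n3 := L1_norm_growth G1 G2 r12.
  have n4 : \int[m]_z (`|ff z| * \1_(`]r1, r2]) z.2) <= \int[m]_z (`|ff z| * \1_(`]s, t]) z.2).
    rewrite !intR_window2; [|exact: L1_abs|exact: L1_abs].
    apply: win_int_mono; [exact: (L1_intR2 (L1_abs Iff))| |exact: ltW|exact: ltW|exact: ltW].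
    by move=> q; exact: intR_ge0.
  apply: le_trans n2 _; apply: le_trans (lerD n3 d2) _.
  by apply: (arith_chain n1 d1 n4).
Qed.

End core.

(** * Borel sets of R^n *)

Section borel_rV.
Context (R : realType) (n : nat).
Local Notation X := 'rV[R]_n.

Lemma ball_rV (x y : X) (e : R) : 0 < e -> ball x e y <-> forall i, ball (x 0 i) e (y 0 i).
Proof.
move=> e0; split => [[_ h] i|h]; first exact: h.
by split => // i j; rewrite ord1.
Qed.

Lemma measurable_ball_rV (x : X) (e : R) : 0 < e -> measurable (ball x e).
Proof.
move=> e0; rewrite (_ : ball x e = \bigcap_(i in [set: 'I_n])
  ((fun y : X => y 0 i : measurableTypeR R) @^-1` ball (x 0 i) e)).
  apply: fin_bigcap_measurable => // i _.
  rewrite -[X in measurable X]setTI; apply: measurable_coord => //.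
  exact: measurable_ball.
apply/seteqP; split => [y /(ball_rV _ _ e0) xy i _|y xy]; first exact: xy.
by apply/ball_rV => // i; exact: xy.
Qed.

(** An open set is the union of the cubes with rational centre and radius 1/(k+1)
    that it contains. *)
Lemma open_measurable_rV (U : set X) : open U -> measurable U.
Proof.
move=> oU.
pose B (p : 'rV[rat]_n * nat) : set X := ball (map_mx ratr p.1 : X) p.2.+1%:R^-1.
have mB p : measurable (B p) by apply: measurable_ball_rV; rewrite invr_gt0.
pose B' p := if `[< B p `<=` U >] then B p else set0.
rewrite (_ : U = \bigcup_p B' p).
  apply: countable_bigcupT_measurable => // p.
  by rewrite /B'; case: ifP => // _; exact: measurable0.
apply/seteqP; split => [x Ux|x [p _]]; last first.
  by rewrite /B'; case: asboolP => // pU; exact: pU.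
have /nbhs_ballP[e /= e0 xe] : nbhs x U by exact: open_nbhs_nbhs.
have e2 : 0 < e / 2 by rewrite divr_gt0.
have [k] := ltr_add_invr e2; rewrite add0r => hk.
have k0 : 0 < (k.+1%:R^-1 : R) by rewrite invr_gt0.
have /choice[q Hq] : forall i : 'I_n, exists q : rat, ball (x 0 i) k.+1%:R^-1 (ratr q : R).
  move=> i; have xx : x 0 i - k.+1%:R^-1 < x 0 i + k.+1%:R^-1.
    by apply: (@lt_trans _ _ (x 0 i)); rewrite ?gtrBl ?ltrDl.
  have [q] := rat_in_itvoo xx; rewrite in_itv/= => /andP[h1 h2]; exists q.
  by rewrite /ball/= distrC ltr_norml ltrBrDl h1 ltrBlDl.
have Bx : B (\row_i q i, k) x.
  by apply/ball_rV => // i; rewrite !mxE/=; apply: ball_sym; exact: Hq.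
exists (\row_i q i, k) => //; rewrite /B'; case: asboolP => // nB; exfalso; apply: nB => y By; apply: xe.
apply: (@le_ball _ _ _ (k.+1%:R^-1 + k.+1%:R^-1)); first by rewrite (splitr e) lerD// ltW.
exact: (ball_triangle (ball_sym Bx) By).
Qed.

Lemma continuous_measurable_rV (h : X -> R) : continuous h -> measurable_fun setT h.
Proof.
move=> /continuousP ch; apply: (measurability _ (RGenOInfty.measurableE R)) => _ [_ [x ->] <-].
by rewrite setTI; apply: open_measurable_rV; apply: ch; exact: rray_open.
Qed.

Lemma bounded_rV_lty (U : set X) : measurable U -> bounded_set U -> (lebesgue_rV n U < +oo)%E.
Proof.
move=> mU /pinfty_ex_gt0[M M0 UM].
pose A (i : 'I_n) : set (measurableTypeR R) := `[-M, M]%classic.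
pose box : set X := [set x | forall i, A i (x 0 i)].
have mbox : measurable box.
  rewrite (_ : box = \bigcap_(i in [set: 'I_n])
    ((fun x : X => x 0 i : measurableTypeR R) @^-1` A i)).
    apply: fin_bigcap_measurable => // i _.
    by rewrite -[X in measurable X]setTI; apply: measurable_coord => //; exact: measurable_itv.
  by apply/seteqP; split => [x /= Ax i _|x /= Ax i]; exact: Ax.
apply: (@le_lt_trans _ _ (lebesgue_rV n box)).
  apply: le_measure; rewrite ?inE//.
  move=> x Ux i; rewrite /A/= in_itv/= -ler_norml.
  apply: le_trans (UM _ Ux).
  have /mapP[j Hj ->] : `|x 0 i| \in [seq `|x k.1 k.2| | k : 'I_1 * 'I_n].
    by apply/mapP; exists (ord0, i) => //=; rewrite mem_enum.
  by rewrite [leRHS]/Num.norm /= mx_normrE; apply/bigmax_geP; right => /=; exists j.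
rewrite /box lebesgue_rV_box => [|i]; last exact: measurable_itv.
have : (\big[*%E/1]_(i < n) lebesgue_measure (A i))%E \is a fin_num.
  elim/big_ind : _ => [//|y z|i _]; first exact: fin_numM.
  by rewrite /A lebesgue_measure_itv/=; case: ifP => // _; rewrite -EFinB.
by move=> h; rewrite -(fineK h) ltry.
Qed.

End borel_rV.

(** * From test functions to the solution as a test *)

Lemma swap_sub (V : zmodType) (a b c d : V) : a - b = c - d -> a - c = b - d.
Proof.
by move=> /eqP; rewrite subr_eq => /eqP ->; rewrite addrAC [c - d - c]addrAC subrr sub0r addrC.
Qed.

(** Here the tests are any class of bounded functions with bounded gradients that
    is stable under differences and under composition with phi and Phi; weak_cut
    and div_cut are the equation and the sign condition tested with
    cutoff (t) p (x). *)
Section evolution.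
Context d (X : measurableType d) (R : realType).
Context (mu : {sigma_finite_measure set X -> \bar R}) (n : nat).
Local Notation lam := (@lebesgue_measure R).
Local Notation Y := (X * measurableTypeR R)%type.
Local Notation m := (mu \x lam)%E.
Variables (Om : set X) (T nu : R).
Hypotheses (mOm : measurable Om) (fOm : (mu Om < +oo)%E) (nu0 : 0 <= nu) (T0 : 0 < T).
Variables (u f : Y -> R) (b g : 'I_n -> Y -> R).
Hypotheses (u_out : forall x t, ~ Om x -> u (x, t) = 0).
Hypotheses (Iu : L1 m u) (If : L1 m f).
Hypotheses (Ig : forall i, L1 m (g i)) (Ig2 : forall i, L1 m (fun z => g i z ^+ 2)).
Hypotheses (Ib : forall i, L1 m (b i)) (Ib2 : forall i, L1 m (fun z => b i z ^+ 2)).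

Variable test : (X -> R) -> ('I_n -> X -> R) -> Prop.
Hypotheses (test_meas : forall p q, test p q -> measurable_fun setT p /\ forall i, measurable_fun setT (q i)).
Hypotheses (test_bd : forall p q, test p q -> exists C, forall x, `|p x| <= C /\ forall i, `|q i x| <= C).
Hypotheses (test_out : forall p q, test p q -> forall x, ~ Om x -> p x = 0 /\ forall i, q i x = 0).
Hypotheses (test_sub : forall p q p' q', test p q -> test p' q' ->
  test (fun x => p x - p' x) (fun i x => q i x - q' i x)).
Hypotheses (test_phi : forall e p q, 0 < e -> test p q ->
  test (fun x => phi e (p x)) (fun i x => dphi e (p x) * q i x)).
Hypotheses (test_Phi : forall e p q, 0 < e -> test p q ->
  test (fun x => Phi e (p x)) (fun i x => phi e (p x) * q i x)).

(** Pairs (v, p) that are limits of tests and their gradients, almost everywhere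
    and in L2 respectively. It abstracts the closure of the test functions in
    W^1_2. *)
Definition test_closure (v : X -> R) (p : 'I_n -> X -> R) :=
  [/\ L1 mu v, forall x, ~ Om x -> v x = 0, forall i, measurable_fun setT (p i),
      forall i, L1 mu (fun x => p i x ^+ 2) &
      exists s_ : nat -> X -> R, exists q_ : nat -> 'I_n -> X -> R,
      [/\ forall j, test (s_ j) (q_ j), {ae mu, forall x, s_ ^~ x @ \oo --> v x} &
       forall i, \int[mu]_x (q_ j i x - p i x) ^+ 2 @[j --> \oo] --> (0 : R)]].

(** The equation reads d/dt u - nu Laplace u + drift = 0. *)
Definition drift (z : Y) := \sum_i b i z * g i z - f z.

Hypothesis weak_cut : forall p q, test p q -> forall s t : R, 0 < s -> s < t -> t < T ->
  exists N, forall j, (N <= j)%N ->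
    \int[lam]_r (dcutoff j.+1%:R s t r * \int[mu]_x (u (x, r) * p x)) =
    \int[lam]_r (cutoff j.+1%:R s t r *
      \int[mu]_x (drift (x, r) * p x + nu * \sum_i g i (x, r) * q i x)).
Hypothesis div_cut : forall p q, test p q -> (forall x, 0 <= p x) ->
  forall s t : R, 0 < s -> s < t -> t < T ->
  exists N, forall j, (N <= j)%N ->
    0 <= \int[lam]_r (cutoff j.+1%:R s t r * \int[mu]_x (\sum_i b i (x, r) * q i x)).
Hypothesis slices : {ae lam, forall t, 0 < t < T -> test_closure (fun x => u (x, t)) (fun i x => g i (x, t))}.

Let mu_ : measurable_fun setT u := L1_meas Iu.
Let mb i : measurable_fun setT (b i) := L1_meas (Ib i).
Let mg i : measurable_fun setT (g i) := L1_meas (Ig i).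

Lemma L1_drift : L1 m drift.
Proof. by apply: L1B => //; apply: L1_sum => i; exact: L1M_sq. Qed.

Let L2_test p q i : test p q -> L1 mu (fun x => q i x ^+ 2).
Proof.
move=> pq; have [_ mq] := test_meas pq; have [C HC] := test_bd pq.
have I1 : L1 mu \1_Om by exact: L1_indicator.
apply: (L1_le (measurable_funX 2 (mq i)) (L1Z (C ^+ 2) I1)) => x; rewrite indicE.
case: (boolP (x \in Om)) => [_|/negP xO].
  rewrite mulr1 normrX lerXn2r ?nnegrE ?normr_ge0//; last exact: (HC x).2.
  exact: le_trans (normr_ge0 _) (HC x).1.
by rewrite mulr0 (test_out pq _).2 ?expr0n ?normr0// => Ox; apply: xO; rewrite inE.
Qed.

Let test_closure_sub v p v' p' : test_closure v p -> test_closure v' p' ->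
  test_closure (fun x => v x - v' x) (fun i x => p i x - p' i x).
Proof.
move=> [Iv vo mp Ip [s [q [tests sv qp]]]] [Iv' vo' mp' Ip' [s' [q' [tests' sv' qp']]]].
split.
- exact: L1B.
- by move=> x Ox; rewrite vo// vo'// subr0.
- by move=> i; exact: measurable_funB.
- by move=> i; exact: L1_sqB.
- exists (fun j x => s j x - s' j x), (fun j i x => q j i x - q' j i x); split.
  + by move=> j; exact: test_sub.
  + by apply: filterS2 sv sv' => x c1 c2; exact: (cvgB c1 c2).
  + move=> i.
    have Iq j := L2_test i (tests j); have Iq' j := L2_test i (tests' j).
    have mq j := (test_meas (tests j)).2 i; have mq' j := (test_meas (tests' j)).2 i.
    have I1 j : L1 mu (fun x => (q j i x - p i x) ^+ 2) by exact: L1_sqB.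
    have I2 j : L1 mu (fun x => (q' j i x - p' i x) ^+ 2) by exact: L1_sqB.
    have c : (fun j => 2 * (\int[mu]_x (q j i x - p i x) ^+ 2 + \int[mu]_x (q' j i x - p' i x) ^+ 2)) @ \oo --> (0 : R).
      rewrite -(mulr0 2) -[X in 2 * X](addr0 0).
      by apply: cvgMr; exact: (cvgD (qp i) (qp' i)).
    apply: (squeeze_cvgr _ (cvg_cst 0) c); apply: nearW => j; rewrite intR_ge0 => [/=|x]; last exact: sqr_ge0.
    rewrite -intRD// -intRZ; last exact: L1D.
    apply: intR_le; [by apply: L1_sqB; [exact: measurable_funB|exact: measurable_funB|exact: L1_sqB|exact: L1_sqB]|exact/L1Z/L1D|move=> x].
    rewrite -subr_ge0 (_ : _ - _ = ((q j i x - p i x) + (q' j i x - p' i x)) ^+ 2) ?sqr_ge0//; ring.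
Qed.

Let cvg_int_phi (e : R) (A0 v : X -> R) (s : nat -> X -> R) : 0 < e -> L1 mu A0 ->
  (forall j, measurable_fun setT (s j)) -> measurable_fun setT v ->
  {ae mu, forall x, s ^~ x @ \oo --> v x} ->
  \int[mu]_x (A0 x * phi e (s j x)) @[j --> \oo] --> \int[mu]_x (A0 x * phi e (v x)).
Proof.
move=> e0 IA ms mv sv; have cp : continuous (phi e).
  by move=> x; exact: (@smooth_cont _ _ _ (smooth_phi e0)).
have mp := continuous_measurable_fun cp; have mA := L1_meas IA.
apply: (@intR_dominated_cvg _ _ _ mu (fun j x => A0 x * phi e (s j x)) _ (fun x => `|A0 x|) _ _ _ _ _).2.
- by move=> j; apply: measurable_funM => //; exact: measurableT_comp.
- by apply: measurable_funM => //; exact: measurableT_comp.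
- exact: L1_abs.
- apply: filterS sv => x sx; apply: cvgMr; exact: (cvg_comp _ _ sx (cp (v x))).
- by apply: aeW => x j; rewrite normrM ler_piMr// phi_le1.
Qed.

(** Write F(s_j) q_j = F(s_j) (q_j - p) + F(s_j) p: the first part tends to 0 in L2,
    the second is dominated. *)
Let cvg_int_grad (F : R -> R) (C : R) (J v p : X -> R) (s q : nat -> X -> R) : continuous F ->
  (forall x, `|F x| <= C) -> measurable_fun setT J -> L1 mu (fun x => J x ^+ 2) ->
  (forall j, measurable_fun setT (s j)) -> measurable_fun setT v ->
  (forall j, measurable_fun setT (q j)) -> measurable_fun setT p ->
  (forall j, L1 mu (fun x => q j x ^+ 2)) -> L1 mu (fun x => p x ^+ 2) ->
  {ae mu, forall x, s ^~ x @ \oo --> v x} ->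
  \int[mu]_x (q j x - p x) ^+ 2 @[j --> \oo] --> (0 : R) ->
  \int[mu]_x (J x * (F (s j x) * q j x)) @[j --> \oo] --> \int[mu]_x (J x * (F (v x) * p x)).
Proof.
move=> cF FC mJ IJ ms mv mq mp Iq Ip sv qp.
have mF := continuous_measurable_fun cF.
have C0 : 0 <= C by exact: le_trans (normr_ge0 _) (FC 0).
have mFs j : measurable_fun setT (fun x => F (s j x)) by exact: measurableT_comp.
have mFv : measurable_fun setT (fun x => F (v x)) by exact: measurableT_comp.
have Iqp j : L1 mu (fun x => (q j x - p x) ^+ 2) by exact: L1_sqB.
have mqp j : measurable_fun setT (fun x => q j x - p x) by exact: measurable_funB.
have IFq j : L1 mu (fun x => (F (s j x) * (q j x - p x)) ^+ 2).
  exact: (@L1_sqM_bd _ _ R mu C _ _ (mqp j) (mFs j) (fun x => FC _) (Iqp j)).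
have IJp : L1 mu (fun x => J x * p x) by exact: L1M_sq.
have c1 : \int[mu]_x ((F (s j x) * (q j x - p x)) * J x) @[j --> \oo] --> (0 : R).
  apply: cvg_int_mul_L2 => //; first by move=> j; exact: measurable_funM.
  have c : (fun j => C ^+ 2 * \int[mu]_x (q j x - p x) ^+ 2) @ \oo --> (0 : R).
    by rewrite -(mulr0 (C ^+ 2)); exact: cvgMr.
  apply: (squeeze_cvgr _ (cvg_cst 0) c); apply: nearW => j; rewrite intR_ge0 => [/=|x]; last exact: sqr_ge0.
  rewrite -intRZ//; apply: intR_le => // [|x]; first exact: L1Z.
  by rewrite exprMn ler_wpM2r ?sqr_ge0// -[F _ ^+ 2]ger0_norm ?sqr_ge0// normrX lerXn2r ?nnegrE.
have c2 : \int[mu]_x (J x * p x * F (s j x)) @[j --> \oo] --> \int[mu]_x (J x * p x * F (v x)).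
  apply: (@intR_dominated_cvg _ _ _ mu (fun j x => J x * p x * F (s j x)) _ (fun x => C * `|J x * p x|) _ _ _ _ _).2.
  - by move=> j; apply: measurable_funM => //; exact: L1_meas IJp.
  - by apply: measurable_funM => //; exact: L1_meas IJp.
  - exact/L1Z/L1_abs.
  - apply: filterS sv => x sx; apply: cvgMr; exact: (cvg_comp _ _ sx (cF (v x))).
  - by apply: aeW => x j; rewrite normrM mulrC ler_wpM2r.
have := cvgD c1 c2; rewrite add0r => c3.
have -> : \int[mu]_x (J x * (F (v x) * p x)) = \int[mu]_x (J x * p x * F (v x)).
  by apply: eq_Rintegral => x _; rewrite mulrA mulrAC.
apply: cvg_trans (c3 _); apply: near_eq_cvg; apply: nearW => j /=.
rewrite -[LHS]/(\int[mu]_x (F (s j x) * (q j x - p x) * J x) + \int[mu]_x (J x * p x * F (s j x))) -intRD.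
- by apply: eq_Rintegral => x _; ring.
- by apply: L1M_sq => //; exact: measurable_funM.
- by refine (@L1M_bd _ _ R mu C _ _ (mFs j) (fun x => FC _) IJp).
Qed.

(** If (s_j) approximates v then phi (s_j) is a sequence of tests. *)
Let closure_identity (e : R) A0 (J : 'I_n -> X -> R) v p : 0 < e -> L1 mu A0 ->
  (forall i, measurable_fun setT (J i)) -> (forall i, L1 mu (fun x => J i x ^+ 2)) -> test_closure v p ->
  (forall p q, test p q -> \int[mu]_x (A0 x * p x) + \sum_i \int[mu]_x (J i x * q i x) = 0) ->
  \int[mu]_x (A0 x * phi e (v x)) + \sum_i \int[mu]_x (J i x * (dphi e (v x) * p i x)) = 0.
Proof.
move=> e0 IA mJ IJ [Iv vo mp Ip [s [q [tests sv qp]]]] H.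
have ms j := (test_meas (tests j)).1; have mv := L1_meas Iv.
have c1 := cvg_int_phi e0 IA ms mv sv.
have c2 : (fun j => \sum_i \int[mu]_x (J i x * (dphi e (s j x) * q j i x))) @ \oo -->
   \sum_i \int[mu]_x (J i x * (dphi e (v x) * p i x)).
  apply: cvg_sum_fin => i; apply: (@cvg_int_grad (dphi e) e^-1 (J i) v (p i) s (fun j => q j i)) => //.
  - by move=> x; exact: (@smooth_cont _ _ _ (smooth_dphi e0)).
  - by move=> x; rewrite ger0_norm ?dphi_ge0 ?dphi_le.
  - by move=> j; exact: (test_meas (tests j)).2.
  - by move=> j; exact: L2_test.
have c3 := cvgD c1 c2.
apply: (cvg_unique _ (c3 _)) => //; apply: cvg_near_cst; apply: nearW => j.
exact: (H _ _ (test_phi e0 (tests j))).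
Qed.

(** The tests Phi (s_j) are nonnegative, with gradient phi (s_j) q_j. *)
Let closure_inequality (e : R) (J : 'I_n -> X -> R) v p : 0 < e ->
  (forall i, measurable_fun setT (J i)) -> (forall i, L1 mu (fun x => J i x ^+ 2)) -> test_closure v p ->
  (forall p q, test p q -> (forall x, 0 <= p x) -> 0 <= \sum_i \int[mu]_x (J i x * q i x)) ->
  0 <= \sum_i \int[mu]_x (J i x * (phi e (v x) * p i x)).
Proof.
move=> e0 mJ IJ [Iv vo mp Ip [s [q [tests sv qp]]]] H.
have ms j := (test_meas (tests j)).1; have mv := L1_meas Iv.
have c2 : (fun j => \sum_i \int[mu]_x (J i x * (phi e (s j x) * q j i x))) @ \oo -->
   \sum_i \int[mu]_x (J i x * (phi e (v x) * p i x)).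
  apply: cvg_sum_fin => i; apply: (@cvg_int_grad (phi e) 1 (J i) v (p i) s (fun j => q j i)) => //.
  - by move=> x; exact: (@smooth_cont _ _ _ (smooth_phi e0)).
  - by move=> x; exact: phi_le1.
  - by move=> j; exact: (test_meas (tests j)).2.
  - by move=> j; exact: L2_test.
apply: (@closed_cvg _ _ _ _ _ [set x : R | 0 <= x] _ _ _ c2); first exact: closed_ge.
apply: nearW => j /=; apply: (H _ _ (test_Phi e0 (tests j))) => x; exact: Phi_ge0.
Qed.

Let mfst (p : X -> R) : measurable_fun setT p -> measurable_fun setT (fun z : Y => p z.1).
Proof. by move=> mp; exact: measurableT_comp measurable_fst. Qed.

Let L1_pair (h : Y -> R) (p : X -> R) (C : R) : L1 m h -> measurable_fun setT p ->
  (forall x, `|p x| <= C) -> L1 m (fun z => h z * p z.1).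
Proof. by move=> Ih mp pC; exact: (@L1M_bd _ _ R m C _ _ (mfst mp) (fun z => pC z.1) Ih). Qed.

Let intR_pair_window (h : Y -> R) (p : X -> R) (C s t : R) : L1 m h -> measurable_fun setT p ->
  (forall x, `|p x| <= C) ->
  \int[m]_z (h z * p z.1 * \1_(`]s, t]) z.2) = \int[mu]_x (time_int h s t x * p x).
Proof.
move=> Ih mp pC; have Ihp := L1_pair Ih mp pC.
rewrite intR_window1//; apply: intR_ae_eq.
- exact: L1_meas (L1_intR1 (L1_window s t Ihp)).
- apply: measurable_funM => //; exact: L1_meas (L1_intR1 (L1_window s t Ih)).
apply: filterS (ae_L1_1 Ih) => x Ix; rewrite /time_int mulrC -intRZ; last exact: L1_mul_oc.
by apply: eq_Rintegral => q _ /=; rewrite mulrAC mulrC.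
Qed.

Let hh (j : nat) : R := j.+1%:R^-1.
Let hh0 j : 0 < hh j. Proof. by rewrite invr_gt0. Qed.

Let fast_subsequence : exists jn : nat -> nat, forall i, (i <= jn i)%N /\
  \int[m]_z `|steklov (hh (jn i)) u z - u z| <= 2^-1 ^+ i.
Proof.
suff : forall i : nat, exists j : nat, (i <= j)%N /\
    \int[m]_z `|steklov (hh j) u z - u z| <= 2^-1 ^+ i.
  by move=> /choice[jn Hjn]; exists jn.
move=> i; have e0 : 0 < (2^-1 : R) ^+ i by rewrite exprn_gt0.
have /cvgr0Pnorm_le /(_ _ e0) [N _ HN] := steklov_cvg_L1 Iu.
exists (maxn i N); split; first exact: leq_maxl.
by apply: le_trans (ler_norm _) _; apply: HN; exact: leq_maxr.
Qed.

Let steklov_gap (jn : nat -> nat) (i : nat) (t : R) := \int[mu]_x `|steklov (hh (jn i)) u (x, t) - u (x, t)|.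

(** The Steklov averages of u converge at these times in L1 in the space variable,
    along a subsequence fixed once for all. As no test function enters, this
    replaces the choice of a countable dense family of tests. *)
Definition good_time (jn : nat -> nat) : set R := [set t | [/\ 0 < t < T,
  test_closure (fun x => u (x, t)) (fun i x => g i (x, t)) & steklov_gap jn ^~ t @ \oo --> (0 : R)]].

Let ISu j : L1 m (fun z => `|steklov (hh j) u z - u z|).
Proof. by apply/L1_abs/L1B => //; exact: L1_steklov. Qed.

Let good_time_full jn : (forall i, (i <= jn i)%N /\
  \int[m]_z `|steklov (hh (jn i)) u z - u z| <= 2^-1 ^+ i) ->
  {ae lam, forall t, 0 < t < T -> good_time jn t}.
Proof.
move=> Hjn.
have : {ae lam, forall t, steklov_gap jn ^~ t @ \oo --> (0 : R)}.
  apply: (@ae_series0 _ _ _ lam (steklov_gap jn) 1) => [i|i t|i].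
  - exact: (L1_intR2 (ISu (jn i))).
  - exact: intR_ge0.
  - by rewrite mul1r (intR_fubini2 (ISu (jn i))); exact: (Hjn i).2.
move=> h; apply: (@filterS2 _ _ (ae_filter_ringOfSetsType lam) _ _ _ _ h slices) => t h1 h2 tT.
by split => //; exact: h2.
Qed.

Let rhs_density p (q : 'I_n -> X -> R) (z : Y) := drift z * p z.1 + nu * \sum_i g i z * q i z.1.

Let L1_rhs_density p q : test p q -> L1 m (rhs_density p q).
Proof.
move=> pq; have [mp mq] := test_meas pq; have [C HC] := test_bd pq.
apply: L1D; first exact: (L1_pair L1_drift mp (fun x => (HC x).1)).
by apply: L1Z; apply: L1_sum => i; exact: (L1_pair (Ig i) (mq i) (fun x => (HC x).2 i)).
Qed.

Let rhs p q r := \int[mu]_x rhs_density p q (x, r).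
Let pairing p r := \int[mu]_x (u (x, r) * p x).

Let win_int_rhs p q s t : test p q -> win_int (rhs p q) s t =
  \int[mu]_x (time_int drift s t x * p x) + nu * \sum_i \int[mu]_x (time_int (g i) s t x * q i x).
Proof.
move=> pq; have [mp mq] := test_meas pq; have [C HC] := test_bd pq.
have I1 := L1_pair L1_drift mp (fun x => (HC x).1).
have I2 i := L1_pair (Ig i) (mq i) (fun x => (HC x).2 i).
rewrite -(intR_pair_window s t L1_drift mp (fun x => (HC x).1)).
under eq_bigr do rewrite -(intR_pair_window s t (Ig _) (mq _) (fun x => (HC x).2 _)).
rewrite -(intR_window2 s t (L1_rhs_density pq)) -intR_sum; last by move=> i; exact: L1_window.
rewrite -intRZ; last by apply: L1_sum => i; exact: L1_window.
rewrite -intRD; [|exact: L1_window|by apply: L1Z; apply: L1_sum => i; exact: L1_window].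
by apply: eq_Rintegral => z _; rewrite /rhs_density mulrDl -[nu * _ * _]mulrA mulr_suml.
Qed.

(** For a given test the pairing equals c + V at almost every time, V being a
    primitive of the right-hand side. At a good time t the averages of the pairing
    over ]t - h, t] converge to its value at t, while those of c + V converge to
    its value by continuity: the identity holds at every good time. *)
Let slice_identity jn p q s t : (forall i, (i <= jn i)%N /\
  \int[m]_z `|steklov (hh (jn i)) u z - u z| <= 2^-1 ^+ i) -> test p q ->
  good_time jn s -> good_time jn t -> s < t -> pairing p t - pairing p s = - win_int (rhs p q) s t.
Proof.
move=> Hjn pq Gs Gt st; have [mp mq] := test_meas pq; have [C HC] := test_bd pq.
have pC x := (HC x).1.
have IU : L1 lam (pairing p) := L1_intR2 (L1_pair Iu mp pC).
have IK : L1 lam (rhs p q) := L1_intR2 (L1_rhs_density pq).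
pose V t := - win_int (rhs p q) 0 t.
have VB (r1 r2 : R) : 0 <= r1 -> r1 <= r2 -> V r1 - V r2 = win_int (rhs p q) r1 r2.
  by move=> h1 h2; rewrite /V (@win_int_add _ (rhs p q) 0 r1 r2)// opprK addKr.
have dbr (r1 r2 : R) : 0 < r1 -> r1 < r2 -> r2 < T -> lebesgue_pt (pairing p) r1 -> lebesgue_pt (pairing p) r2 ->
    pairing p r1 - V r1 = pairing p r2 - V r2.
  move=> h1 h2 h3 l1 l2.
  have := du_bois_reymond IU IK h2 l1 l2 (weak_cut pq h1 h2 h3).
  by rewrite -/(win_int (rhs p q) r1 r2) -(VB _ _ (ltW h1) (ltW h2)) => /swap_sub.
have aeL := L1_lebesgue_pt IU.
(* any Lebesgue point of the pairing fixes the constant *)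
have [r0 [lr0 /andP[r00 r0T] _]] : exists r, [/\ lebesgue_pt (pairing p) r, 0 < r < T & (T - 0) * 0 <= win_int (fun=> 0 : R) 0 T].
  apply: (@exists_below_average _ (lebesgue_pt (pairing p)) (fun=> 0)) => //; first exact: L10.
  by apply: (@filterS _ _ (ae_filter_ringOfSetsType lam) _ _ _ aeL).
pose c := pairing p r0 - V r0.
have UV : {ae lam, forall r, 0 < r < T -> pairing p r = c + V r}.
  apply: (@filterS _ _ (ae_filter_ringOfSetsType lam) _ _ _ aeL) => r lr /andP[h1 h2].
  apply/eqP; rewrite -subr_eq; apply/eqP; rewrite /c.
  have [rr0|rr0|->] := ltgtP r r0; last by [].
    exact: dbr.
  by apply/esym; exact: dbr.
suff key r : good_time jn r -> pairing p r = c + V r.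
  rewrite !key// opprD addrACA subrr add0r -opprB VB//.
    by case: Gs => /andP[/ltW].
  exact: ltW.
move=> [/andP[r1 rT] [Iur _ _ _ _] Dr].
have e1 h : 0 < h -> h^-1 * win_int (pairing p) (r - h) r = \int[mu]_x (steklov h u (x, r) * p x).
  move=> h0; rewrite -(intR_window2 (r - h) r (L1_pair Iu mp pC)) (intR_pair_window (r - h) r Iu mp pC) -intRZ.
    by apply: eq_Rintegral => x _; rewrite mulrA.
  exact: (@L1M_bd _ _ R mu C _ _ mp pC (L1_intR1 (L1_window (r - h) r Iu))).
pose y i := (hh (jn i))^-1 * win_int (pairing p) (r - hh (jn i)) r.
have hl (D : R) : 0 < D -> \forall i \near \oo, hh (jn i) < D.
  move=> D0; have [N] := ltr_add_invr D0; rewrite add0r => hN.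
  exists N => // i /= Ni; apply: le_lt_trans hN.
  by rewrite lef_pV2 ?posrE// ler_nat ltnS; exact: leq_trans Ni (Hjn i).1.
have c1 : y @ \oo --> c + V r.
  apply/cvgrPdist_le => eta eta0.
  have [D D0 HD] := win_int_small (L1_abs IK) (fun q => normr_ge0 _) eta0.
  near=> i.
  have hD : hh (jn i) < D by near: i; exact: hl.
  have hr : hh (jn i) < r by near: i; exact: hl.
  have h0 := hh0 (jn i); set h := hh (jn i) in h0 hD hr *.
  have rh : r - h <= r by rewrite gerBl ltW.
  have Rc a : win_int (fun=> a) (r - h) r = h * a.
    by rewrite /win_int intRZ ?intR_indic_oc ?subKr 1?mulrC//; exact: L1_indic_oc.
  have Ic a : L1 lam (fun q : R => a * \1_(`]r - h, r]) q) by exact/L1Z/L1_indic_oc.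
  have : `|h * (c + V r) - win_int (pairing p) (r - h) r| <= h * eta.
    rewrite -!Rc /win_int -intRB//; last exact: L1_mul_oc.
    have IB : L1 lam (fun q => (c + V r) * \1_(`]r - h, r]) q - pairing p q * \1_(`]r - h, r]) q).
      by apply: L1B => //; exact: L1_mul_oc.
    apply: le_trans (intR_abs IB) _.
    apply: (intR_ae_le (L1_abs IB) (Ic eta)).
    apply: (@filterS _ _ (ae_filter_ringOfSetsType lam) _ _ _ UV) => a Ua.
    rewrite -mulrBl normrM [X in _ * X]ger0_norm ?indicE ?ler0n//.
    case: (boolP (a \in _)) => [|_]; last by rewrite (mulr0 `|_|) mulr0.
    rewrite inE/= in_itv/= => /andP[q1 q2]; rewrite (mulr1 `|_|) mulr1.
    have a0 : 0 < a by apply: lt_trans q1; rewrite subr_gt0.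
    rewrite Ua ?a0 ?(le_lt_trans q2 rT)// opprD addrACA subrr add0r -opprB normrN.
    rewrite VB ?(ltW a0)//; apply: le_trans (intR_abs _) _; first exact: L1_mul_oc.
    apply: le_trans (HD a r q2 _); last first.
      by apply: lt_trans hD; rewrite ltrBlDl -ltrBlDr.
    rewrite le_eqVlt; apply/orP; left; apply/eqP; apply: eq_Rintegral => z _.
    by rewrite normrM [X in _ * X]ger0_norm// indicE ler0n.
  rewrite /y -/h -(ler_pM2l (_ : 0 < h^-1)) ?invr_gt0// mulKf ?gt_eqF//.
  rewrite -[X in X * _]gtr0_norm ?invr_gt0// -normrM mulrBr mulKf ?gt_eqF//.
have c2 : y @ \oo --> pairing p r.
  have c0 : (fun i => C * steklov_gap jn i r) @ \oo --> (0 : R) by rewrite -(mulr0 C); exact: cvgMr.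
  apply/cvgrPdist_le => eta eta0.
  have /cvgr0Pnorm_le /(_ _ eta0) := c0; apply: filterS => i; apply: le_trans.
  rewrite /y e1// distrC; apply: le_trans (ler_norm _).
  have Is : L1 mu (fun x => steklov (hh (jn i)) u (x, r)) by exact: (L1Z _ (L1_intR1 (L1_window (r - hh (jn i)) r Iu))).
  have Isp := @L1M_bd _ _ R mu C _ _ mp pC Is; have Iup := @L1M_bd _ _ R mu C _ _ mp pC Iur.
  rewrite /pairing -intRB// -intRZ; last exact/L1_abs/L1B.
  apply: intR_abs_le; [exact: L1B|exact/L1Z/L1_abs/L1B|move=> x].
  by rewrite -mulrBl normrM mulrC ler_wpM2r.
exact: (cvg_unique _ c2 c1).
Unshelve. all: by end_near.
Qed.

Let phi_tested_equation jn : (forall i, (i <= jn i)%N /\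
  \int[m]_z `|steklov (hh (jn i)) u z - u z| <= 2^-1 ^+ i) ->
  forall (s t e : R) v p, good_time jn s -> good_time jn t -> s < t -> 0 < e -> test_closure v p ->
  \int[mu]_x ((u (x, t) - u (x, s)) * phi e (v x)) =
  - (\int[mu]_x (time_int drift s t x * phi e (v x)) +
     nu * \sum_i \int[mu]_x (time_int (g i) s t x * (dphi e (v x) * p i x))).
Proof.
move=> Hjn s t e v p Gs Gt st e0 Wv.
have [_ [Ius _ _ _ _] _] := Gs; have [_ [Iut _ _ _ _] _] := Gt.
have IA := L1_intR1 (L1_window s t L1_drift).
have mJ i : measurable_fun setT (time_int (g i) s t) by exact: L1_meas (L1_intR1 (L1_window s t (Ig i))).
have IJ i : L1 mu (fun x => time_int (g i) s t x ^+ 2) by exact: L2_time_g.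
have Iv : L1 mu v by case: Wv.
have mpv : measurable_fun setT (fun x => phi e (v x)).
  exact: (measurableT_comp (measurable_phi e0) (L1_meas Iv)).
have bpv x : `|phi e (v x)| <= 1 by exact: phi_le1.
have := @closure_identity e (fun x => u (x, t) - u (x, s) + time_int drift s t x) (fun i x => nu * time_int (g i) s t x) v p e0.
have -> : \int[mu]_x ((u (x, t) - u (x, s) + time_int drift s t x) * phi e (v x)) =
   \int[mu]_x ((u (x, t) - u (x, s)) * phi e (v x)) + \int[mu]_x (time_int drift s t x * phi e (v x)).
  rewrite -intRD; [|exact: (@L1M_bd _ _ R mu 1 _ _ mpv bpv (L1B Iut Ius))|exact: (@L1M_bd _ _ R mu 1 _ _ mpv bpv IA)].
  by apply: eq_Rintegral => x _; rewrite mulrDl.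
have -> : \sum_i \int[mu]_x (nu * time_int (g i) s t x * (dphi e (v x) * p i x)) =
    nu * \sum_i \int[mu]_x (time_int (g i) s t x * (dphi e (v x) * p i x)).
  rewrite mulr_sumr; apply: eq_bigr => i _; rewrite -intRZ.
    by apply: eq_Rintegral => x _; exact/esym/mulrA.
  have [_ _ mp Ip _] := Wv.
  have mdv : measurable_fun setT (fun x => dphi e (v x)).
    exact: (measurableT_comp (measurable_dphi e0) (L1_meas Iv)).
  apply: L1M_sq => //; first exact: measurable_funM.
  apply: (@L1_sqM_bd _ _ R mu e^-1 _ _ (mp i) mdv _ (Ip i)) => x.
  by rewrite ger0_norm ?dphi_ge0 ?dphi_le.
move=> H; apply/eqP; rewrite -addr_eq0 addrA; apply/eqP; apply: H => //.
- by apply: L1D => //; exact: L1B.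
- by move=> i; exact: measurable_funM.
- move=> i; have := L1Z (nu ^+ 2) (IJ i); congr (L1 mu _); apply/funext => x.
  by rewrite exprMn.
move=> p' q' pq; have [mp' mq'] := test_meas pq; have [C HC] := test_bd pq.
have pC x := (HC x).1.
have := slice_identity Hjn pq Gs Gt st; rewrite win_int_rhs// => GI.
have -> : \int[mu]_x ((u (x, t) - u (x, s) + time_int drift s t x) * p' x) =
   pairing p' t - pairing p' s + \int[mu]_x (time_int drift s t x * p' x).
  rewrite /pairing -intRB; [|exact: (@L1M_bd _ _ R mu C _ _ mp' pC Iut)|exact: (@L1M_bd _ _ R mu C _ _ mp' pC Ius)].
  rewrite -intRD; [|apply: L1B|exact: (@L1M_bd _ _ R mu C _ _ mp' pC IA)]; last first.
  - exact: (@L1M_bd _ _ R mu C _ _ mp' pC Ius).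
  - exact: (@L1M_bd _ _ R mu C _ _ mp' pC Iut).
  by apply: eq_Rintegral => x _; rewrite mulrDl mulrBl.
rewrite GI mulr_sumr opprD addrAC -addrA [X in _ + X]addrC addrA.
rewrite [X in X + _ = _]addrC.
have -> : \sum_i \int[mu]_x (nu * time_int (g i) s t x * q' i x) =
    \sum_i nu * \int[mu]_x (time_int (g i) s t x * q' i x).
  apply: eq_bigr => i _; rewrite -intRZ.
    by apply: eq_Rintegral => x _; exact/esym/mulrA.
  exact: (@L1M_bd _ _ R mu C _ _ (mq' i) (fun x => (HC x).2 i) (L1_intR1 (L1_window s t (Ig i)))).
ring.
Qed.

Let Iste2 i j : L1 m (fun z => steklov (hh j) (b i) z ^+ 2).
Proof. exact: L1_steklov_sq. Qed.

Let mphiu (e : R) : 0 < e -> measurable_fun setT (fun z => phi e (u z)).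
Proof.
move=> e0; exact: (measurableT_comp (measurable_phi e0) mu_).
Qed.

Let Ipg (e : R) i : 0 < e -> L1 m (fun z => (phi e (u z) * g i z) ^+ 2).
Proof.
move=> e0; refine (@L1_sqM_bd _ _ R m 1 (g i) (fun x => phi e (u x)) (mg i) (mphiu e0) _ (Ig2 i)).
by move=> x; exact: phi_le1.
Qed.

Let mpg (e : R) i : 0 < e -> measurable_fun setT (fun z => phi e (u z) * g i z).
Proof. by move=> e0; apply: measurable_funM => //; exact: mphiu. Qed.

Let Ibpg (e : R) i (h : Y -> R) : 0 < e -> measurable_fun setT h -> L1 m (fun z => h z ^+ 2) ->
  L1 m (fun z => h z * (phi e (u z) * g i z)).
Proof. by move=> e0 mf If'; apply: L1M_sq => //; [exact: mpg|exact: Ipg]. Qed.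

(** For h < s and every r in ]s, t] the average of b over ]r - h, r] has
    nonpositive divergence, being an average of such fields; it is square
    integrable, hence may be tested with Phi (u (r)), whose gradient is phi (u) g. *)
Let steklov_div_le0 (e s t : R) j : 0 < e -> 0 < s -> s < t -> t < T -> hh j < s ->
  0 <= \sum_i \int[m]_z (steklov (hh j) (b i) z * (phi e (u z) * g i z) * \1_(`]s, t]) z.2).
Proof.
move=> e0 s0 st tT hs.
have mst i : measurable_fun setT (steklov (hh j) (b i)) by exact: meas_steklov.
have IQ : L1 m (fun z => \sum_i steklov (hh j) (b i) z * (phi e (u z) * g i z)).
  by apply: L1_sum => i; exact: Ibpg.
rewrite -intR_sum; last by move=> i; apply/L1_window/Ibpg.
have -> : \int[m]_x (\sum_i steklov (hh j) (b i) x * (phi e (u x) * g i x) * \1_(`]s, t]) x.2) =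
    \int[m]_x ((\sum_i steklov (hh j) (b i) x * (phi e (u x) * g i x)) * \1_(`]s, t]) x.2).
  by apply: eq_Rintegral => z _; rewrite mulr_suml.
rewrite intR_window2// /win_int -[X in X <= _](intR0 lam).
apply: intR_ae_le; [exact: L10|exact/L1_mul_oc/(L1_intR2 IQ)|].
have aei : {ae lam, forall r, forall i, L1 mu (fun x => steklov (hh j) (b i) (x, r) ^+ 2)}.
  apply: (@filter_forall _ _ _ _ (ae_filter_ringOfSetsType lam)) => i.
  exact: (ae_L1_2 (Iste2 i j)).
apply: (@filterS2 _ _ (ae_filter_ringOfSetsType lam) _ _ _ _ slices aei) => r Wr I2.
rewrite indicE; case: (boolP (r \in _)) => [|_]; last by rewrite mulr0.
rewrite inE/= in_itv/= mulr1 => /andP[sr rt].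
have r0 : 0 < r by exact: lt_trans sr.
have rT : r < T by exact: le_lt_trans tT.
have {}Wr := Wr (introT andP (conj r0 rT)).
have [Iur _ mgr Igr _] := Wr.
have mphir : measurable_fun setT (fun x => phi e (u (x, r))).
  exact: (meas_slice2 r (mphiu e0)).
have mstr i : measurable_fun setT (fun x => steklov (hh j) (b i) (x, r)).
  exact: (meas_slice2 r (mst i)).
rewrite intR_sum; last first.
  move=> i; apply: L1M_sq => //; first by apply: measurable_funM => //; exact: mgr.
  by apply: (@L1_sqM_bd _ _ R mu 1 _ _ (mgr i) mphir _ (Igr i)) => x; exact: phi_le1.
apply: (closure_inequality e0 _ _ Wr) => // p q pq p0.
have [mp mq] := test_meas pq; have [C HC] := test_bd pq.
have rh : r - hh j < r by rewrite gtrBl.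
have hr : 0 < r - hh j by rewrite subr_gt0 (lt_trans hs).
have Ibq i := L1_pair (Ib i) (mq i) (fun x => (HC x).2 i).
have IK : L1 lam (fun r => \int[mu]_x (\sum_i b i (x, r) * q i x)).
  by apply: (@L1_intR2 _ _ _ _ _ _ _ (fun z => \sum_i b i z * q i z.1)); exact: L1_sum.
have := ge0_of_cutoffs IK rh (div_cut pq p0 hr rh rT).
have -> : \int[lam]_r0 ((\int[mu]_x (\sum_i b i (x, r0) * q i x)) * \1_(`]r - hh j, r]) r0) =
   hh j * \sum_i \int[mu]_x (steklov (hh j) (b i) (x, r) * q i x).
  rewrite -[LHS]/(win_int (fun r => \int[mu]_x (\sum_i b i (x, r) * q i x)) (r - hh j) r).
  rewrite -(@intR_window2 _ _ _ _ (fun z => \sum_i b i z * q i z.1)); last exact: L1_sum.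
  transitivity (\sum_i \int[m]_z (b i z * q i z.1 * \1_(`]r - hh j, r]) z.2)).
    rewrite -intR_sum; last by move=> i; exact: L1_window.
    by apply: eq_Rintegral => z _; rewrite mulr_suml.
  rewrite mulr_sumr; apply: eq_bigr => i _.
  rewrite (intR_pair_window (r - hh j) r (Ib i) (mq i) (fun x => (HC x).2 i)) -intRZ.
    apply: eq_Rintegral => x _; rewrite mulrA; congr (_ * _).
    by apply/esym/mulVKf; rewrite gt_eqF.
  apply: (@L1M_bd _ _ R mu C _ _ (mq i) (fun x => (HC x).2 i)).
  exact: (L1Z _ (L1_intR1 (L1_window (r - hh j) r (Ib i)))).
by rewrite pmulr_rge0.
Qed.

(** As h tends to 0 the averages of b converge in L2 and the transport term
    b . g phi (u) keeps its sign. *)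
Let phi_tested_drift (e s t : R) : 0 < e -> 0 < s -> s < t -> t < T ->
  - (\int[m]_z (`|f z| * \1_(`]s, t]) z.2)) <=
  \int[m]_z (drift z * phi e (u z) * \1_(`]s, t]) z.2).
Proof.
move=> e0 s0 st tT.
have bp : 0 <= \sum_i \int[m]_z (b i z * (phi e (u z) * g i z) * \1_(`]s, t]) z.2).
  have cl : (fun j => \sum_i \int[m]_z (steklov (hh j) (b i) z * (phi e (u z) * g i z) * \1_(`]s, t]) z.2))
      @ \oo --> \sum_i \int[m]_z (b i z * (phi e (u z) * g i z) * \1_(`]s, t]) z.2).
    apply: cvg_sum_fin => i.
    exact: (steklov_mul_cvg (Ib i) (Ib2 i) (mpg i e0) (Ipg i e0)).
  apply: (@closed_cvg _ _ _ _ _ [set x : R | 0 <= x] _ _ _ cl); first exact: closed_ge.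
  have [N] := ltr_add_invr s0; rewrite add0r => hN.
  exists N => // j /= Nj; apply: steklov_div_le0 => //; apply: le_lt_trans hN.
  by rewrite lef_pV2 ?posrE// ler_nat.
have I3 i : L1 m (fun z => b i z * (phi e (u z) * g i z) * \1_(`]s, t]) z.2).
  by apply/L1_window/Ibpg.
have If1 : L1 m (fun z => f z * phi e (u z)).
  by apply: (@L1M_bd _ _ R m 1 _ _ (mphiu e0) _ If) => x; exact: phi_le1.
have -> : \int[m]_z (drift z * phi e (u z) * \1_(`]s, t]) z.2) =
   \sum_i \int[m]_z (b i z * (phi e (u z) * g i z) * \1_(`]s, t]) z.2) -
   \int[m]_z (f z * phi e (u z) * \1_(`]s, t]) z.2).
  rewrite -intR_sum// -intRB; [|exact: L1_sum|exact: L1_window].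
  apply: eq_Rintegral => z _; rewrite /drift !mulrBl !mulr_suml; congr (_ - _).
  by apply: eq_bigr => i _; congr (_ * _); rewrite mulrAC mulrA.
apply: (@le_trans _ _ (- \int[m]_z (f z * phi e (u z) * \1_(`]s, t]) z.2))); last by rewrite lerDr.
rewrite lerN2; apply: le_trans (ler_norm _) _.
apply: intR_abs_le; [exact: L1_window|exact/L1_window/L1_abs|move=> z].
rewrite -mulrA normrM ler_wpM2l// normrM -[X in _ <= X]mul1r.
rewrite [X in _ * X <= _]ger0_norm ?indicE ?ler0n// ler_wpM2r ?ler0n//.
exact: phi_le1.
Qed.

Theorem test_closure_evolution : exists w : R -> X -> R,
  [/\ forall t, 0 <= t <= T -> L1 mu (w t) /\ (forall x, ~ Om x -> w t x = 0),
      forall t (eta : R), 0 <= t <= T -> 0 < eta -> exists2 D : R, 0 < D &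
        forall s, 0 <= s <= T -> `|s - t| < D -> \int[mu]_x `|w s x - w t x| <= eta,
      {ae lam, forall t, 0 < t < T -> {ae mu, forall x, w t x = u (x, t)}} &
      forall s t, 0 <= s -> s <= t -> t <= T -> \int[mu]_x `|w t x| <=
        \int[mu]_x `|w s x| + \int[m]_z (`|f z| * \1_(`]s, t]) z.2)].
Proof.
have [jn Hjn] := fast_subsequence; have GF := good_time_full Hjn.
have H1 v p : test_closure v p -> L1 mu v by case.
have H3 v p : test_closure v p -> forall i, measurable_fun setT (p i) by case.
have H4 v p : test_closure v p -> forall i, L1 mu (fun x => p i x ^+ 2) by case.
have G1 t : good_time jn t -> 0 < t < T by case.
have G2 t : good_time jn t -> test_closure (fun x => u (x, t)) (fun i x => g i (x, t)) by case.
have [w [h1 h2 h3 h4]] := @L1_continuous_representative _ X R mu n Om T nu mOm fOm nu0 u drift g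
  u_out Iu L1_drift Ig Ig2 test_closure H1 H3 H4 test_closure_sub (good_time jn) G1 GF G2 (phi_tested_equation Hjn) f If phi_tested_drift T0.
exists w; split => //; apply: (@filterS _ _ (ae_filter_ringOfSetsType lam) _ _ _ GF) => t Gt tT.
by apply: h3; exact: Gt.
Qed.

End evolution.

(** * Test functions on space and on space-time *)

Section test_functions.
Context {R : realType} {V : normedModType R}.
Implicit Types (D K : set V) (f g : V -> R).

Definition supp f := closure [set x | f x != 0].

Lemma supp_out f x : ~ supp f x -> f x = 0.
Proof. by move=> nx; apply/eqP/negPn/negP => fx; apply: nx; exact: subset_closure. Qed.

Lemma test_functionI D K f : smooth f -> compact K -> K `<=` D ->
  (forall x, ~ K x -> f x = 0) -> test_function D f.
Proof.
move=> sf cK KD fK.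
have clK : closed K by apply: compact_closed cK; exact: norm_hausdorff.
have sK : supp f `<=` K.
  rewrite ((closure_id K).1 clK); apply: closure_subset => x /= fx.
  by apply: contrapT => /fK /eqP; rewrite (negPf fx).
split => //; last exact: subset_trans sK KD.
by apply: (subclosed_compact _ cK sK); exact: closed_closure.
Qed.

(** The function vanishes near x. *)
Lemma derive_supp f v x : ~ supp f x -> 'D_v f x = 0.
Proof.
move=> nx; have : \forall y \near x, f y = cst 0 y.
  have : open_nbhs x (~` supp f) by split => //; apply: closed_openC; exact: closed_closure.
  by move=> /open_nbhs_nbhs; apply: filterS => y; exact: supp_out.
by move=> /(near_eq_derive v) ->; rewrite derive_cst.
Qed.

Lemma bounded_supp K (h : V -> R) : continuous h -> compact K ->
  (forall x, ~ K x -> h x = 0) -> exists2 C : R, 0 <= C & forall x, `|h x| <= C.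
Proof.
move=> ch cK hK.
have : compact (h @` K) by apply: continuous_compact => //; exact: continuous_subspaceT.
move=> /compact_bounded /pinfty_ex_gt0[C C0 HC]; exists C; first exact: ltW.
move=> x; have [Kx|/hK ->] := pselect (K x); last by rewrite normr0 ltW.
by apply: HC; exists x.
Qed.

Lemma test_functionB D f g : test_function D f -> test_function D g ->
  test_function D (fun x => f x - g x).
Proof.
move=> [sf cf fD] [sg cg gD]; apply: (@test_functionI _ (supp f `|` supp g)).
- exact: smoothBf.
- exact: compactU.
- by move=> x [/fD|/gD].
- by move=> x /not_orP[/supp_out -> /supp_out ->]; rewrite subr0.
Qed.

Lemma test_function_comp D (F : R -> R) f : smooth F -> F 0 = 0 -> test_function D f ->
  test_function D (fun x => F (f x)).
Proof.
move=> sF F0 [sf cf fD]; apply: (@test_functionI _ (supp f)); [exact: smooth_comp|exact: cf|exact: fD|].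
by move=> x /supp_out ->.
Qed.

End test_functions.

Section space_time.
Context {R : realType} {n : nat}.
Local Notation X := 'rV[R]_n.
Local Notation Z := (X * R)%type.
Implicit Types (c : R -> R) (p : X -> R).

Let L1_ : {linear Z -> X} := [the {linear Z -> X} of fst].
Let L2_ : {linear Z -> R} := [the {linear Z -> R} of snd].

Let smooth_fst p : smooth p -> smooth (fun z : Z => p z.1).
Proof. by apply: (@smooth_linear R X Z L1_ p) => z; exact: cvg_fst. Qed.

Let smooth_snd c : smooth c -> smooth (fun z : Z => c z.2).
Proof. by apply: (@smooth_linear R R Z L2_ c) => z; exact: cvg_snd. Qed.

Definition tensor c p (z : Z) := c z.2 * p z.1.

Lemma smooth_tensor c p : smooth c -> smooth p -> smooth (tensor c p).
Proof. by move=> sc sp; apply: smoothMf; [exact: smooth_snd|exact: smooth_fst]. Qed.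

Lemma derive_tensor c p z v : smooth c -> smooth p ->
  'D_v (tensor c p) z = c z.2 * 'D_(v.1) p z.1 + p z.1 * 'D_(v.2) c z.2.
Proof.
move=> sc sp.
have dc := @smooth_derivable _ _ (fun z : Z => c z.2) z v (smooth_snd sc).
have dp := @smooth_derivable _ _ (fun z : Z => p z.1) z v (smooth_fst sp).
have := deriveM dc dp.
rewrite (@derive_linear R X Z L1_ p z v) (@derive_linear R R Z L2_ c z v).
exact.
Qed.

Lemma test_tensor D (s t : R) c p : smooth c -> s <= t ->
  (forall r, r \notin `[s, t] -> c r = 0) -> test_function D p ->
  forall E : set Z, D `*` `[s, t]%classic `<=` E -> test_function E (tensor c p).
Proof.
move=> sc st c0 [sp cp pD] E DE.
apply: (@test_functionI _ _ _ (supp p `*` `[s, t]%classic)).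
- exact: smooth_tensor.
- by apply: compact_setX => //; exact: segment_compact.
- by move=> [x r] [/= px rst]; apply: DE; split => //; exact: pD.
- move=> [x r] /= nxr; rewrite /tensor /=.
  have [xp|/supp_out ->] := pselect (supp p x); last by rewrite mulr0.
  rewrite c0 ?mul0r//; apply/negP => rst; apply: nxr; split => //.
Qed.

End space_time.

(** * Pairs of a test function and its gradient *)

Section test_pairs.
Context {R : realType} {n : nat}.
Local Notation X := 'rV[R]_n.
Variable Om : set X.
Implicit Types (p : X -> R) (q : 'I_n -> X -> R).

Definition test_pair p q := test_function Om p /\ forall i x, q i x = grad p x 0 i.

Lemma test_pairE p q : test_pair p q -> forall i, q i = fun x => 'D_(delta_mx 0 i) p x.
Proof. by move=> [_ qE] i; apply/funext => x; rewrite qE mxE. Qed.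

Let smooth_q p q i : test_pair p q -> smooth (q i).
Proof. by move=> pq; rewrite (test_pairE pq); apply: smooth_D; case: pq => -[]. Qed.

Lemma test_pair_meas p q : test_pair p q ->
  measurable_fun setT p /\ forall i, measurable_fun setT (q i).
Proof.
move=> pq; split => [|i]; apply: continuous_measurable_rV => x.
  by apply: (@smooth_cont _ _ p); case: pq => -[].
exact: (@smooth_cont _ _ _ (smooth_q i pq)).
Qed.

Lemma test_pair_out p q : test_pair p q -> forall x, ~ Om x -> p x = 0 /\ forall i, q i x = 0.
Proof.
move=> pq; have [[_ _ sO] _] := pq => x nO.
have ns : ~ supp p x by move=> /sO.
split=> [|i]; first exact: supp_out.
by rewrite (test_pairE pq); exact: derive_supp.
Qed.

Lemma test_pair_bd p q : test_pair p q -> exists C, forall x, `|p x| <= C /\ forall i, `|q i x| <= C.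
Proof.
move=> pq; have [[sp cp _] _] := pq.
have [C C0 HC] := bounded_supp (smooth_cont sp) cp (@supp_out _ _ p).
have /choice[D HD] : forall i, exists D : R, 0 <= D /\ forall x, `|q i x| <= D.
  move=> i; have [D D0 HD] : exists2 D : R, 0 <= D & forall x, `|q i x| <= D.
    apply: bounded_supp cp _; first exact: (smooth_cont (smooth_q i pq)).
    by move=> x; rewrite (test_pairE pq); exact: derive_supp.
  by exists D.
exists (C + \sum_i D i) => x; split.
  by rewrite (le_trans (HC x))// lerDl sumr_ge0// => i _; exact: (HD i).1.
move=> i; apply: le_trans ((HD i).2 x) _.
rewrite (bigD1 i)//= addrCA lerDl addr_ge0// sumr_ge0// => j _; exact: (HD j).1.
Qed.

Lemma test_pair_sub p q p' q' : test_pair p q -> test_pair p' q' ->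
  test_pair (fun x => p x - p' x) (fun i x => q i x - q' i x).
Proof.
move=> pq pq'; have [tp _] := pq; have [tp' _] := pq'; split; first exact: test_functionB.
have [sp _ _] := tp; have [sp' _ _] := tp'.
move=> i x; rewrite (test_pairE pq) (test_pairE pq') mxE.
by rewrite deriveB//; [exact: smooth_derivable|exact: smooth_derivable].
Qed.

Lemma test_pair_comp (F F' : R -> R) p q : smooth F -> F 0 = 0 ->
  (forall s : R, is_derive s 1 F (F' s)) -> test_pair p q ->
  test_pair (fun x => F (p x)) (fun i x => F' (p x) * q i x).
Proof.
move=> sF F0 dF pq; have [tp _] := pq; split; first exact: test_function_comp.
have [sp _ _] := tp.
move=> i x; rewrite (test_pairE pq) mxE derive_dir_comp; last exact: smooth_derivable.
  by rewrite (@derive_val _ _ _ _ _ _ _ (dF (p x))).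
by have [] := dF (p x).
Qed.

Lemma test_pair_phi (e : R) p q : 0 < e -> test_pair p q ->
  test_pair (fun x => phi e (p x)) (fun i x => dphi e (p x) * q i x).
Proof.
move=> e0; apply: test_pair_comp; [exact: smooth_phi|exact: phi0|].
by move=> s; exact: is_derive_phi.
Qed.

Lemma test_pair_Phi (e : R) p q : 0 < e -> test_pair p q ->
  test_pair (fun x => Phi e (p x)) (fun i x => phi e (p x) * q i x).
Proof.
move=> e0; apply: test_pair_comp; [exact: smooth_Phi|exact: Phi0|].
by move=> s; exact: is_derive_Phi.
Qed.

Lemma dt_tensor (c : R -> R) p z : smooth c -> smooth p ->
  dt (tensor c p) z = 'D_1 c z.2 * p z.1.
Proof. by move=> sc sp; rewrite /dt derive_tensor//= derive0 mulr0 add0r mulrC. Qed.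

Lemma gradx_tensor (c : R -> R) p q z i : smooth c -> test_pair p q ->
  gradx (tensor c p) z 0 i = c z.2 * q i z.1.
Proof.
move=> sc pq; have [[sp _ _] _] := pq.
by rewrite mxE derive_tensor//= derive0 mulr0 addr0 (test_pairE pq).
Qed.

End test_pairs.

(** * The slices of a weak solution *)

Lemma L1_of_L2 d (T : measurableType d) (R : realType) (mu : {measure set T -> \bar R})
  (D : set T) (h : T -> R) : measurable D -> (mu D < +oo)%E -> measurable_fun setT h ->
  (forall x, ~ D x -> h x = 0) -> L1 mu (fun x => h x ^+ 2) -> L1 mu h.
Proof.
move=> mD fD mh h0 Ih2.
have I1 : L1 mu \1_D by exact: L1_indicator.
apply: (L1_le mh (L1D I1 Ih2)) => x; rewrite indicE.
case: (boolP (x \in D)) => [_|/negP xD].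
  rewrite -(real_normK (num_real (h x))); set a := `|h x|.
  rewrite -subr_ge0 (_ : true%:R = 1 :> R)// (_ : _ - _ = (a - 1 / 2) ^+ 2 + 3 / 4); last by field.
  by rewrite addr_ge0 ?sqr_ge0.
rewrite h0 ?normr0 ?expr0n ?addr0// => Dx; by apply: xD; rewrite inE.
Qed.

Lemma cvg_sq0 (R : realType) (a : nat -> R) (l : R) :
  (fun j => (a j - l) ^+ 2) @ \oo --> (0 : R) -> a @ \oo --> l.
Proof.
move=> h; apply/cvgrPdist_le => e e0.
have e2 : 0 < e ^+ 2 by rewrite exprn_gt0.
have /cvgr0Pnorm_le /(_ _ e2) := h; apply: filterS => j.
by rewrite normrX distrC ler_pXn2r ?nnegrE// ltW.
Qed.

Section slices.
Context {R : realType} {n : nat}.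
Local Notation X := 'rV[R]_n.
Variables (Om : set X).
Hypotheses (oOm : open Om) (bOm : bounded_set Om).
Local Notation mu := (lebesgue_rV n : {sigma_finite_measure set X -> \bar R}).

Let mOm : measurable Om. Proof. exact: open_measurable_rV. Qed.
Let fOm : (mu Om < +oo)%E. Proof. exact: bounded_rV_lty. Qed.

Let patch_out (h : X -> R) x : ~ Om x -> (h \_ Om) x = 0.
Proof. by move=> nO; rewrite patchE memNset. Qed.

Let Lp2 (h : X -> R) : Lp_on mu 2 Om h ->
  measurable_fun setT (h \_ Om) /\ L1 mu (fun x => (h \_ Om) x ^+ 2).
Proof.
move=> L2h; split; last exact: Lfun2_integrable_sqr.
by move: L2h; rewrite /Lp_on inE => /andP[/[!inE]].
Qed.

(** Approximations within 2^-j in W^1_2 converge almost everywhere. *)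
Lemma W12_0_test_closure (v : X -> R) (g : X -> 'rV[R]_n) : W12_0 Om v g ->
  test_closure mu Om (test_pair Om) (v \_ Om) (fun i => (fun x => g x 0 i) \_ Om).
Proof.
move=> [[/Lp2[mv Iv2] Lg _] ap].
have mg i := (Lp2 (Lg i)).1; have Ig2 i := (Lp2 (Lg i)).2.
have Iv : L1 mu (v \_ Om) by apply: (L1_of_L2 mOm fOm mv) => // x; exact: patch_out.
have /choice[s Hs] : forall j : nat, exists p, test_function Om p /\
    (W12_sqnorm Om (v \- p)%R (g \- grad p)%R < (2^-1 ^+ j)%:E)%E.
  move=> j; have [|p tp Hp] := ap (2^-1 ^+ j); first by rewrite exprn_gt0.
  by exists p.
pose q j i x := grad (s j) x 0 i.
have tests j : test_pair Om (s j) (q j) by split => //; exact: (Hs j).1.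
have ms j := (test_pair_meas (tests j)).1; have mq j i := (test_pair_meas (tests j)).2 i.
have Ibd (h : X -> R) (C : R) : measurable_fun setT h -> (forall x, `|h x| <= C) ->
    (forall x, ~ Om x -> h x = 0) -> L1 mu (fun x => h x ^+ 2).
  move=> mh hC h0.
  have I1 : L1 mu \1_Om by exact: L1_indicator.
  apply: (L1_le (measurable_funX 2 mh) (L1Z (C ^+ 2) I1)) => x; rewrite indicE.
  case: (boolP (x \in Om)) => [_|/negP xO].
    by rewrite mulr1 normrX lerXn2r ?nnegrE ?normr_ge0//; exact: le_trans (normr_ge0 _) (hC x).
  by rewrite mulr0 h0 ?expr0n ?normr0// => Ox; apply: xO; rewrite inE.
have Is2 j : L1 mu (fun x => s j x ^+ 2).
  have [C HC] := test_pair_bd (tests j).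
  by apply: (Ibd _ C) => // x => [|nO]; [exact: (HC x).1|exact: (test_pair_out (tests j) nO).1].
have Iq2 j i : L1 mu (fun x => q j i x ^+ 2).
  have [C HC] := test_pair_bd (tests j).
  by apply: (Ibd _ C) => // x => [|nO]; [exact: (HC x).2|exact: (test_pair_out (tests j) nO).2].
pose D0 j x := (s j x - (v \_ Om) x) ^+ 2.
pose D1 j i x := (q j i x - ((fun x => g x 0 i) \_ Om) x) ^+ 2.
have ID0 j : L1 mu (D0 j) by exact: L1_sqB.
have ID1 j i : L1 mu (D1 j i) by exact: L1_sqB.
pose h j x := D0 j x + \sum_i D1 j i x.
have Ih j : L1 mu (h j) by apply: L1D => //; exact: L1_sum.
have Rh j : \int[mu]_x h j x <= 2^-1 ^+ j.
  have := (Hs j).2; rewrite /W12_sqnorm integral_mkcond.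
  have -> : (\int[mu]_x (((fun x => ((v \- s j) x ^+ 2 + dotrv ((g \- grad (s j)) x) ((g \- grad (s j)) x))%:E) \_ Om) x) =
     \int[mu]_x (h j x)%:E)%E.
    apply: eq_integral => x _; rewrite patchE; case: ifPn => [xO|/negP xO].
      congr (_%:E); rewrite /h /D0 patchE xO /= -sqrrN opprB; congr (_ + _).
      by apply: eq_bigr => i _; rewrite /D1 patchE xO /q !mxE; ring.
    have nO : ~ Om x by move=> Ox; apply: xO; rewrite inE.
    rewrite -[LHS]/(0%:E); congr (_%:E); apply/esym.
    rewrite /h /D0 patch_out// (test_pair_out (tests j) nO).1 subr0 expr0n add0r big1// => i _.
    by rewrite /D1 patch_out// (test_pair_out (tests j) nO).2 subr0 expr0n.
  by rewrite -EFin_intR// lte_fin => /ltW.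
have D00 j x : 0 <= D0 j x by exact: sqr_ge0.
have D10 j i x : 0 <= D1 j i x by exact: sqr_ge0.
split => //; first exact: patch_out.
exists s, q; split => //.
  have RD0 j : \int[mu]_x D0 j x <= 1 * 2^-1 ^+ j.
    rewrite mul1r; apply: le_trans (Rh j); apply: intR_le => // x.
    by rewrite /h lerDl sumr_ge0.
  have := @ae_series0 _ _ _ mu D0 1 ID0 D00 RD0.
  by apply: filterS => x; exact: cvg_sq0.
move=> i.
have c : (fun j => (2^-1 : R) ^+ j) @ \oo --> (0 : R).
  by apply: cvg_expr; rewrite ger0_norm ?invr_ge0// invf_lt1// ltr1n.
apply: (squeeze_cvgr _ (cvg_cst 0) c); apply: nearW => j.
rewrite intR_ge0 => [/=|x]; last exact: sqr_ge0.
apply: le_trans (Rh j); apply: intR_le => // [|x]; first exact: ID1.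
by rewrite /h (bigD1 i)//= addrCA lerDl addr_ge0// sumr_ge0.
Qed.

End slices.

(** * The weak formulation with product tests *)

Section parabolic.
Context {R : realType} {n : nat}.
Local Notation X := 'rV[R]_n.
Local Notation lam := (@lebesgue_measure R).
Local Notation Y := (X * measurableTypeR R)%type.
Variables (Om : set X) (T nu : R).
Hypotheses (oOm : open Om) (bOm : bounded_set Om) (T0 : 0 < T).
Local Notation mu := (lebesgue_rV n : {sigma_finite_measure set X -> \bar R}).
Local Notation m := (mu \x lam)%E.
Local Notation Q := (QT Om T : set Y).

Let mOm : measurable Om. Proof. exact: open_measurable_rV. Qed.
Let fOm : (mu Om < +oo)%E. Proof. exact: bounded_rV_lty. Qed.

Let mQ : measurable Q. Proof. by apply: measurableX => //; exact: measurable_itv. Qed.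

Lemma QT_lty : (m Q < +oo)%E.
Proof.
rewrite (@product_measure1E _ _ _ _ _ mu lam Om `]0, T[%classic mOm (measurable_itv _)).
have h : (lam `]0%R, T[%classic < +oo)%E.
  by rewrite lebesgue_measure_itv/=; case: ifP => // _; rewrite -EFinB ltry.
by apply: lte_mul_pinfty => //; rewrite ge0_fin_numE.
Qed.

Let Qpatch_out (h : Y -> R) z : ~ Q z -> (h \_ Q) z = 0.
Proof. by move=> nO; rewrite patchE memNset. Qed.

Lemma intR_restrict d (S : measurableType d) (P : {measure set S -> \bar R}) (D : set S) (h k : S -> R) :
  (forall x, D x -> h x = k x) -> (forall x, ~ D x -> k x = 0) ->
  \int[P]_(x in D) h x = \int[P]_x k x.
Proof.
move=> hk k0; rewrite Rintegral_mkcond; apply: eq_Rintegral => x _; rewrite patchE.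
case: ifPn => [|/negP xD]; first by rewrite inE; exact: hk.
by rewrite k0// => Dx; apply: xD; rewrite inE.
Qed.

Lemma fubini_time_factor (c : R -> R) (C : R) (h : Y -> R) : measurable_fun setT (c : measurableTypeR R -> R) ->
  (forall r, `|c r| <= C) -> L1 m h ->
  L1 m (fun z => c z.2 * h z) /\
  \int[m]_z (c z.2 * h z) = \int[lam]_r (c r * \int[mu]_x h (x, r)).
Proof.
move=> mc cC Ih.
have mc2 : measurable_fun setT (fun z : Y => c z.2) by exact: measurableT_comp measurable_snd.
have Ich : L1 m (fun z => c z.2 * h z).
  have := @L1M_bd _ _ R m C _ _ mc2 (fun z => cC z.2) Ih.
  by congr (L1 m _); apply/funext => z; exact: mulrC.
split => //; rewrite -(intR_fubini2 Ich); apply: intR_ae_eq.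
- exact: L1_meas (L1_intR2 Ich).
- by apply: measurable_funM => //; exact: L1_meas (L1_intR2 Ih).
by apply: filterS (ae_L1_2 Ih) => r Ir; rewrite -intRZ.
Qed.

Lemma dcutoff_meas (a s t : R) : measurable_fun setT (dcutoff a s t : measurableTypeR R -> R).
Proof.
have -> : dcutoff a s t = (fun r => 'D_1 (cutoff a s t) r).
  by apply/funext => r; rewrite (@derive_val _ _ _ _ _ _ _ (is_derive_cutoff a s t r)).
apply: cont_meas => r.
exact: (@smooth_cont R R _ (@smooth_D R R (cutoff a s t) 1 (smooth_cutoff a s t)) r).
Qed.

Lemma dcutoff_bd (a s t : R) : exists C, forall r, `|dcutoff a s t r| <= C.
Proof.
have [C C0 HC] := @dstep_bounded R; exists (`|a| * C + `|a| * C) => r.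
by apply: le_trans (ler_normB _ _) _; apply: lerD; rewrite (normrM a); apply: ler_wpM2l.
Qed.

Section equation.
Variables (b g : Y -> X) (u f : Y -> R).
Let ut := u \_ Q.
Let ft := f \_ Q.
Let bt i := (fun z => b z 0 i) \_ Q.
Let gt i := (fun z => g z 0 i) \_ Q.
Hypotheses (Iu : L1 m ut) (If : L1 m ft).
Hypotheses (Ig : forall i, L1 m (gt i)) (Ig2 : forall i, L1 m (fun z => gt i z ^+ 2)).
Hypotheses (Ib : forall i, L1 m (bt i)) (Ib2 : forall i, L1 m (fun z => bt i z ^+ 2)).

Let window (t : R) : t < T -> exists N, forall j, (N <= j)%N -> t + j.+1%:R^-1 < T.
Proof.
move=> tT; have : 0 < T - t by rewrite subr_gt0.
move=> /ltr_add_invr [N]; rewrite add0r ltrBrDl => hN; exists N => j Nj.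
by apply: le_lt_trans hN; rewrite lerD2l lef_pV2 ?posrE// ler_nat.
Qed.

Let tensor_cut (E : set Y) p q (s t : R) j : test_pair Om p q -> s < t ->
  Om `*` `[s, t + j.+1%:R^-1]%classic `<=` E ->
  test_function (E : set (X * R)) (tensor (cutoff j.+1%:R s t) p).
Proof.
move=> [tp _] st sE; have j0 : 0 < (j.+1%:R : R) by [].
have sj : s <= t + j.+1%:R^-1 by rewrite (le_trans (ltW st))// lerDl invr_ge0.
apply: (@test_tensor _ _ Om s (t + j.+1%:R^-1)) => //; first exact: smooth_cutoff.
move=> r; rewrite in_itv/= negb_and -!ltNge => /orP h.
apply: cutoff_out => //; first exact: ltW.
by case: h => [/ltW|/ltW]; [left|right].
Qed.

Let kt := drift ft bt gt.

Let dotE (z : Y) : Q z -> dotrv (b z) (g z) = \sum_i bt i z * gt i z.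
Proof. by move=> Qz; apply: eq_bigr => i _; rewrite /bt /gt !patchE mem_set. Qed.

Let pair_fst (h : Y -> R) (p : X -> R) (C : R) : L1 m h -> measurable_fun setT p ->
  (forall x, `|p x| <= C) -> L1 m (fun z => h z * p z.1).
Proof.
move=> Ih mp pC; have mp2 : measurable_fun setT (fun z : Y => p z.1) by exact: measurableT_comp measurable_fst.
exact: (@L1M_bd _ _ R m C _ _ mp2 (fun z => pC z.1) Ih).
Qed.

Hypothesis weak_eq : forall eta, test_function (Om `*` `]-oo, T[) eta -> (forall x, eta (x, 0) = 0) ->
  \int[m]_(z in Q) (- u z * dt eta z + nu * dotrv (g z) (gradx eta z)) +
  \int[m]_(z in Q) (dotrv (b z) (g z) * eta z) = \int[m]_(z in Q) (f z * eta z).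
Hypothesis hdiv : div_le0 Om T b.

(** The weak formulation with the test cutoff (t) p (x), in which the initial datum
    does not enter. *)
Lemma weak_cut_of p q : test_pair Om p q -> forall s t : R, 0 < s -> s < t -> t < T ->
  exists N, forall j, (N <= j)%N ->
    \int[lam]_r (dcutoff j.+1%:R s t r * \int[mu]_x (ut (x, r) * p x)) =
    \int[lam]_r (cutoff j.+1%:R s t r *
      \int[mu]_x (kt (x, r) * p x + nu * \sum_i gt i (x, r) * q i x)).
Proof.
move=> pq s t s0 st tT; have [N HN] := window tT; exists N => j /HN tjT.
have [mp mq] := test_pair_meas pq; have [C HC] := test_pair_bd pq.
have [tp qE] := pq; have [sp _ _] := tp.
set c := cutoff j.+1%:R s t; set c' := dcutoff j.+1%:R s t.
have j0 : 0 < (j.+1%:R : R) by [].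
have sc : smooth c by exact: smooth_cutoff.
have Dc r : 'D_1 c r = c' r.
  by rewrite (@derive_val _ _ _ _ _ _ _ (is_derive_cutoff j.+1%:R s t r)).
have teta : test_function (Om `*` `]-oo, T[ : set (X * R)) (tensor c p).
  apply: (tensor_cut pq st) => -[x r] [/= Ox]; rewrite !in_itv/= => /andP[_ rt].
  by split => //; exact: le_lt_trans rt tjT.
have c00 : c 0 = 0 by apply: cutoff_out => //; [exact: ltW|left; exact: ltW].
have := weak_eq teta (fun x => etrans (congr1 (fun y => y * p x) c00) (mul0r _)).
have Ik : L1 m kt by apply: L1_drift.
have I1 := pair_fst Ik mp (fun x => (HC x).1).
have I2 i := pair_fst (Ig i) (mq i) (fun x => (HC x).2 i).
have I3 := pair_fst Iu mp (fun x => (HC x).1).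
have I4 := pair_fst If mp (fun x => (HC x).1).
have I5 : L1 m (fun z => (\sum_i bt i z * gt i z) * p z.1).
  apply: pair_fst mp (fun x => (HC x).1); apply: L1_sum => i.
  by apply: L1M_sq => //; [exact: L1_meas (Ib i)|exact: L1_meas (Ig i)].
have mc : measurable_fun setT (c : measurableTypeR R -> R) by exact: meas_cutoff.
have mc' : measurable_fun setT (c' : measurableTypeR R -> R) by exact: dcutoff_meas.
have cC r : `|c r| <= 1 by apply: cutoff_norm => //; exact: ltW.
have [C' cC'] := dcutoff_bd j.+1%:R s t.
have IG : L1 m (fun z => nu * \sum_i gt i z * q i z.1) by apply/L1Z/L1_sum.
have [J1 F1] := fubini_time_factor mc' cC' I3.
have [J2 F2] := fubini_time_factor mc cC (L1D I1 IG).
have [J3 _] := fubini_time_factor mc cC IG.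
have [J4 _] := fubini_time_factor mc cC I4.
have [J5 _] := fubini_time_factor mc cC I5.
have [J6 _] := fubini_time_factor mc cC I1.
rewrite -F1 -F2.
have E1 : \int[m]_(z in Q) (- u z * dt (tensor c p) z + nu * dotrv (g z) (gradx (tensor c p) z)) =
    \int[m]_z (c z.2 * (nu * \sum_i gt i z * q i z.1) - c' z.2 * (ut z * p z.1)).
  apply: intR_restrict => z => [Qz|nQ]; last first.
    rewrite /ut Qpatch_out// mul0r mulr0 subr0 big1 ?mulr0// => i _.
    by rewrite /gt Qpatch_out// mul0r.
  rewrite /dotrv (dt_tensor _ sc sp) /ut patchE mem_set// Dc.
  rewrite [RHS]addrC mulNr; congr (- _ + _); first by rewrite mulrCA.
  rewrite mulrCA; congr (_ * _); rewrite mulr_sumr; apply: eq_bigr => i _.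
  by rewrite (gradx_tensor _ _ sc pq) /gt patchE mem_set// mulrCA.
have E2 : \int[m]_(z in Q) (dotrv (b z) (g z) * tensor c p z) =
    \int[m]_z (c z.2 * ((\sum_i bt i z * gt i z) * p z.1)).
  apply: intR_restrict => z => [Qz|nQ]; first by rewrite dotE// /tensor mulrCA.
  by rewrite big1 ?mul0r ?mulr0// => i _; rewrite /gt Qpatch_out// mulr0.
have E3 : \int[m]_(z in Q) (f z * tensor c p z) = \int[m]_z (c z.2 * (ft z * p z.1)).
  apply: intR_restrict => z => [Qz|nQ]; first by rewrite /ft patchE mem_set// /tensor mulrCA.
  by rewrite /ft Qpatch_out// mul0r mulr0.
rewrite E1 E2 E3.
rewrite (intRB J3 J1) => H; apply/eqP; rewrite -subr_eq0; apply/eqP.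
have E : \int[m]_z (c z.2 * (kt z * p z.1 + nu * \sum_i gt i z * q i z.1)) =
  \int[m]_z (c z.2 * ((\sum_i bt i z * gt i z) * p z.1)) - \int[m]_z (c z.2 * (ft z * p z.1)) +
  \int[m]_z (c z.2 * (nu * \sum_i gt i z * q i z.1)).
  rewrite -(intRB J5 J4) -(intRD (L1B J5 J4) J3); apply: eq_Rintegral => z _.
  by rewrite mulrDr; congr (_ + _); rewrite -mulrBr; congr (_ * _); rewrite -mulrBl.
rewrite E -H; set P1 := \int[m]_z _; set P2 := \int[m]_z _; set P3 := \int[m]_z _.
ring.
Qed.

Lemma div_cut_of p q : test_pair Om p q -> (forall x, 0 <= p x) ->
  forall s t : R, 0 < s -> s < t -> t < T ->
  exists N, forall j, (N <= j)%N ->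
    0 <= \int[lam]_r (cutoff j.+1%:R s t r * \int[mu]_x (\sum_i bt i (x, r) * q i x)).
Proof.
move=> pq p0 s t s0 st tT; have [N HN] := window tT; exists N => j /HN tjT.
have [mp mq] := test_pair_meas pq; have [C HC] := test_pair_bd pq.
set c := cutoff j.+1%:R s t.
have j0 : 0 < (j.+1%:R : R) by [].
have sc : smooth c by exact: smooth_cutoff.
have teta : test_function (QT Om T : set (X * R)) (tensor c p).
  apply: (tensor_cut pq st) => -[x r] [/= Ox]; rewrite !in_itv/= => /andP[sr rt].
  by split => //=; rewrite in_itv/= (lt_le_trans s0 sr) (le_lt_trans rt tjT).
have eta0 z : 0 <= tensor c p z by rewrite mulr_ge0// cutoff_ge0// ltW.
have mc : measurable_fun setT (c : measurableTypeR R -> R) by exact: meas_cutoff.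
have cC r : `|c r| <= 1 by apply: cutoff_norm => //; exact: ltW.
have I1 : L1 m (fun z => \sum_i bt i z * q i z.1).
  by apply: L1_sum => i; exact: (pair_fst (Ib i) (mq i) (fun x => (HC x).2 i)).
have [_ <-] := fubini_time_factor mc cC I1.
have := hdiv teta eta0.
have -> : \int[lebesgue_xt]_(z in QT Om T) dotrv (b z) (gradx (tensor c p) z) =
    \int[m]_z (c z.2 * \sum_i bt i z * q i z.1).
  apply: (@intR_restrict _ _ m) => z => [Qz|nQ].
    rewrite mulr_sumr; apply: eq_bigr => i _.
    by rewrite (gradx_tensor _ _ sc pq) /bt patchE mem_set// mulrCA.
  by rewrite big1 ?mulr0// => i _; rewrite /bt Qpatch_out// mul0r.
exact.
Qed.

End equation.
End parabolic.

(** * The parabolic problem *)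

Section data.
Context {R : realType} {n : nat}.
Local Notation X := 'rV[R]_n.
Local Notation lam := (@lebesgue_measure R).
Local Notation Y := (X * measurableTypeR R)%type.
Variables (Om : set X) (T : R).
Hypotheses (oOm : open Om) (bOm : bounded_set Om).
Local Notation mu := (lebesgue_rV n : {sigma_finite_measure set X -> \bar R}).
Local Notation m := (mu \x lam)%E.
Local Notation Q := (QT Om T : set Y).

Let mOm : measurable Om. Proof. exact: open_measurable_rV. Qed.
Let mQ : measurable Q. Proof. by apply: measurableX => //; exact: measurable_itv. Qed.

Let Qpatch_out (h : Y -> R) z : ~ Q z -> (h \_ Q) z = 0.
Proof. by move=> nO; rewrite patchE memNset. Qed.

Let meas_patch (h : Y -> R) : measurable_fun Q h -> measurable_fun setT (h \_ Q).
Proof. by move=> mh; exact: (measurable_restrictT h mQ).1. Qed.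

Lemma QpatchE (h : Y -> R) (t : R) : 0 < t < T ->
  (fun x => (h \_ Q) (x, t)) = (fun x => h (x, t)) \_ Om.
Proof.
move=> tT; apply/funext => x; rewrite !patchE.
case: ifPn => [|/negP zQ]; first by rewrite inE => -[/= Ox _]; rewrite mem_set.
by rewrite memNset// => Ox; apply: zQ; rewrite inE; split => //=; rewrite in_itv.
Qed.

Lemma L1_QTP (h : Y -> R) : measurable_fun setT h -> (forall z, 0 <= h z) ->
  (\int[lam]_t \int[mu]_x (h (x, t))%:E < +oo)%E -> L1 m h.
Proof.
move=> mh h0 hoo; apply: L1P => //.
under eq_integral do rewrite ger0_norm//.
rewrite (@fubini_tonelli2 _ _ _ _ _ mu lam (fun z => (h z)%:E))//.
exact/measurable_EFinP.
Qed.

(** By Tonelli the integral over time of the squared W^1_2-norms of the slices is an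
    integral over the cylinder. *)
Lemma L2_W12_0_L2 (u : Y -> R) (g : Y -> X) : L2_W12_0 Om T u g ->
  [/\ measurable_fun setT (u \_ Q), forall i, measurable_fun setT ((fun z => g z 0 i) \_ Q),
      L1 m (fun z => (u \_ Q) z ^+ 2) & forall i, L1 m (fun z => ((fun z => g z 0 i) \_ Q) z ^+ 2)].
Proof.
move=> [mu_ mg _ fin].
have mut : measurable_fun setT (u \_ Q) by exact: meas_patch mu_.
have mgt i : measurable_fun setT ((fun z => g z 0 i) \_ Q) by exact: meas_patch (mg i).
pose F z := (u \_ Q) z ^+ 2 + \sum_i ((fun z => g z 0 i) \_ Q) z ^+ 2.
have mF : measurable_fun setT F.
  apply: measurable_funD; first exact: measurable_funX.
  by apply: measurable_sum => i; exact: measurable_funX.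
have F0 z : 0 <= F z by rewrite addr_ge0 ?sqr_ge0// sumr_ge0// => i _; exact: sqr_ge0.
have IF : L1 m F.
  apply: (L1_QTP mF F0); apply: le_lt_trans fin.
  rewrite [leRHS]integral_mkcond le_eqVlt; apply/orP; left; apply/eqP.
  apply: eq_integral => t _; rewrite patchE; case: ifPn => [|/negP tT].
    rewrite inE/= in_itv/= => tT; rewrite /W12_sqnorm [RHS]integral_mkcond.
    apply: eq_integral => x _; rewrite patchE /F.
    have uE := congr1 (fun h => h x) (QpatchE u tT).
    have gE i := congr1 (fun h => h x) (QpatchE (fun z => g z 0 i) tT).
    rewrite /= in uE gE; rewrite uE patchE; under eq_bigr do rewrite gE patchE.
    case: ifPn => xO; first by congr (_%:E).
    by rewrite -[RHS]/(0%:E) expr0n add0r big1// => i _; rewrite expr0n.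
  rewrite -[RHS]/(0%:E) -[RHS](integral0 mu setT); apply: eq_integral => x _.
  have nQ : ~ Q (x, t) by move=> [_ /= h]; apply: tT; rewrite inE.
  rewrite /F Qpatch_out// expr0n add0r big1// => i _.
  by rewrite Qpatch_out// expr0n.
split => // [|i].
  apply: (L1_le (measurable_funX 2 mut) IF) => z; rewrite ger0_norm ?sqr_ge0//.
  by rewrite /F lerDl sumr_ge0// => i _; exact: sqr_ge0.
apply: (L1_le (measurable_funX 2 (mgt i)) IF) => z; rewrite ger0_norm ?sqr_ge0//.
rewrite /F (bigD1 i)//= addrCA lerDl addr_ge0 ?sqr_ge0// sumr_ge0// => j _; exact: sqr_ge0.
Qed.

Lemma integral_window (f : Y -> R) (t1 t2 : R) : L1 m (f \_ Q) -> 0 <= t1 -> t2 <= T ->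
  ((\int[m]_z (`|(f \_ Q) z| * \1_(`]t1, t2]) z.2))%:E =
  \int[lam]_(t in `]t1, t2[) \int[mu]_(x in Om) `|f (x, t)|%:E)%E.
Proof.
move=> If t10 t2T.
pose ind (z : Y) : R := \1_(`]t1, t2[) z.2.
have mind' : measurable_fun setT ind.
  by apply: (measurableT_comp _ measurable_snd); exact: measurable_indic.
have bind z : `|ind z| <= 1 by rewrite /ind indicE ger0_norm ?ler0n// lern1 leq_b1.
have Ih : L1 m (fun z => `|(f \_ Q) z| * ind z).
  exact: (@L1M_bd _ _ R m 1 _ _ mind' bind (L1_abs If)).
have nt := ae_neq t2.
have -> : \int[m]_z (`|(f \_ Q) z| * \1_(`]t1, t2]) z.2) = \int[m]_z (`|(f \_ Q) z| * ind z).
  apply: intR_ae_eq; [exact: L1_meas (L1_window t1 t2 (L1_abs If))|exact: L1_meas Ih|].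
  have := @ae_snd _ _ R mu _ nt; apply: filterS => z zt; congr (_ * _).
  by rewrite /ind !indicE !mem_setE !in_itv/= [z.2 < t2]lt_neqAle zt.
have h0 z : 0 <= `|(f \_ Q) z| * ind z by rewrite mulr_ge0// indicE ler0n.
have mE : measurable_fun setT (fun z => (`|(f \_ Q) z| * ind z)%:E).
  by apply/measurable_EFinP; exact: L1_meas Ih.
rewrite (EFin_intR Ih) (@fubini_tonelli2 _ _ _ _ _ mu lam _ mE (fun z => h0 z)).
rewrite [RHS]integral_mkcond; apply: eq_integral => t _; rewrite patchE /fubini_G.
case: ifPn => [|/negP tn].
  rewrite inE/= in_itv/= => /andP[h1 h2].
  have tT : 0 < t < T by rewrite (le_lt_trans t10 h1) (lt_le_trans h2 t2T).
  rewrite [RHS]integral_mkcond; apply: eq_integral => x _; rewrite patchE.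
  have fE := congr1 (fun h => h x) (QpatchE f tT); rewrite /= in fE.
  rewrite fE /ind indicE mem_set/= ?in_itv/= ?h1// mulr1 patchE.
  by case: ifPn => // _; rewrite normr0.
rewrite -[RHS]/(0%:E) -[RHS](integral0 mu setT); apply: eq_integral => x _.
by rewrite /ind indicE memNset/= ?mulr0// => h; apply: tn; rewrite inE.
Qed.

End data.

Theorem theorem1p2 (R : realType) (n : nat) (hn : (2 <= n)%N)
    (Omega : set 'rV[R]_n) (hOmega : bounded_lipschitz_domain Omega)
    (T : R) (hT : 0 < T) (nu : R) (hnu : 0 < nu)
    (b : 'rV[R]_n * R -> 'rV[R]_n)
    (hb : forall i, Lp_on lebesgue_xt 2 (QT Omega T) (fun z => b z 0 i))
    (u0 : 'rV[R]_n -> R) (hu0 : Lp_on (lebesgue_rV n) 2 Omega u0)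
    (f : 'rV[R]_n * R -> R) (hf : Lp_on lebesgue_xt 1 (QT Omega T) f)
    (hdiv : div_le0 Omega T b)
    (u : 'rV[R]_n * R -> R) (hu : weak_solution Omega T nu b u0 f u) :
  exists2 w : R -> 'rV[R]_n -> R, C_L1_representative Omega T u w &
    forall t1 t2 : R, 0 <= t1 -> t1 <= t2 -> t2 <= T ->
    (L1_norm Omega (w t2) <= L1_norm Omega (w t1) +
      \int[@lebesgue_measure R]_(t in `]t1, t2[)
        \int[lebesgue_rV n]_(x in Omega) `|f (x, t)|%:E)%E.
Proof.
have [oOm _ _ bOm _] := hOmega.
pose mu := (lebesgue_rV n : {sigma_finite_measure set 'rV[R]_n -> \bar R}).
pose lam := @lebesgue_measure R.
pose Q := QT Omega T : set ('rV[R]_n * measurableTypeR R).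
have mOm : measurable Omega by exact: open_measurable_rV.
have fOm : (mu Omega < +oo)%E by exact: bounded_rV_lty.
have mQ : measurable Q by apply: measurableX => //; exact: measurable_itv.
have fQ := QT_lty T oOm bOm.
have outQ (h : 'rV[R]_n * measurableTypeR R -> R) z : ~ Q z -> (h \_ Q) z = 0.
  by move=> nO; rewrite patchE memNset.
have [_ [g hg weq]] := hu.
have [mut mgt Iu2 Ig2] := L2_W12_0_L2 oOm hg.
pose ut := (u : 'rV[R]_n * measurableTypeR R -> R) \_ Q.
pose ft := (f : 'rV[R]_n * measurableTypeR R -> R) \_ Q.
pose bt i := (fun z : 'rV[R]_n * measurableTypeR R => b z 0 i) \_ Q.
pose gt i := (fun z : 'rV[R]_n * measurableTypeR R => g z 0 i) \_ Q.
have Iu : L1 (mu \x lam)%E ut by exact: (L1_of_L2 mQ fQ mut (outQ _) Iu2).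
have Ig i : L1 (mu \x lam)%E (gt i) by exact: (L1_of_L2 mQ fQ (mgt i) (outQ _) (Ig2 i)).
have Ib2 i : L1 (mu \x lam)%E (fun z => bt i z ^+ 2).
  exact: Lfun2_integrable_sqr (hb i).
have mbt i : measurable_fun setT (bt i).
  by have := hb i; rewrite /Lp_on inE => /andP[/[!inE]].
have Ib i : L1 (mu \x lam)%E (bt i) by exact: (L1_of_L2 mQ fQ (mbt i) (outQ _) (Ib2 i)).
have If : L1 (mu \x lam)%E ft by apply/Lfun1_integrable.
have u_out x t : ~ Omega x -> ut (x, t) = 0.
  by move=> nO; apply: outQ => -[].
(* for tests that vanish at t = 0 the initial datum disappears *)
have weak_eq eta : test_function (Omega `*` `]-oo, T[) eta -> (forall x, eta (x, 0) = 0) ->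
  \int[(mu \x lam)%E]_(z in Q) (- u z * dt eta z + nu * dotrv (g z) (gradx eta z)) +
  \int[(mu \x lam)%E]_(z in Q) (dotrv (b z) (g z) * eta z) = \int[(mu \x lam)%E]_(z in Q) (f z * eta z).
  move=> teta eta0; have := weq eta teta.
  rewrite [X in _ = X + _ -> _](_ : _ = 0) ?add0r//.
  by rewrite /Rintegral integral0_eq// => x _ /=; rewrite eta0 mulr0.
have sl : {ae lam, forall t, 0 < t < T -> test_closure mu Omega (test_pair Omega) (fun x => ut (x, t)) (fun i x => gt i (x, t))}.
  have [_ _ hs _] := hg.
  apply: (@filterS _ _ (ae_filter_ringOfSetsType lam) _ _ _ hs) => t ht tT.
  have := W12_0_test_closure oOm bOm (ht tT).
  rewrite /ut (QpatchE _ _ tT).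
  have -> : (fun i x => gt i (x, t)) = (fun i => (fun x => g (x, t) 0 i) \_ Omega).
    by apply/funext => i; exact: (QpatchE _ _ tT).
  exact.
have [w [w1 w2 w3 w4]] := @test_closure_evolution _ _ R mu n Omega T nu mOm fOm (ltW hnu) hT ut ft bt gt
  u_out Iu If Ig Ig2 Ib Ib2 (test_pair Omega) (@test_pair_meas R n Omega) (@test_pair_bd R n Omega)
  (@test_pair_out R n Omega) (@test_pair_sub R n Omega) (@test_pair_phi R n Omega) (@test_pair_Phi R n Omega)
  (@weak_cut_of R n Omega T nu b g u f Iu If Ig Ig2 Ib Ib2 weak_eq)
  (@div_cut_of R n Omega T b Ib hdiv) sl.
have L1E (h : 'rV[R]_n -> R) : L1 mu h -> (forall x, ~ Omega x -> h x = 0) ->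
    L1_norm Omega h = (\int[mu]_x `|h x|)%:E.
  move=> Ih h0; rewrite EFin_intR; last exact: L1_abs.
  rewrite /L1_norm [LHS]integral_mkcond; apply: eq_integral => x _; rewrite patchE.
  case: ifPn => // /negP xO; rewrite -[LHS]/(0%:E) h0 ?normr0// => Ox; by apply: xO; rewrite inE.
have L1wE t : 0 <= t <= T -> L1_norm Omega (w t) = (\int[mu]_x `|w t x|)%:E.
  by move=> /w1[Iw wo]; exact: L1E.
exists w.
  split => [t tT|t tT|].
  - have [Iw wo] := w1 _ tT; rewrite /Lp_on.
    have -> : w t \_ Omega = w t.
      apply/funext => x; rewrite patchE; case: ifPn => // /negP xO.
      by rewrite wo// => Ox; apply: xO; rewrite inE.
    exact/Lfun1_integrable.
  - have dE s : 0 <= s <= T ->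
        L1_norm Omega (fun x => w s x - w t x) = (\int[mu]_x `|w s x - w t x|)%:E.
      move=> sT; have [Is so] := w1 _ sT; have [It to_] := w1 _ tT.
      by apply: L1E; [exact: L1B|move=> x Ox; rewrite so// to_// subrr].
    have c : (fun s => (\int[mu]_x `|w s x - w t x|)%:E) @ within `[0, T] (nbhs t) --> 0%:E.
      apply: cvg_EFin; first by apply: nearW.
      apply/cvgr0Pnorm_le => e e0; have [D D0 HD] := w2 _ _ tT e0.
      rewrite near_withinE; exists D => //= s /= st; rewrite in_itv/= => sT.
      by rewrite ger0_norm ?intR_ge0// HD// distrC.
    apply: cvg_trans c; apply: near_eq_cvg; rewrite near_withinE; apply: nearW => s /=.
    by rewrite in_itv/= => /dE ->.
  - apply: (@filterS _ _ (ae_filter_ringOfSetsType lam) _ _ _ w3) => t ht tT.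
    by have := ht tT; apply: filterS => x -> Ox; rewrite /ut patchE mem_set.
move=> t1 t2 t10 t12 t2T.
rewrite !L1wE ?t10 ?(le_trans t12)//; last by rewrite (le_trans t10).
have := w4 _ _ t10 t12 t2T; rewrite -lee_fin EFinD => /le_trans; apply; rewrite leeD2l//.
by rewrite -(integral_window If t10 t2T).
Qed.
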